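(* (i) Let $k\in\{4,5,7,8,9,\ldots\}$ (i.e. $k\geq 4$ and $k\neq 6$) and let $a,b,c$ be positive integers with $a\le b\le c$. Suppose that $ap_k+bp_k+cp_k$ is universal over $\mathbb{Z}$. Then $k=5$ and $(a,b,c)$ is among the following $20$ triples: $$(1,1,c)\ (c\in\{1,2,3,4,5,6,8,9,10\}),\quad (1,2,c)\ (c\in\{2,3,4,6,8\}),$$ $$(1,3,3),\ (1,3,4),\ (1,3,6),\ (1,3,7),\ (1,3,8),\ (1,3,9).$$ (ii) The sums $$p_5+p_5+2p_5,\quad p_5+p_5+4p_5,\quad p_5+2p_5+2p_5,\quad p_5+2p_5+4p_5,\quad p_5+p_5+5p_5,\quad p_5+3p_5+6p_5$$ are universal over $\mathbb{Z}$.
   Context: $\mathbb{N}=\{0,1,2,\ldots\}$. For an integer $m\ge 3$ and $x\in\mathbb{Z}$, $p_m(x)=\frac{(m-2)x^2-(m-4)x}{2}$. For positive integers $a,b,c$ and integers $i,j,k\ge 3$, the sum $ap_i+bp_j+cp_k$ is called universal over $\mathbb{Z}$ if $\{ap_i(x)+bp_j(y)+cp_k(z): x,y,z\in\mathbb{Z}\}=\mathbb{N}$, i.e. every $n\in\mathbb{N}$ can be written as $n=ap_i(x)+bp_j(y)+cp_k(z)$ with $x,y,z\in\mathbb{Z}$ (note $p_m(x)\ge 0$ for all $x\in\mathbb{Z}$). *)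

(* Defs.v *)
From HB Require Import structures.
From mathcomp Require Import all_boot all_order all_algebra.
From mathcomp Require Import ring.

Set Implicit Arguments.
Unset Strict Implicit.
Unset Printing Implicit Defensive.

Import Order.TTheory GRing.Theory Num.Theory.

Local Open Scope ring_scope.

(* The integer division is exact, see [polygonalE]. *)
Definition polygonal (m : nat) (x : int) : int :=
  (((m%:Z - 2) * x ^+ 2 - (m%:Z - 4) * x) %/ 2)%Z.

Lemma polygonalE (m : nat) (x : int) :
  2 * polygonal m x = (m%:Z - 2) * x ^+ 2 - (m%:Z - 4) * x.
Proof.
have even_xx : (2 %| x * (x - 1))%Z.
  rewrite dvdzE abszM; case: (boolP (2 %| `|x|)%N) => [|odd_x].
    exact: dvdn_mulr.
  apply: dvdn_mull; move: odd_x; rewrite !dvdn2 negbK => odd_x.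
  have := divz_eq x 2; have := modz_ge0 x (d := 2) isT.
  have := ltz_pmod x (d := 2) isT.
  have xn0 : (x %% 2)%Z != 0.
    by apply/negP => /eqP/dvdz_mod0P; rewrite dvdzE dvdn2 odd_x.
  case: (x %% 2)%Z xn0 => [[|[|n]]|n] // _ _ _ ->.
  by rewrite addrK abszM oddM andbF.
rewrite mulrC /polygonal divzK //.
have -> : (m%:Z - 2) * x ^+ 2 - (m%:Z - 4) * x
          = (m%:Z - 2) * (x * (x - 1)) + x * 2 by ring.
by apply: rpredD; apply: dvdz_mull.
Qed.

Definition universal (a b c i j k : nat) : Prop :=
  forall n : int,
    (exists x y z : int,
       n = a%:Z * polygonal i x + b%:Z * polygonal j y + c%:Z * polygonal k z)
    <-> 0 <= n.

Definition candidates : seq (nat * nat * nat) :=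
  ([seq (1, 1, c) | c <- [:: 1; 2; 3; 4; 5; 6; 8; 9; 10]]
   ++ [seq (1, 2, c) | c <- [:: 2; 3; 4; 6; 8]]
   ++ [seq (1, 3, c) | c <- [:: 3; 4; 6; 7; 8; 9]])%N.

(* Main.v *)
(* Completing squares, [a p_5 + b p_5 + c p_5] represents [n] as soon as [24 n + a + b + c] is
   [a X^2 + b Y^2 + c Z^2] with [X, Y, Z] prime to 6.  For each of the six triples a linear
   substitution turns this into a representation of an explicit multiple or shift of [n] by a sum
   of three squares; the conditions modulo 3 are then restored by norm-preserving rational
   substitutions with denominator 3.

   Three squares: for squarefree [N] choose [b = q] or [2 q], with [q] a prime (or 1) congruent to
   1 modulo 4, such that [- b] is a square modulo [N] and, by quadratic reciprocity, [N] is a square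
   modulo [b].  A pigeonhole argument solves [z^2 + b t^2 = N w^2], and as [b] is itself a sum of
   two rational squares, [N] is a sum of three rational squares, hence of three integral ones.
   The conditions on [q] only prescribe the values of finitely many real characters, so the part of
   Dirichlet's theorem that concerns real characters suffices.

   The necessity of the list is a finite escalation: a value missed by [p_k] bounds [b], a value
   missed by [p_k + b p_k] bounds [c]; for [k >= 12] the eight sums of subsets of [{a, b, c}] cannot
   cover [0, ..., 8]. *)
Require Import Defs.
From mathcomp Require Import all_boot all_order all_algebra.
From mathcomp Require Import all_fingroup all_solvable all_field.
From mathcomp Require Import ring lra zify.
From mathcomp Require Import boolp classical_sets reals exp Rstruct.

Set Implicit Arguments.
Unset Strict Implicit.
Unset Printing Implicit Defensive.

Import Order.TTheory GRing.Theory Num.Theory.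

Local Open Scope ring_scope.

(** * Real characters *)

(** Only quadratic symbols and residues modulo 8 are imposed on [q], so the weight that detects
    them, a product of factors [1 + f a * f n], expands into real characters alone. Summed against
    Lambda(n)/n, it contains the divergent principal sum once, and everything else is bounded below.
    Mertens' identity reduces this to L(1, f) being nonzero for real [f], which an elementary count
    of squares settles. The condition on [q] modulo 4 serves twice: reciprocity loses its sign, and
    [q] becomes a sum of two rational squares. The residue modulo 8 and the choice between [q] and
    [2 q] adjust the symbol of 2 to each class of [N]. On the pentagonal side, parity follows from
    the residue of the target modulo a power of 2, but primality to 3 does not: coordinates
    divisible by 3 are repaired by dividing 3 out and multiplying by an element of norm 9 that is
    not divisible by 3. For (1, 3, 6) the repair is decided modulo 9, which leaves the exceptional
    residues called [bad]. *)

Lemma abel_bound (R : realDomainType) (f g : nat -> R) (B : R) (m n : nat) :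
    (m <= n)%N ->
    (forall i, (m <= i)%N -> g i.+1 <= g i) -> (forall i, (m <= i)%N -> 0 <= g i) ->
    (forall k, `|\sum_(m <= i < k) f i| <= B) ->
  `|\sum_(m <= i < n) f i * g i| <= B * g m.
Proof.
move=> le_mn g_dec g_ge0 f_bound.
pose S k := \sum_(m <= i < k) f i.
have -> : \sum_(m <= i < n) f i * g i
    = S n * g n + \sum_(m <= i < n) S i.+1 * (g i - g i.+1).
  elim: n le_mn => [|n IHn]; first by rewrite leqn0 => /eqP->; rewrite /S !big_geq // mul0r addr0.
  rewrite leq_eqVlt => /predU1P[<-|lt_mn]; first by rewrite /S !big_geq // mul0r addr0.
  by rewrite !(big_nat_recr n) //= IHn // /S (big_nat_recr n) //=; ring.
have S_bound k : `|S k| <= B := f_bound k.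
have B_ge0 : 0 <= B by apply: le_trans (S_bound 0%N).
apply: le_trans (_ : B * g n + \sum_(m <= i < n) B * (g i - g i.+1) <= _).
  apply: le_trans (ler_normD _ _) _; apply: lerD.
    by rewrite normrM (ger0_norm (g_ge0 _ le_mn)) ler_wpM2r ?g_ge0.
  apply: le_trans (ler_norm_sum _ _ _) _.
  rewrite big_nat_cond [leRHS]big_nat_cond; apply: ler_sum => i /andP[/andP[le_mi _] _].
  have g_sub : 0 <= g i - g i.+1 by rewrite subr_ge0 g_dec.
  by rewrite normrM (ger0_norm g_sub) ler_wpM2r.
rewrite -mulr_sumr.
have -> : \sum_(m <= i < n) (g i - g i.+1) = g m - g n.
  by rewrite -[RHS]opprB -(telescope_sumr g le_mn) -sumrN; apply: eq_bigr => i _; rewrite opprB.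
by rewrite -mulrDr addrC subrK.
Qed.

Definition real_character (R : nzRingType) (M : nat) (f : nat -> R) :=
  [/\ f 1%N = 1, {morph f : a b / (a * b)%N >-> a * b},
      forall n, f (n + M)%N = f n,
      forall n, coprime n M -> f n = 1 \/ f n = -1
    & forall n, ~~ coprime n M -> f n = 0].

Section RealCharacter.
Variables (R : realType) (M : nat) (f : nat -> R).
Hypotheses (M_gt0 : (0 < M)%N) (chf : real_character M f).

Lemma char_mod n : f (n %% M) = f n.
Proof.
case: chf => _ _ fM _ _; rewrite [in RHS](divn_eq n M).
elim: (n %/ M)%N => [|k IHk]; first by rewrite add0n.
by rewrite mulSn -addnA addnC fM.
Qed.

Lemma char_norm n : `|f n| <= 1.
Proof.
case: chf => _ _ _ f1 f0; case: (boolP (coprime n M)) => [/f1[]|/f0] ->.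
- by rewrite normr1.
- by rewrite normrN1.
- by rewrite normr0.
Qed.

Lemma char_dichotomy :
  (forall a, coprime a M -> f a = 1) \/ (exists2 a, coprime a M & f a = -1).
Proof.
case: (boolP [forall a : 'I_M, coprime a M ==> (f a == 1)]).
  move=> /forallP f1; left=> a coaM.
  have lt_aM : (a %% M < M)%N by rewrite ltn_mod.
  have := f1 (Ordinal lt_aM); rewrite /= coprime_modl coaM => /eqP.
  by rewrite char_mod.
rewrite negb_forall => /existsP[a]; rewrite negb_imply => /andP[coaM fa].
right; exists a => //; case: chf => _ _ _ f1 _.
by case: (f1 a coaM) fa => // ->; rewrite eqxx.
Qed.

Section NonPrincipal.
Variable a : nat.
Hypotheses (coaM : coprime a M) (fa : f a = -1).

(** Multiplication by [a] permutes the residues modulo [M] and, as [f a = -1], reverses the sign of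
    the sum. *)
Lemma char_sum_period : \sum_(0 <= i < M) f i = 0.
Proof.
case: chf => _ fM _ _ _.
rewrite big_mkord.
have ltM (i : nat) : (a * i %% M < M)%N by rewrite ltn_mod.
pose h (i : 'I_M) := Ordinal (ltM i).
have inj_h : injective h.
  move=> i j /(congr1 val) /= /eqP.
  wlog le_ij : i j / (j <= i)%N.
    by move=> H; case: (leqP j i) => [/H|/ltnW le_ij] //; rewrite eq_sym => /(H _ _ le_ij).
  rewrite eqn_mod_dvd ?leq_mul // -mulnBr Gauss_dvdr 1?coprime_sym // => dvd_ij.
  apply/val_inj/eqP; rewrite eqn_leq le_ij andbT -subn_eq0.
  apply/eqP; apply: contraTeq dvd_ij; rewrite -lt0n => ij_gt0.
  by rewrite gtnNdvd // (leq_ltn_trans (leq_subr _ _)).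
suff eqS : \sum_(i < M) f i = - \sum_(i < M) f i by lra.
rewrite [LHS](reindex_inj inj_h) -mulN1r -fa mulr_sumr.
by apply: eq_bigr => i _; rewrite /= char_mod fM.
Qed.

(** Full periods cancel, so an initial sum reduces to fewer than [M] terms of norm at most 1; an
    interval is a difference of two initial sums, hence the factor 2. *)
Lemma char_sum_bound m n : `|\sum_(m <= i < n) f i| <= (2 * M)%:R.
Proof.
have init k : `|\sum_(0 <= i < k) f i| <= M%:R.
  elim/ltn_ind: k => k IHk; case: (ltnP k M) => [lt_kM|le_Mk].
    apply: le_trans (ler_norm_sum _ _ _) _.
    apply: le_trans (ler_sum _ (fun i _ => char_norm i)) _.
    by rewrite big_const_nat iter_addr addr0 subn0 ler_nat ltnW.
  rewrite (@big_cat_nat _ _ _ M) //= char_sum_period add0r.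
  rewrite -{1}[M]add0n big_addn.
  under eq_bigr => i _ do rewrite (let: And5 _ _ fp _ _ := chf in fp).
  by apply: IHk; rewrite ltn_subrL M_gt0 (leq_trans M_gt0).
case: (leqP m n) => [le_mn|/ltnW le_nm]; last by rewrite big_geq ?normr0.
have -> : \sum_(m <= i < n) f i = \sum_(0 <= i < n) f i - \sum_(0 <= i < m) f i.
  by rewrite [X in X - _](@big_cat_nat _ _ _ m 0%N n) //=; ring.
apply: le_trans (ler_normB _ _) _.
by rewrite natrM mulr_natl mulr2n lerD.
Qed.

Lemma char_tail_bound m n : (0 < m)%N -> `|\sum_(m <= i < n) f i / i%:R| <= (2 * M)%:R / m%:R.
Proof.
move=> m_gt0; case: (leqP m n) => [le_mn|/ltnW le_nm]; last first.
  by rewrite big_geq ?normr0 ?divr_ge0.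
apply: (@abel_bound R f (fun i => i%:R^-1)) => // [i le_mi|i _|k]; last 2 first.
- by rewrite invr_ge0 ler0n.
- exact: char_sum_bound.
have i_gt0 := leq_trans m_gt0 le_mi.
by rewrite lef_pV2 ?posrE ?ltr0n // ler_nat.
Qed.

(** By the tail bound, the intervals of radius [2 M / n] around the partial sums pairwise intersect,
    so the supremum of their left ends lies in all of them. The later estimates use the explicit
    rate, not mere convergence. *)
Lemma char_L_exists :
  exists L : R, forall n, (0 < n)%N ->
    `|\sum_(1 <= i < n) f i / i%:R - L| <= (2 * M)%:R / n%:R.
Proof.
pose A n := \sum_(1 <= i < n) f i / i%:R.
pose E n := (2 * M)%:R / n%:R : R.
have A_E m n : (0 < m)%N -> (0 < n)%N -> A m - E m <= A n + E n.
  have E_ge0 k : 0 <= E k by rewrite divr_ge0.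
  have Asub k l : (0 < k)%N -> (k <= l)%N -> `|A l - A k| <= E k.
    move=> k_gt0 le_kl; rewrite /A [X in X - _](@big_cat_nat _ _ _ k 1%N l) //= [X in X - _]addrC addrK.
    exact: char_tail_bound.
  move=> m_gt0 n_gt0; case: (leqP m n) => [le_mn|/ltnW le_nm].
    by have := Asub _ _ m_gt0 le_mn; have := E_ge0 n; rewrite ler_norml => ? /andP[? ?]; lra.
  by have := Asub _ _ n_gt0 le_nm; have := E_ge0 m; rewrite ler_norml => ? /andP[? ?]; lra.
pose S := [set x : R | exists2 n, (0 < n)%N & x = A n - E n]%classic.
have Sn n : (0 < n)%N -> S (A n - E n) by exists n.
exists (sup S) => n n_gt0; rewrite -/(A n) -/(E n).
have ubS k : (0 < k)%N -> ubound S (A k + E k) by move=> k_gt0 x [l l_gt0 ->]; apply: A_E.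
have le1 : A n - E n <= sup S.
  by apply: ub_le_sup (Sn _ n_gt0); exists (A 1%N + E 1%N); apply: ubS.
have le2 : sup S <= A n + E n.
  by apply: ge_sup (ubS _ n_gt0); exists (A 1%N - E 1%N); apply: Sn.
by rewrite ler_norml; apply/andP; split; lra.
Qed.

End NonPrincipal.
End RealCharacter.

(** * Elementary bounds for the logarithm *)

Section LogBounds.
Variable R : realType.
Implicit Types x y : R.

Lemma ln_nat_ge0 n : 0 <= ln (n%:R : R).
Proof. by case: n => [|n]; [rewrite ln0 | rewrite ln_ge0 // ler1n]. Qed.

Lemma ln_nat_le n : ln (n%:R : R) <= n%:R.
Proof. by case: n => [|n]; [rewrite ln0 | rewrite ltW // ln_sublinear ?ltr0Sn]. Qed.

Lemma ln_natM m n : (0 < m)%N -> (0 < n)%N -> ln ((m * n)%:R : R) = ln m%:R + ln n%:R.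
Proof. by move=> m_gt0 n_gt0; rewrite natrM lnM // posrE ltr0n. Qed.

Lemma ln_succ_le n : (0 < n)%N -> ln (n.+1%:R : R) <= ln n%:R + n%:R^-1.
Proof.
move=> n_gt0; have nR : 0 < n%:R :> R by rewrite ltr0n.
have nV : 0 < n%:R^-1 :> R by rewrite invr_gt0.
have -> : n.+1%:R = n%:R * (1 + n%:R^-1) :> R by rewrite mulrDr mulr1 divff ?gt_eqF // -natr1.
rewrite lnM ?posrE ?lerD2l; [|lra|lra]; apply: le_ln1Dx; lra.
Qed.

Lemma ln2_ge_half : 1 / 2 <= ln (2 : R).
Proof.
have h : -1 < - (2^-1) :> R by lra.
have := le_ln1Dx h; rewrite (_ : 1 - 2^-1 = 2^-1 :> R); last by field.
by rewrite lnV ?posrE // => ?; lra.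
Qed.

(** The quotient decreases once [ln i >= 1]; the threshold 4 comes from [ln 4 = 2 ln 2] and the
    cheap bound [ln 2 >= 1/2]. *)
Lemma ln_div_decr i : (4 <= i)%N -> ln (i.+1%:R : R) / i.+1%:R <= ln i%:R / i%:R.
Proof.
move=> i4; have i_gt0 : (0 < i)%N by apply: leq_trans i4.
have iR : 0 < i%:R :> R by rewrite ltr0n.
have ln_i : 1 <= ln (i%:R : R).
  have : ln (4%:R : R) <= ln i%:R by rewrite ler_ln ?posrE ?ltr0n ?ler_nat.
  rewrite (_ : 4 = 2 * 2)%N // ln_natM // => ln22; have ln2 := ln2_ge_half.
  clear -ln2 ln22; lra.
have le_ln := ln_succ_le i_gt0.
rewrite ler_pdivlMr // mulrAC ler_pdivrMr ?ltr0Sn // [leRHS]mulrC -[in leRHS]natr1.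
have := ler_wpM2r (ltW iR) le_ln; rewrite mulrDl mulVf ?gt_eqF // => h; lra.
Qed.

Lemma harmonic_ge_ln n : ln (n%:R : R) <= \sum_(1 <= i < n) i%:R^-1.
Proof.
elim: n => [|[|n] IHn]; first by rewrite ln0 // big_geq.
  by rewrite ln1 big_geq.
rewrite big_nat_recr //=; apply: le_trans (ln_succ_le _) _ => //.
by rewrite lerD2r.
Qed.

Lemma ln_nat_unbounded (B : R) : exists2 n, (0 < n)%N & B < ln n%:R.
Proof.
exists (2 ^ (2 * Num.bound `|B|))%N; first by rewrite expn_gt0.
rewrite natrX lnXn // -[ln _ *+ _]mulr_natl natrM.
have B_lt := archi_boundP (normr_ge0 B).
have B_le := ler_norm B; have ln2 := ln2_ge_half.
have b_ge0 : 0 <= (Num.bound `|B|)%:R :> R by rewrite ler0n.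
nra.
Qed.

End LogBounds.

(** * The von Mangoldt function *)

Lemma sum_multiples (V : nmodType) (G : nat -> V) (d x : nat) : (0 < d)%N ->
  \sum_(1 <= n < x.+1 | (d %| n)%N) G n = \sum_(1 <= m < (x %/ d).+1) G (d * m)%N.
Proof.
move=> d_gt0; elim: x => [|x IHx]; first by rewrite div0n !big_geq.
rewrite big_mkcond big_nat_recr //= -big_mkcond IHx divnS //.
case: ifP => [dvd_d|_]; last by rewrite addr0.
rewrite add1n [RHS]big_nat_recr //=; congr (_ + G _).
by have := divnS x d_gt0; rewrite dvd_d add1n => <-; rewrite mulnC divnK.
Qed.

Lemma sum_divisors_swap (V : nmodType) (F : nat -> nat -> V) (x : nat) :
  \sum_(1 <= n < x.+1) \sum_(1 <= d < x.+1 | (d %| n)%N) F d n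
    = \sum_(1 <= d < x.+1) \sum_(1 <= m < (x %/ d).+1) F d (d * m)%N.
Proof.
rewrite (exchange_big_dep_nat predT) //=; apply: eq_big_nat => d /andP[d_gt0 _].
exact: sum_multiples.
Qed.

Section VonMangoldt.
Variable R : realType.

(** [primes n] is a singleton exactly when [n] is a prime power with positive exponent, and its
    entry is then the base. *)
Definition von_mangoldt (n : nat) : R := if primes n is [:: p] then ln p%:R else 0.
Local Notation Lam := von_mangoldt.

Lemma von_mangoldt_ge0 n : 0 <= Lam n.
Proof. by rewrite /Lam; case: (primes n) => [|p []] // *; apply: ln_nat_ge0. Qed.

Lemma von_mangoldt_neq0 n : Lam n != 0 ->
  exists p k, [/\ prime p, (0 < k)%N & n = (p ^ k)%N].
Proof.
rewrite /Lam; case def_n: (primes n) => [|p [|p' s]]; rewrite ?eqxx // => _.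
have : p \in primes n by rewrite def_n inE.
rewrite mem_primes => /and3P[p_pr n_gt0 dvd_pn].
have : p.-nat n by rewrite /pnat n_gt0 def_n /= inE eqxx.
case/p_natP=> k def_k; exists p, k; split=> //.
by case: k def_k dvd_pn => // ->; rewrite expn0 dvdn1 => /eqP p1; rewrite p1 in p_pr.
Qed.

Lemma von_mangoldtX p k : prime p -> (0 < k)%N -> Lam (p ^ k) = ln p%:R.
Proof. by move=> p_pr k_gt0; rewrite /Lam primesX // primes_prime. Qed.

(** Induction on [n = p * n']: among the divisors of [n] that do not divide [n'], the only prime
    power is the full power of [p] in [n], which contributes [ln p]. The bound [x] makes the range
    independent of [n], ready for exchanging sums. *)
Lemma sum_von_mangoldt n x : (0 < n)%N -> (n <= x)%N ->
  \sum_(1 <= d < x.+1 | (d %| n)%N) Lam d = ln n%:R.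
Proof.
elim/ltn_ind: n => n IHn n_gt0 le_nx.
have [n_le1|n_gt1] := leqP n 1.
  have -> : n = 1%N by apply/eqP; rewrite eqn_leq n_le1.
  rewrite ln1 big1 // => d; rewrite dvdn1 => /eqP->; by rewrite /Lam.
pose p := pdiv n; have p_pr : prime p by apply: pdiv_prime.
have p_gt0 := prime_gt0 p_pr; have p_gt1 := prime_gt1 p_pr.
have dvd_pn : (p %| n)%N := pdiv_dvd n.
pose n' := (n %/ p)%N; have def_n : n = (p * n')%N by rewrite mulnC divnK.
have n'_gt0 : (0 < n')%N by move: n_gt0; rewrite def_n muln_gt0 => /andP[].
have lt_n'n : (n' < n)%N by rewrite def_n ltn_Pmull.
rewrite (bigID (fun d => d %| n')%N) /=.
under eq_bigl => d.
  rewrite (_ : _ && _ = (d %| n')%N); last first.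
    by case: (boolP (d %| n')%N) => [dn'|]; rewrite ?andbF // def_n dvdn_mull.
  over.
rewrite IHn ?(leq_trans (ltnW lt_n'n)) // [in RHS]def_n ln_natM // [RHS]addrC; congr (_ + _).
pose v := logn p n; have v_gt0 : (0 < v)%N by rewrite logn_gt0 mem_primes p_pr n_gt0.
have logn' : logn p n' = v.-1 by rewrite /v def_n lognM // (logn_prime p p_pr) eqxx.
have pv_dvd : (p ^ v %| n)%N := pfactor_dvdnn p n.
have pv_ndvd : ~~ (p ^ v %| n')%N by rewrite pfactor_dvdn // logn' -ltnNge prednK.
rewrite -big_filter (bigD1_seq (p ^ v)%N) /=; first last.
- by rewrite filter_uniq // iota_uniq.
- rewrite mem_filter pv_dvd pv_ndvd mem_index_iota expn_gt0 p_gt0 /= ltnS.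
  by rewrite (leq_trans _ le_nx) // dvdn_leq.
rewrite von_mangoldtX // big_filter_cond big1 ?addr0 // => d /andP[/andP[dn ndn'] d_neq].
apply: contraNeq ndn' => /von_mangoldt_neq0[r [k [r_pr k_gt0 def_d]]].
have [eq_rp|neq_rp] := eqVneq r p.
  move: dn d_neq; rewrite def_d eq_rp !pfactor_dvdn // logn' -/v => le_kv neq_kv.
  have : k != v by apply: contraNneq neq_kv => ->.
  by rewrite neq_ltn ltnNge [(v < k)%N]ltnNge le_kv orbF; case: (v) v_gt0 => // m _; rewrite -ltnNge ltnS.
move: dn; rewrite def_n def_d Gauss_dvdr // coprime_pexpl //.
by rewrite prime_coprime // dvdn_prime2.
Qed.

Definition chebyshev_psi x : R := \sum_(1 <= d < x.+1) Lam d.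
Local Notation psi := chebyshev_psi.

Lemma ln_fact n x : (n <= x)%N ->
  ln (n`!%:R : R) = \sum_(1 <= d < x.+1) Lam d * (n %/ d)%:R.
Proof.
move=> le_nx.
transitivity (\sum_(1 <= m < n.+1) ln (m%:R : R)).
  elim: n {le_nx} => [|n IHn]; first by rewrite ln1 big_geq.
  by rewrite factS ln_natM ?fact_gt0 // IHn [RHS]big_nat_recr //= addrC.
have -> : \sum_(1 <= m < n.+1) ln (m%:R : R)
   = \sum_(1 <= m < n.+1) \sum_(1 <= d < x.+1 | (d %| m)%N) Lam d.
  apply: eq_big_nat => m /andP[m_gt0]; rewrite ltnS => le_mn.
  by rewrite sum_von_mangoldt // (leq_trans le_mn).
rewrite (exchange_big_dep_nat predT) //=; apply: eq_big_nat => d /andP[d_gt0 _].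
by rewrite sum_multiples // sumr_const_nat subn1 mulr_natr.
Qed.

(** Chebyshev's argument: the logarithm of the central binomial coefficient is at most [2 n], and it
    is the sum of Lambda(d) times [2 n %/ d - 2 (n %/ d)], a factor that is never negative and
    equals 1 for [n < d <= 2 n]. *)
Lemma psi_double n : psi (2 * n) <= psi n + (2 * n)%:R.
Proof.
have [->|n_gt0] := posnP n; first by rewrite muln0 addr0.
have le2 : (n <= 2 * n)%N by rewrite leq_pmull.
have bin2n : ln ('C(2 * n, n)%:R : R) = ln ((2 * n)`!%:R) - (ln n`!%:R + ln n`!%:R).
  rewrite -(bin_fact le2) mul2n -addnn addnK !ln_natM ?muln_gt0 ?fact_gt0 //; first by ring.
  by rewrite bin_gt0 leq_addr.
rewrite /psi (@big_cat_nat _ _ _ n.+1) //= lerD2l.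
have bin_le : ln ('C(2 * n, n)%:R : R) <= (2 * n)%:R.
  have lt0 : (0 < 'C(2 * n, n))%N by rewrite bin_gt0.
  apply: le_trans (_ : ln ((2 ^ (2 * n))%:R) <= _).
    rewrite ler_ln ?posrE ?ltr0n ?expn_gt0 // ler_nat.
    rewrite -[2%N]/(1 + 1)%N expnDn (bigD1 (inord n)) //= inordK ?ltnS //.
    by rewrite !exp1n !muln1 leq_addr.
  rewrite natrX lnXn // -[ln _ *+ _]mulr_natl ler_piMr //.
  have h : (-1 : R) < 1 by lra.
  by have := le_ln1Dx h.
apply: le_trans bin_le; rewrite bin2n (ln_fact le2) (ln_fact (leqnn _)).
rewrite -big_split -sumrB /= [leRHS](@big_cat_nat _ _ _ n.+1) //=.
rewrite -[leLHS]add0r; apply: lerD.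
  rewrite big_nat_cond; apply: sumr_ge0 => d /andP[/andP[d_gt0 _] _].
  rewrite -mulrDr -mulrBr mulr_ge0 ?von_mangoldt_ge0 // subr_ge0 -natrD ler_nat.
  by rewrite mul2n -addnn divnD // leq_addr.
rewrite big_nat_cond [leRHS]big_nat_cond; apply: ler_sum => d /andP[/andP[lt_nd le_d] _].
rewrite (divn_small lt_nd) mulr0 addr0 subr0 ler_peMr ?von_mangoldt_ge0 // ler1n divn_gt0 //.
exact: leq_trans lt_nd.
Qed.

Lemma psi_succ n : psi n.+1 <= psi n + n.+1%:R.
Proof.
rewrite /psi big_nat_recr //= lerD2l /Lam.
case def_p: (primes _) => [|p [|? ?]] //.
have : p \in primes n.+1 by rewrite def_p inE.
rewrite mem_primes => /and3P[p_pr _ /dvdn_leq-/(_ isT) le_p].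
by apply: le_trans (ln_nat_le _ _) _; rewrite ler_nat.
Qed.

(** Induction on the half [h] of [x]. For odd [x] the last term is bounded crudely by [x], and
    [4 h + 2 h + x <= 4 x] is what calls for the constant 4. *)
Lemma psi_le x : psi x <= (4 * x)%:R.
Proof.
elim/ltn_ind: x => x IHx; have [->|x_gt0] := posnP x; first by rewrite /psi big_geq.
have half_lt : (x./2 < x)%N by rewrite -divn2 ltn_Pdiv.
have IH2 := IHx _ half_lt; have dbl := psi_double x./2.
have def_x := odd_double_half x; rewrite -mul2n in def_x.
apply: le_trans (_ : psi (2 * x./2) + (odd x * x)%:R <= _).
  have := psi_succ (2 * x./2); rewrite -add1n.
  case: (odd x) def_x => def_x; first by rewrite def_x mul1n.
  by rewrite add0n in def_x; rewrite mul0n addr0 def_x.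
apply: le_trans (_ : (4 * x./2)%:R + (2 * x./2)%:R + (odd x * x)%:R <= _).
  by rewrite lerD2r (le_trans dbl) // lerD2r.
by rewrite -!natrD ler_nat; case: (odd x) def_x; lia.
Qed.

Section CharacterSums.
Variables (M : nat) (f : nat -> R).
Hypotheses (M_gt0 : (0 < M)%N) (chf : real_character M f).

(** The logarithm is the Dirichlet convolution of Lambda with 1; complete multiplicativity of [f]
    separates the two factors of [n = d * m]. *)
Lemma char_ln_swap x : \sum_(1 <= n < x.+1) f n * ln n%:R / n%:R
  = \sum_(1 <= d < x.+1) f d * Lam d / d%:R * \sum_(1 <= m < (x %/ d).+1) f m / m%:R.
Proof.
case: chf => _ fM _ _ _.
under [RHS]eq_bigr do rewrite mulr_sumr.
transitivity (\sum_(1 <= n < x.+1) \sum_(1 <= d < x.+1 | (d %| n)%N) f n * Lam d / n%:R).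
  apply: eq_big_nat => n /andP[n_gt0]; rewrite ltnS => le_nx.
  by rewrite -(sum_von_mangoldt n_gt0 le_nx) mulr_sumr mulr_suml.
rewrite (sum_divisors_swap (fun d n => f n * Lam d / n%:R)).
apply: eq_big_nat => d /andP[d_gt0 _]; apply: eq_big_nat => m /andP[m_gt0 _].
have dR : d%:R != 0 :> R by rewrite pnatr_eq0 -lt0n.
have mR : m%:R != 0 :> R by rewrite pnatr_eq0 -lt0n.
by rewrite fM natrM; field; rewrite dR mR.
Qed.

Section NonPrincipal.
Variable a : nat.
Hypotheses (coaM : coprime a M) (fa : f a = -1).

Lemma char_ln_bound : exists C : R, forall n, `|\sum_(1 <= i < n) f i * ln i%:R / i%:R| <= C.
Proof.
pose C := \sum_(1 <= i < 4) `|f i * ln i%:R / i%:R| + (2 * M)%:R * (ln 4%:R / 4%:R).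
exists C => n.
have C2 : 0 <= (2 * M)%:R * (ln (4%:R : R) / 4%:R) by rewrite !mulr_ge0 ?invr_ge0 ?ln_nat_ge0.
have [le_n4|lt_4n] := leqP n 4.
  apply: le_trans (ler_norm_sum _ _ _) _; rewrite /C.
  have [le_n1|lt_1n] := leqP n 1.
    by rewrite big_geq // addr_ge0 // sumr_ge0.
  rewrite [X in _ <= X + _](@big_cat_nat _ _ _ n) //=; last exact: ltnW.
  by rewrite -addrA lerDl addr_ge0 // sumr_ge0.
rewrite (@big_cat_nat _ _ _ 4) //=; last exact: ltnW.
apply: le_trans (ler_normD _ _) _; apply: lerD; first exact: ler_norm_sum.
under eq_bigr do rewrite -mulrA.
apply: (@abel_bound R f (fun i => ln i%:R / i%:R)); first exact: ltnW.
- exact: ln_div_decr.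
- by move=> i _; rewrite divr_ge0 ?ln_nat_ge0.
- by move=> k; apply: (char_sum_bound M_gt0 chf coaM fa).
Qed.

(** Mertens' argument: in [char_ln_swap], replacing each inner sum by its limit [L] costs at most
    [2 M d / x]. Weighted by Lambda(d)/d, these errors total at most [2 M psi(x) / x <= 8 M], so [L]
    times the wanted sum is bounded. *)
Lemma char_von_mangoldt_bound (L : R) : L != 0 ->
    (forall n, (0 < n)%N -> `|\sum_(1 <= i < n) f i / i%:R - L| <= (2 * M)%:R / n%:R) ->
  exists C : R, forall x, `|\sum_(1 <= d < x.+1) f d * Lam d / d%:R| <= C.
Proof.
move=> L_neq0 f_L; have [C C_ln] := char_ln_bound.
exists ((C + (2 * M)%:R * 4) / `|L|) => x.
rewrite ler_pdivlMr ?normr_gt0 // -normrM.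
have [->|x_gt0] := posnP x.
  rewrite big_geq // mul0r normr0 addr_ge0 ?mulr_ge0 //.
  exact: le_trans (C_ln 0%N).
set S := \sum_(_ <= _ < _) _.
have -> : S * L = \sum_(1 <= n < x.+1) f n * ln n%:R / n%:R
    - \sum_(1 <= d < x.+1) f d * Lam d / d%:R *
        (\sum_(1 <= m < (x %/ d).+1) f m / m%:R - L).
  rewrite char_ln_swap -sumrB /S mulr_suml; apply: eq_bigr => d _; ring.
apply: le_trans (ler_normB _ _) _; apply: lerD; first exact: C_ln.
apply: le_trans (ler_norm_sum _ _ _) _.
apply: le_trans (_ : \sum_(1 <= d < x.+1) Lam d * ((2 * M)%:R / x%:R) <= _); last first.
  rewrite -mulr_suml mulrCA ler_wpM2l // -/(psi x) ler_pdivrMr ?ltr0n //.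
  by rewrite -natrM psi_le.
rewrite big_nat_cond [leRHS]big_nat_cond; apply: ler_sum => d /andP[/andP[d_gt0]].
rewrite ltnS => le_dx _.
have dR : 0 < d%:R :> R by rewrite ltr0n.
have xR : 0 < x%:R :> R by rewrite ltr0n.
rewrite !normrM normfV (ger0_norm (von_mangoldt_ge0 d)) [`|d%:R|]ger0_norm //.
apply: le_trans (_ : 1 * Lam d / d%:R * ((2 * M)%:R / (x %/ d).+1%:R) <= _).
  apply: ler_pM; rewrite ?f_L // ?mulr_ge0 ?von_mangoldt_ge0 ?invr_ge0 //.
  by rewrite !ler_wpM2r ?invr_ge0 ?von_mangoldt_ge0 // (char_norm chf).
rewrite mul1r -mulrA ler_wpM2l ?von_mangoldt_ge0 // mulrCA ler_wpM2l //.
rewrite -invfM lef_pV2 ?posrE ?mulr_gt0 ?ltr0n // -natrM ler_nat.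
by rewrite mulnC ltnW // ltn_ceil.
Qed.

End NonPrincipal.
End CharacterSums.
End VonMangoldt.

(** * Nonvanishing of L(1, chi) *)

Section LNonzero.
Variables (R : realType) (M : nat) (f : nat -> R).
Hypotheses (M_gt0 : (0 < M)%N) (chf : real_character M f).

(** The Dirichlet convolution of [f] with 1, that is, the coefficients of zeta(s) L(s, f). *)
Definition divisor_sum (n : nat) : R := \sum_(1 <= d < n.+1 | (d %| n)%N) f d.
Local Notation F := divisor_sum.

Lemma divisor_sum_widen n x : (0 < n)%N -> (n <= x)%N ->
  \sum_(1 <= d < x.+1 | (d %| n)%N) f d = F n.
Proof.
move=> n_gt0 le_nx; rewrite /F (@big_cat_nat _ _ _ n.+1) //= [X in _ + X]big_nat_cond.
rewrite [X in _ + X]big_pred0 ?addr0 // => d.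
by apply/negP => /andP[/andP[lt_nd _] /dvdn_leq-/(_ n_gt0)]; rewrite leqNgt lt_nd.
Qed.

Lemma divisor_sum_step p k m : prime p -> ~~ (p %| m)%N -> (0 < m)%N ->
  F (p ^ k.+1 * m) = F m + f p * F (p ^ k * m).
Proof.
move=> p_pr ndvd m_gt0; have p_gt0 := prime_gt0 p_pr.
case: chf => _ fM _ _ _.
set n := (p ^ k.+1 * m)%N; set n' := (p ^ k * m)%N.
have def_n : n = (p * n')%N by rewrite mulnA -expnS.
have pk_gt0 j : (0 < p ^ j)%N by rewrite expn_gt0 p_gt0.
rewrite /F (bigID (fun d => p %| d)%N) /= addrC; congr (_ + _).
  under eq_bigl => d.
    rewrite (_ : _ && _ = (d %| m)%N); first over.
    apply/andP/idP => [[dn npd]|dm]; last first.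
      by split; [apply: dvdn_mull | apply: contra ndvd => /dvdn_trans->].
    by move: dn; rewrite Gauss_dvdr // coprime_sym coprime_pexpl // prime_coprime.
  by apply: divisor_sum_widen => //; rewrite /n leq_pmull.
under eq_bigl do rewrite andbC.
rewrite big_mkcondr /= sum_multiples // def_n mulKn // mulr_sumr [RHS]big_mkcond /=.
by apply: eq_bigr => d _; rewrite dvdn_pmul2l //; case: ifP; rewrite ?fM.
Qed.

(** By the recursion, [F (p ^ k * m)] is [F m] times [k + 1], or 1, or alternately 1 and 0,
    according to [f p]. An even exponent never loses anything, which is why squares are singled
    out. *)
Lemma divisor_sum_prime_power p k m : prime p -> ~~ (p %| m)%N -> (0 < m)%N -> 0 <= F m ->
  0 <= F (p ^ k * m) /\ (~~ odd k -> F m <= F (p ^ k * m)).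
Proof.
move=> p_pr ndvd m_gt0 Fm; have step j := divisor_sum_step j p_pr ndvd m_gt0.
have fp : [\/ f p = 1, f p = 0 | f p = -1].
  case: chf => _ _ _ f1 f0; case: (boolP (coprime p M)) => [/f1[]|/f0] ->.
  - by constructor 1.
  - by constructor 3.
  - by constructor 2.
case: fp => fp.
- have le_Fm : F m <= F (p ^ k * m).
    elim: k => [|k IHk]; first by rewrite mul1n.
    by rewrite step fp mul1r lerDl (le_trans Fm).
  by split=> //; apply: le_trans le_Fm.
- have -> : F (p ^ k * m) = F m by case: k => [|k]; rewrite ?mul1n // step fp mul0r addr0.
  by split.
- have -> : F (p ^ k * m) = if odd k then 0 else F m.
    elim: k => [|k IHk]; first by rewrite mul1n.
    by rewrite step fp IHk oddS; case: (odd k) => /=; rewrite mulN1r ?oppr0 ?addr0 ?subrr.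
  by case: (odd k).
Qed.

Lemma prime_part n : (1 < n)%N -> exists p k m,
  [/\ prime p, ~~ (p %| m)%N, (0 < m < n)%N & n = (p ^ k * m)%N].
Proof.
move=> n_gt1; have p_pr := pdiv_prime n_gt1; have n_gt0 := ltnW n_gt1.
have [m m_co def_n] := pfactor_coprime p_pr n_gt0.
have m_gt0 : (0 < m)%N by move: n_gt0; rewrite {1}def_n muln_gt0 => /andP[].
exists (pdiv n), (logn (pdiv n) n), m; split=> //.
- by rewrite -prime_coprime.
- rewrite m_gt0 [ltnRHS]def_n ltn_Pmulr // -(expn0 (pdiv n)) ltn_exp2l ?prime_gt1 //.
  by rewrite logn_gt0 mem_primes p_pr n_gt0 pdiv_dvd.
- by rewrite mulnC.
Qed.

Lemma divisor_sum_ge0 n : (0 < n)%N -> 0 <= F n.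
Proof.
elim/ltn_ind: n => n IHn n_gt0; have [n_le1|n_gt1] := leqP n 1.
  have -> : n = 1%N by apply/eqP; rewrite eqn_leq n_le1.
  by case: chf => f1 _ _ _ _; rewrite /F big_mkcond big_nat1 /= f1.
have [p [k [m [p_pr ndvd /andP[m_gt0 lt_mn] def_n]]]] := prime_part n_gt1.
by rewrite {1}def_n; have [] := divisor_sum_prime_power k p_pr ndvd m_gt0 (IHn _ lt_mn m_gt0).
Qed.

Lemma divisor_sum_square n : (0 < n)%N -> 1 <= F (n ^ 2).
Proof.
elim/ltn_ind: n => n IHn n_gt0; have [n_le1|n_gt1] := leqP n 1.
  have -> : n = 1%N by apply/eqP; rewrite eqn_leq n_le1.
  by case: chf => f1 _ _ _ _; rewrite /F big_mkcond big_nat1 /= f1.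
have [p [k [m [p_pr ndvd /andP[m_gt0 lt_mn] def_n]]]] := prime_part n_gt1.
have m2_gt0 : (0 < m ^ 2)%N by rewrite expn_gt0 m_gt0.
have ndvd2 : ~~ (p %| m ^ 2)%N by rewrite Euclid_dvdX // negb_and ndvd.
rewrite {1}def_n expnMn -expnM.
have [_] := divisor_sum_prime_power (k * 2) p_pr ndvd2 m2_gt0 (divisor_sum_ge0 m2_gt0).
by rewrite oddM andbF => /(_ isT); apply: le_trans (IHn _ lt_mn m_gt0).
Qed.

(** Only the squares are kept, where [F] is at least 1. The linear weight decides the comparison to
    come: with a sharp cut-off at [x], the squares number about [x ^ (1/2)] and the same estimate of
    the divisor side is also of order [x ^ (1/2)], a tie. *)
Lemma sum_square_weight y :
  (4 * y%:R ^+ 3 - 4 * y%:R ^+ 2) / 6 <= \sum_(1 <= n < (y ^ 2).+1) F n * ((y ^ 2)%:R - n%:R) :> R.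
Proof.
pose w n : R := (y ^ 2)%:R - n%:R.
have w_ge0 n : (n < (y ^ 2).+1)%N -> 0 <= w n by rewrite ltnS subr_ge0 ler_nat.
apply: le_trans (_ : \sum_(1 <= m < y.+1) w (m ^ 2)%N <= _).
  have -> : \sum_(1 <= m < y.+1) w (m ^ 2)%N
      = y%:R * (y ^ 2)%:R - (y%:R * (y%:R + 1) * (2 * y%:R + 1)) / 6.
    rewrite /w; move: (y ^ 2)%:R => z; elim: y {w w_ge0} => [|y IHy].
      by rewrite big_geq // !mul0r subr0.
    by rewrite big_nat_recr //= IHy natrX -natr1; field.
  (* The sum is [(4 y^3 - 3 y^2 - y) / 6]; bounding [y] by [y^2] gives the stated cubic. *)
  rewrite natrX; have : y%:R <= y%:R ^+ 2 :> R by rewrite -natrX ler_nat; nia.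
  by move: (y%:R : R) => z hz; rewrite ler_pdivrMr //; nra.
have -> : \sum_(1 <= m < y.+1) w (m ^ 2)%N
    = \sum_(1 <= n < (y ^ 2).+1) w n * (\sum_(1 <= m < y.+1 | (m ^ 2 == n)%N) 1).
  under [RHS]eq_bigr do rewrite mulr_sumr.
  rewrite (exchange_big_dep_nat predT) //=; apply: eq_big_nat => m /andP[m_gt0 le_my].
  rewrite -big_filter (bigD1_seq (m ^ 2)%N) /=; first last.
  - by rewrite filter_uniq // iota_uniq.
  - by rewrite mem_filter eqxx mem_index_iota expn_gt0 m_gt0 /= ltnS leq_exp2r.
  rewrite big_filter_cond big_pred0 ?addr0 ?mulr1 // => n.
  by rewrite eq_sym andbN.
rewrite big_nat_cond [leRHS]big_nat_cond; apply: ler_sum => n /andP[/andP[n_gt0 le_n] _].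
rewrite [leRHS]mulrC; apply: ler_wpM2l; first exact: w_ge0.
case: (boolP (has (fun m => m ^ 2 == n)%N (index_iota 1 y.+1))) => [|/hasPn no_m].
  case/hasP=> m m_in /eqP def_n; rewrite -def_n.
  have m_gt0 : (0 < m)%N by move: m_in; rewrite mem_index_iota => /andP[].
  rewrite -big_filter (bigD1_seq m) /=; first last.
  - by rewrite filter_uniq // iota_uniq.
  - by rewrite mem_filter eqxx.
  rewrite big_filter_cond big_pred0 ?addr0 ?divisor_sum_square // => j.
  by rewrite eqn_exp2r // andbN.
rewrite big_seq_cond big_pred0 ?divisor_sum_ge0 // => m.
by apply/negP=> /andP[/no_m/negP].
Qed.

Lemma sum_weight_swap x :
  \sum_(1 <= n < x.+1) F n * (x%:R - n%:R)
    = \sum_(1 <= d < x.+1) f d * \sum_(1 <= m < (x %/ d).+1) (x%:R - (d * m)%:R).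
Proof.
transitivity (\sum_(1 <= n < x.+1) \sum_(1 <= d < x.+1 | (d %| n)%N) f d * (x%:R - n%:R)).
  apply: eq_big_nat => n /andP[n_gt0]; rewrite ltnS => le_nx.
  by rewrite -(divisor_sum_widen n_gt0 le_nx) mulr_suml.
rewrite (sum_divisors_swap (fun d n => f d * (x%:R - n%:R))).
by apply: eq_bigr => d _; rewrite mulr_sumr.
Qed.

End LNonzero.

Section Weights.
Variable R : realFieldType.

Definition mweight (x d : nat) : R := \sum_(1 <= m < (x %/ d).+1) (x%:R - (d * m)%:R).

Lemma mweight_term_ge0 x d m : (m <= x %/ d)%N -> 0 <= x%:R - (d * m)%:R :> R.
Proof.
move=> le_m; rewrite subr_ge0 ler_nat; apply: leq_trans (leq_trunc_div x d).
by rewrite mulnC leq_mul2r le_m orbT.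
Qed.

Lemma mweight_ge0 x d : 0 <= mweight x d.
Proof.
rewrite /mweight big_nat_cond; apply: sumr_ge0 => m /andP[/andP[_ le_m] _].
exact: mweight_term_ge0.
Qed.

Lemma mweight_le x d : (0 < d)%N -> mweight x d <= (x %/ d)%:R * x%:R.
Proof.
move=> d_gt0; apply: le_trans (_ : \sum_(1 <= m < (x %/ d).+1) x%:R <= _).
  by apply: ler_sum => m _; rewrite gerBl.
by rewrite sumr_const_nat subn1 mulr_natl.
Qed.

Lemma mweight_decr x d : (0 < d)%N -> mweight x d.+1 <= mweight x d.
Proof.
move=> d_gt0; have le_div : (x %/ d.+1 <= x %/ d)%N by rewrite leq_div2l.
rewrite /mweight [leRHS](@big_cat_nat _ _ _ (x %/ d.+1).+1) //= -[leLHS]addr0; apply: lerD.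
  by apply: ler_sum => m _; rewrite lerD2l lerN2 ler_nat leq_mul2r leqnSn orbT.
rewrite big_nat_cond; apply: sumr_ge0 => m /andP[/andP[_ le_m] _].
exact: mweight_term_ge0.
Qed.

(** With [x = k d + r] the error is exactly [r (d - r) / (2 d)]. *)
Lemma mweight_approx x d : (0 < d)%N ->
  `|mweight x d - (x%:R ^+ 2 / 2 / d%:R - x%:R / 2)| <= d%:R.
Proof.
move=> d_gt0; pose k := (x %/ d)%N; pose r := (x %% d)%N.
have dR : 0 < d%:R :> R by rewrite ltr0n.
have r_ge0 : 0 <= r%:R :> R by rewrite ler0n.
have r_lt : r%:R <= d%:R :> R by rewrite ler_nat ltnW // ltn_mod.
have -> : mweight x d = k%:R * x%:R - d%:R * (k%:R * (k%:R + 1) / 2).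
  rewrite /mweight -/k; elim: (k) => [|j IHj]; first by rewrite big_geq // !mul0r mulr0 subr0.
  by rewrite big_nat_recr //= IHj natrM -natr1; field.
have def_x : x%:R = k%:R * d%:R + r%:R :> R by rewrite -natrM -natrD -divn_eq.
rewrite def_x; move: (k%:R : R) (r%:R : R) (d%:R : R) dR r_ge0 r_lt => K r' D D_gt0 r_ge0 r_lt.
have -> : K * (K * D + r') - D * (K * (K + 1) / 2)
    - ((K * D + r') ^+ 2 / 2 / D - (K * D + r') / 2) = r' * (D - r') / (2 * D).
  by field; rewrite gt_eqF.
have D2 : 0 < 2 * D by lra.
rewrite ger0_norm; last by rewrite divr_ge0 ?mulr_ge0 //; lra.
by rewrite ler_pdivrMr //; nra.
Qed.

End Weights.

Section LNonzero2.
Variables (R : realType) (M : nat) (f : nat -> R) (a : nat).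
Hypotheses (M_gt0 : (0 < M)%N) (chf : real_character M f).
Hypotheses (coaM : coprime a M) (fa : f a = -1).

(* If [L = 0], evaluating [sum_(n <= x) F n * (x - n)] through the divisors of [n] gives
   [O(x ^ (4/3))], whereas the squares alone contribute at least a constant times [x ^ (3/2)].
   Here [x = s ^ 6], and the divisors are cut at [D = s ^ 4]. *)
Lemma char_L_neq0 (L : R) :
    (forall n, (0 < n)%N -> `|\sum_(1 <= i < n) f i / i%:R - L| <= (2 * M)%:R / n%:R) ->
  L != 0.
Proof.
move=> f_L; apply/eqP=> L0; rewrite {}L0 in f_L.
(* This choice makes [4 S / 6 = 4 M + 8/3], so the squares give at least [(4 M + 2) S^8], while the
   four parts of the divisor side total at most [(4 M + 1) S^8]. The cut [D = x ^ (2/3)] balances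
   [x^2 / D] against [D^2]. *)
pose s := (6 * M + 4)%N; pose y := (s ^ 3)%N; pose D := (s ^ 4)%N; pose x := (y ^ 2)%N.
have s_gt0 : (0 < s)%N by rewrite addn_gt0 orbT.
have lower := sum_square_weight M_gt0 chf y; rewrite -/x sum_weight_swap in lower.
have D_gt0 : (0 < D)%N by rewrite expn_gt0 s_gt0.
have def_x : x = (D * s ^ 2)%N by rewrite /x /y /D -expnM -expnD.
have le_Dx : (D <= x)%N by rewrite def_x leq_pmulr // expn_gt0 s_gt0.
pose S : R := s%:R.
have MR : 1 <= M%:R :> R by rewrite ler1n.
have S_def : S = 6 * M%:R + 4 by rewrite /S natrD natrM.
have xS : x%:R = S ^+ 6 :> R by rewrite /x /y -expnM natrX.
have DS : D%:R = S ^+ 4 :> R by rewrite natrX.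
have S_gt0 : 0 < S by rewrite ltr0n.
have upper1 : `|\sum_(D.+1 <= d < x.+1) f d * mweight R x d| <= 2 * M%:R * S ^+ 8.
  apply: le_trans (_ : (2 * M)%:R * mweight R x D.+1 <= _).
    apply: abel_bound => // [i lt_Di|i _|k].
    - by apply: mweight_decr; apply: leq_trans lt_Di.
    - exact: mweight_ge0.
    - exact: (char_sum_bound M_gt0 chf coaM fa).
  rewrite natrM ler_wpM2l ?mulr_ge0 //; apply: le_trans (mweight_le R x (ltn0Sn D)) _.
  rewrite xS (_ : S ^+ 8 = (s ^ 2)%:R * S ^+ 6); last by rewrite natrX -exprD.
  rewrite ler_wpM2r ?exprn_ge0 ?(ltW S_gt0) // ler_nat.
  apply: leq_trans (leq_div2l _ D_gt0 (leqnSn D)) _.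
  by rewrite def_x mulKn.
pose E d := mweight R x d - (x%:R ^+ 2 / 2 / d%:R - x%:R / 2).
have split1 : \sum_(1 <= d < D.+1) f d * mweight R x d
  = x%:R ^+ 2 / 2 * \sum_(1 <= d < D.+1) f d / d%:R
    - x%:R / 2 * \sum_(1 <= d < D.+1) f d + \sum_(1 <= d < D.+1) f d * E d.
  rewrite !mulr_sumr -sumrB -big_split /=; apply: eq_bigr => d _; rewrite /E; ring.
have part1 : `|x%:R ^+ 2 / 2 * \sum_(1 <= d < D.+1) f d / d%:R| <= M%:R * S ^+ 8.
  rewrite normrM ger0_norm ?divr_ge0 ?exprn_ge0 //.
  have := f_L D.+1 isT; rewrite subr0 => fD.
  apply: le_trans (_ : x%:R ^+ 2 / 2 * ((2 * M)%:R / D%:R) <= _).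
    rewrite ler_wpM2l ?divr_ge0 ?exprn_ge0 //; apply: le_trans fD _.
    by rewrite ler_wpM2l // lef_pV2 ?posrE ?ltr0n // ler_nat.
  by rewrite xS DS natrM le_eqVlt; apply/orP; left; apply/eqP; field; rewrite gt_eqF.
have part2 : `|x%:R / 2 * \sum_(1 <= d < D.+1) f d| <= M%:R * S ^+ 8.
  rewrite normrM ger0_norm ?divr_ge0 //.
  apply: le_trans (_ : x%:R / 2 * (2 * M)%:R <= _).
    by rewrite ler_wpM2l ?divr_ge0 // (char_sum_bound M_gt0 chf coaM fa).
  have S1 : 1 <= S by rewrite ler1n.
  rewrite xS natrM (_ : S ^+ 6 / 2 * (2 * M%:R) = M%:R * S ^+ 6); last by field.
  by rewrite ler_wpM2l // ler_weXn2l.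
have part3 : `|\sum_(1 <= d < D.+1) f d * E d| <= S ^+ 8.
  apply: le_trans (ler_norm_sum _ _ _) _.
  apply: le_trans (_ : \sum_(1 <= d < D.+1) D%:R <= _); last first.
    by rewrite sumr_const_nat subn1 -[leLHS]mulr_natr DS -exprD.
  rewrite big_nat_cond [leRHS]big_nat_cond; apply: ler_sum => d /andP[/andP[d_gt0 le_dD] _].
  rewrite normrM -[leRHS]mul1r; apply: ler_pM => //; first exact: (char_norm chf).
  by apply: le_trans (mweight_approx R x d_gt0) _; rewrite ler_nat.
have upper : \sum_(1 <= d < x.+1) f d * mweight R x d <= (4 * M%:R + 1) * S ^+ 8.
  rewrite (@big_cat_nat _ _ _ D.+1) //= split1.
  move: part1 part2 part3 upper1; rewrite !ler_norml.
  by move=> /andP[? ?] /andP[? ?] /andP[? ?] /andP[? ?]; lra.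
have := le_trans lower upper.
have -> : y%:R = S ^+ 3 :> R by rewrite natrX.
have S8 : 0 < S ^+ 8 by rewrite exprn_gt0.
have S68 : S ^+ 6 <= S ^+ 8 by rewrite ler_weXn2l // ler1n.
rewrite -!exprM -[(3 * 3)%N]/(8 + 1)%N exprD expr1 -[(3 * 2)%N]/6%N S_def.
nra.
Qed.

End LNonzero2.

(** * Primes with prescribed quadratic characters *)

Lemma real_characterM (R : comNzRingType) M (f g : nat -> R) :
  real_character M f -> real_character M g -> real_character M (fun n => f n * g n).
Proof.
case=> f1 fM fp fu f0 [g1 gM gp gu g0]; split=> [|a b|n|n con|n ncon].
- by rewrite f1 g1 mulr1.
- by rewrite fM gM mulrACA.
- by rewrite fp gp.
- by case: (fu n con) (gu n con) => -> [] ->; rewrite ?mulrNN ?mulr1 ?mul1r; [left|right|right|left].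
- by rewrite f0 // mul0r.
Qed.

Section Existence.
Variables (R : realType) (M : nat).
Hypothesis M_gt0 : (0 < M)%N.
Implicit Types (f g : nat -> R) (cs : seq (nat -> R)).

Definition principal_char (n : nat) : R := (coprime n M)%:R.
Local Notation chi0 := principal_char.
Local Notation Lam := (@von_mangoldt R).

Lemma principal_char_real : real_character M chi0.
Proof.
split=> [|a b|n|n con|n ncon]; rewrite /chi0.
- by rewrite coprime1n.
- by rewrite coprimeMl -natrM mulnb.
- by rewrite -coprime_modl modnDr coprime_modl.
- by left; rewrite con.
- by rewrite (negbTE ncon).
Qed.

Lemma chi0_ge0 n : 0 <= chi0 n. Proof. exact: ler0n. Qed.

(** In each block of [M] integers, the term [J * M + 1] is prime to [M], and its reciprocal is at
    least that of [M * (J + 1)]. *)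
Lemma principal_harmonic_ge J :
  M%:R^-1 * (\sum_(1 <= j < J.+1) j%:R^-1) <= \sum_(1 <= n < (J * M).+1) chi0 n / n%:R.
Proof.
elim: J => [|J IHJ]; first by rewrite !big_geq // mulr0.
rewrite big_nat_recr //= mulrDr [leRHS](@big_cat_nat _ _ _ (J * M).+1) //=; last first.
  by rewrite ltnS leq_mul2r leqnSn orbT.
apply: lerD => //; rewrite big_ltn; last by rewrite ltnS ltn_mul2r M_gt0 ltnSn.
rewrite -[leLHS]addr0; apply: lerD; last first.
  by apply: sumr_ge0 => n _; rewrite divr_ge0 ?chi0_ge0.
rewrite /chi0 -[in X in coprime X]addn1 coprime_sym /coprime gcdnMDl gcdn1 mul1r -invfM -natrM.
by rewrite lef_pV2 ?posrE ?ltr0n ?muln_gt0 ?M_gt0 ?addn1 // ler_nat; nia.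
Qed.

(** If [B] were a bound, [char_ln_swap] would make the sums of [chi0 n * (ln n - B) / n]
    nonpositive. But beyond [ln n > B + 1] these terms dominate [chi0 n / n], whose sum diverges. *)
Lemma principal_von_mangoldt_unbounded (B : R) :
  ~ (forall x, \sum_(1 <= d < x.+1) chi0 d * Lam d / d%:R <= B).
Proof.
move=> S_le; pose A x := \sum_(1 <= m < x.+1) chi0 m / m%:R.
have t_ge0 m : 0 <= chi0 m / m%:R by rewrite divr_ge0 ?chi0_ge0.
have A_mono x y : (x <= y)%N -> A x <= A y.
  by move=> le_xy; rewrite /A [leRHS](@big_cat_nat _ _ _ x.+1) //= lerDl sumr_ge0.
have A_ge0 x : 0 <= A x by apply: sumr_ge0.
have lnA x : \sum_(1 <= n < x.+1) chi0 n * (ln n%:R - B) / n%:R <= 0.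
  have -> : \sum_(1 <= n < x.+1) chi0 n * (ln n%:R - B) / n%:R
      = \sum_(1 <= n < x.+1) chi0 n * ln n%:R / n%:R - B * A x.
    by rewrite mulr_sumr -sumrB; apply: eq_bigr => n _; ring.
  rewrite subr_le0 (char_ln_swap principal_char_real).
  apply: le_trans (_ : \sum_(1 <= d < x.+1) chi0 d * Lam d / d%:R * A x <= _).
    apply: ler_sum => d _; apply: ler_wpM2l; last exact/A_mono/leq_div.
    by rewrite !mulr_ge0 ?chi0_ge0 ?von_mangoldt_ge0 ?invr_ge0.
  by rewrite -mulr_suml ler_wpM2r.
have [n0 n0_gt0 ln_n0] := @ln_nat_unbounded R (B + 1).
pose K := - \sum_(1 <= n < n0) chi0 n * (ln n%:R - B) / n%:R + A n0.
have A_le x : A x <= K.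
  have le_x : (n0 <= (x + n0).+1)%N by rewrite leqW // leq_addl.
  have h0 := lnA (x + n0)%N; rewrite (@big_cat_nat _ _ _ n0) //= in h0.
  apply: le_trans (A_mono _ (x + n0)%N (leq_addr _ _)) _.
  have : \sum_(n0 <= n < (x + n0).+1) chi0 n / n%:R
      <= \sum_(n0 <= n < (x + n0).+1) chi0 n * (ln n%:R - B) / n%:R.
    rewrite big_nat_cond [leRHS]big_nat_cond; apply: ler_sum => n /andP[/andP[le_n _] _].
    have n_gt0 := leq_trans n0_gt0 le_n.
    rewrite mulrAC ler_peMr //.
    have : ln (n0%:R : R) <= ln n%:R by rewrite ler_ln ?posrE ?ltr0n ?ler_nat.
    by move=> h; lra.
  have : A (x + n0)%N <= A n0 + \sum_(n0 <= n < (x + n0).+1) chi0 n / n%:R.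
    rewrite /A (@big_cat_nat _ _ _ n0) //= lerD2r.
    by rewrite [leRHS]big_nat_recr //= lerDl.
  by rewrite /K => h1 h2; lra.
have [n n_gt0 ln_n] := @ln_nat_unbounded R (M%:R * K).
have := principal_harmonic_ge n; rewrite -/(A (n * M)%N) leNgt => /negP; apply.
apply: le_lt_trans (A_le _) _.
have MR : 0 < M%:R :> R by rewrite ltr0n.
rewrite mulrC ltr_pdivlMr // mulrC; apply: lt_le_trans ln_n _.
apply: le_trans (harmonic_ge_ln R n) _.
by rewrite [leRHS]big_nat_recr //= lerDl invr_ge0.
Qed.

Lemma nonprincipal_von_mangoldt_bound f a : real_character M f ->
    coprime a M -> f a = -1 ->
  exists C : R, forall x, `|\sum_(1 <= d < x.+1) f d * Lam d / d%:R| <= C.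
Proof.
move=> chf coaM fa; have [L f_L] := char_L_exists M_gt0 chf coaM fa.
apply: (char_von_mangoldt_bound M_gt0 chf coaM fa _ f_L).
exact: (char_L_neq0 M_gt0 chf coaM fa f_L).
Qed.

Section Pattern.
Variables (a : nat) (coaM : coprime a M).

(* Up to the factor [principal_char], a multiple of the indicator function of the [n] on which all
   the characters of [cs] take the same values as on [a]. *)
Definition pattern_weight cs (n : nat) : R := \prod_(f <- cs) (1 + f a * f n).
Local Notation W := pattern_weight.

(** The extra character [g] closes the induction: the factor [1 + f a * f n] replaces [g] by [g] and
    [f g]. Only a lower bound can be claimed, since such a product may be principal, and then its
    sum diverges upwards. *)
Lemma pattern_sum_bounded_below cs g : (forall f, List.In f cs -> real_character M f) ->
    real_character M g ->
  exists C : R, forall x, - C <= \sum_(1 <= d < x.+1) W cs d * (g a * g d) * Lam d / d%:R.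
Proof.
elim: cs g => [|f cs IHcs] g ch_cs ch_g.
  have [g1|[b cobM gb]] := char_dichotomy M_gt0 ch_g.
    exists 0 => x; rewrite oppr0; apply: sumr_ge0 => d _.
    rewrite /W big_nil mul1r g1 // mul1r !mulr_ge0 ?von_mangoldt_ge0 ?invr_ge0 //.
    case: ch_g => _ _ _ _ g0; case: (boolP (coprime d M)) => [/g1->|/g0->] //.
  have [C C_bound] := nonprincipal_von_mangoldt_bound ch_g cobM gb.
  exists C => x.
  have -> : \sum_(1 <= d < x.+1) W [::] d * (g a * g d) * Lam d / d%:R
      = g a * \sum_(1 <= d < x.+1) g d * Lam d / d%:R.
    by rewrite mulr_sumr; apply: eq_bigr => d _; rewrite /W big_nil mul1r; ring.
  have : `|g a * \sum_(1 <= d < x.+1) g d * Lam d / d%:R| <= C.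
    rewrite normrM; apply: le_trans (C_bound x).
    by rewrite ler_piMl // (char_norm ch_g).
  by rewrite ler_norml => /andP[].
have ch_f : real_character M f by apply: ch_cs; left.
have ch_cs' h : List.In h cs -> real_character M h by move=> h_in; apply: ch_cs; right.
have [C1 C1P] := IHcs g ch_cs' ch_g.
have [C2 C2P] := IHcs _ ch_cs' (real_characterM ch_f ch_g).
exists (C1 + C2) => x; rewrite opprD; apply: le_trans (lerD (C1P x) (C2P x)) _.
rewrite -big_split /= le_eqVlt; apply/orP; left; apply/eqP; apply: eq_bigr => d _.
by rewrite /W big_cons; ring.
Qed.

(** The term 1 of the expanded product yields the principal sum; every other term falls under
    [pattern_sum_bounded_below]. *)
Lemma pattern_sum_ge_principal cs : (forall f, List.In f cs -> real_character M f) ->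
  exists C : R, forall x, \sum_(1 <= d < x.+1) chi0 d * Lam d / d%:R - C
     <= \sum_(1 <= d < x.+1) W cs d * chi0 d * Lam d / d%:R.
Proof.
elim: cs => [|f cs IHcs] ch_cs.
  by exists 0 => x; rewrite subr0; apply: ler_sum => d _; rewrite /W big_nil mul1r.
have ch_f : real_character M f by apply: ch_cs; left.
have ch_cs' h : List.In h cs -> real_character M h by move=> h_in; apply: ch_cs; right.
have [C1 C1P] := IHcs ch_cs'.
have [C2 C2P] := pattern_sum_bounded_below ch_cs' ch_f.
exists (C1 + C2) => x; rewrite opprD addrA; apply: le_trans (lerD (C1P x) (C2P x)) _.
rewrite -big_split /= le_eqVlt; apply/orP; left; apply/eqP; apply: eq_bigr => d _.
rewrite /W big_cons /chi0; case: (boolP (coprime d M)) => [_ /=|ncod]; first by ring.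
by have [_ _ _ _ f0] := ch_f; rewrite (f0 d ncod) !(mulr0, mul0r, addr0).
Qed.

(* The value [q = 1] absorbs the even prime powers, on which every real character is trivial; no
   bound on the contribution of the higher prime powers is then needed. *)
Lemma exists_prime_or_one_with_pattern cs : (forall f, List.In f cs -> real_character M f) ->
  exists q, [/\ q = 1%N \/ prime q, coprime q M & forall f, List.In f cs -> f q = f a].
Proof.
move=> ch_cs; have [C C_le] := pattern_sum_ge_principal ch_cs.
have [x] : exists x, 0 < \sum_(1 <= d < x.+1) W cs d * chi0 d * Lam d / d%:R.
  apply: contrapT => no_x; apply: (@principal_von_mangoldt_unbounded C) => x.
  rewrite -subr_le0; apply: le_trans (C_le x) _; rewrite leNgt; apply/negP => x_gt0.
  by apply: no_x; exists x.
move=> S_gt0.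
have [d d_neq0] : exists d, W cs d * chi0 d * Lam d / d%:R != 0.
  apply: contrapT => all0; move: S_gt0; rewrite big1 ?ltxx // => d _.
  by apply/eqP; apply: contraPT isT => d_neq0 _; apply: all0; exists d.
move: d_neq0; rewrite !mulf_eq0 !negb_or => /andP[/andP[/andP[W_neq0 chi_neq0] Lam_neq0] _].
have cod : coprime d M.
  by move: chi_neq0; rewrite /chi0; case: (coprime d M) => //; rewrite eqxx.
have fd f : List.In f cs -> f d = f a.
  move=> f_in; have [_ _ _ fu _] := ch_cs f f_in.
  have : 1 + f a * f d != 0.
    elim: cs W_neq0 f_in {C ch_cs C_le S_gt0} => //= h cs IHcs.
    rewrite /W big_cons mulf_eq0 negb_or => /andP[h_neq0 W_neq0] [<- //|]; exact: IHcs.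
  by case: (fu a coaM) (fu d cod) => -> [] -> //; rewrite ?mul1r ?mulr1 subrr eqxx.
have [p [k [p_pr k_gt0 def_d]]] := von_mangoldt_neq0 Lam_neq0.
have cop : coprime p M by move: cod; rewrite def_d coprime_pexpl.
have fX f j : real_character M f -> f (p ^ j)%N = f p ^+ j.
  by case=> f1 fM _ _ _; elim: j => [|j IHj]; rewrite ?f1 // expnS fM IHj exprS.
have f2 f : real_character M f -> f p ^+ 2 = 1.
  by case=> _ _ _ fu _; case: (fu p cop) => ->; rewrite ?sqrrN expr1n.
case: (boolP (odd k)) => [odd_k|even_k].
  exists p; split=> //; first by right.
  move=> f f_in; rewrite -(fd f f_in) def_d fX; last exact: ch_cs.
  rewrite -(odd_double_half k) odd_k -mul2n exprD exprM f2 ?expr1n ?mulr1 //.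
  exact: ch_cs.
exists 1%N; split=> //; first by left.
  by rewrite coprime1n.
move=> f f_in; rewrite -(fd f f_in) def_d fX; last exact: ch_cs.
rewrite -(odd_double_half k) (negbTE even_k) -mul2n add0n exprM f2 ?expr1n //; last exact: ch_cs.
by case: (ch_cs f f_in).
Qed.

End Pattern.
End Existence.

(** * Legendre symbol and quadratic reciprocity *)

Section FiniteFieldUnits.
Variable F : finFieldType.

Lemma expf_cardB1 (x : F) : x != 0 -> x ^+ #|F|.-1 = 1.
Proof.
move=> x_neq0; have := expf_card x; have := finRing_gt1 F.
by case: #|F| => // n _; rewrite exprS -[RHS]mulr1 => /(mulfI x_neq0).
Qed.

Lemma finField_prim_root d : (0 < d)%N -> (d %| #|F|.-1)%N -> exists z : F, d.-primitive_root z.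
Proof.
move=> d_gt0 /dvdnP[k def_n]; have n_gt0 : (0 < #|F|.-1)%N by have := finRing_gt1 F; case: #|F|.
have /hasP[z _ z_prim] : has #|F|.-1.-primitive_root [seq x <- enum F | x != 0].
  apply: has_prim_root => //; last 2 first.
  - by rewrite filter_uniq ?enum_uniq.
  - have <- : #|predC1 (0 : F)| = #|F|.-1 by rewrite cardC1.
    by rewrite cardE -(eq_filter (a1 := predC1 0)) // {1}enumT.
  by apply/allP => x; rewrite mem_filter unity_rootE => /andP[/expf_cardB1-> _].
have d_dvd : (k %| #|F|.-1)%N by rewrite def_n dvdn_mulr.
exists (z ^+ k); have := exp_prim_root z_prim k.
rewrite (gcdn_idPl d_dvd) def_n mulKn //.
by rewrite def_n muln_gt0 in n_gt0; case/andP: n_gt0.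
Qed.

Lemma euler_criterion (x : F) : odd #|F| -> x != 0 -> x ^+ (#|F|.-1./2) = 1 ->
  exists y, x = y ^+ 2.
Proof.
move=> F_odd x_neq0 x_half; have n_gt0 : (0 < #|F|.-1)%N by have := finRing_gt1 F; case: #|F|.
have [z z_prim] := finField_prim_root n_gt0 (dvdnn _).
have [[i /= _] def_x] := prim_rootP z_prim (expf_cardB1 x_neq0).
have F_even : #|F|.-1 = (#|F|.-1./2 * 2)%N.
  by rewrite muln2 even_halfK //; case: #|F| F_odd.
have half_gt0 : (0 < #|F|.-1./2)%N by rewrite F_even muln_gt0 in n_gt0; case/andP: n_gt0.
move/eqP: x_half; rewrite def_x -exprM -(prim_order_dvd z_prim) {1}F_even.
rewrite [(i * _)%N]mulnC dvdn_pmul2l // => /dvdnP[j def_i].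
by exists (z ^+ j); rewrite -exprM -def_i.
Qed.

End FiniteFieldUnits.

Section Legendre.
Variable p : nat.
Hypotheses (p_pr : prime p) (p_odd : odd p).

Definition legendre (x : 'F_p) : int :=
  if x == 0 then 0 else if x ^+ p.-1./2 == 1 then 1 else -1.

Lemma even_half_predp : p.-1 = (p.-1./2 * 2)%N.
Proof. by rewrite muln2 even_halfK //; case: p p_odd. Qed.

Lemma Fp_half_sq (x : 'F_p) : x != 0 -> x ^+ p.-1./2 = 1 \/ x ^+ p.-1./2 = -1.
Proof.
move=> x_neq0; have : (x ^+ p.-1./2) ^+ 2 == 1.
  by rewrite -exprM -even_half_predp -[in p.-1](card_Fp p_pr) expf_cardB1.
by rewrite sqrf_eq1 => /orP[] /eqP->; [left | right].
Qed.

Lemma Fp_neqN1 : (1 : 'F_p) != -1.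
Proof.
rewrite -subr_eq0 opprK -[1 + 1]/(2%:R) -(dvdn_pcharf (pchar_Fp p_pr)).
by rewrite dvdn_prime2 //; apply: contraTneq p_odd => ->.
Qed.

Lemma legendreE (x : 'F_p) : (legendre x)%:~R = x ^+ p.-1./2.
Proof.
rewrite /legendre; have [->|x_neq0] := eqVneq x 0.
  by rewrite expr0n; case: p p_pr p_odd => [|[|[|n]]].
by case: (Fp_half_sq x_neq0) => ->; rewrite ?eqxx // eq_sym (negbTE Fp_neqN1).
Qed.

Lemma legendre_pm1 (x : 'F_p) : x != 0 -> legendre x = 1 \/ legendre x = -1.
Proof. by rewrite /legendre => /negbTE->; case: ifP; [left | right]. Qed.

Lemma pm1_Fp_inj (e e' : int) : e = 1 \/ e = -1 -> e' = 1 \/ e' = -1 ->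
  e%:~R = e'%:~R :> 'F_p -> e = e'.
Proof.
by move=> [] -> [] -> //; rewrite mulrNz mulr1z; [move/eqP | move/esym/eqP]; rewrite (negbTE Fp_neqN1).
Qed.

Lemma legendre0 : legendre 0 = 0.
Proof. by rewrite /legendre eqxx. Qed.

Lemma legendreM : {morph legendre : x y / x * y}.
Proof.
move=> x y; have [->|x_neq0] := eqVneq x 0; first by rewrite !(mul0r, legendre0).
have [->|y_neq0] := eqVneq y 0; first by rewrite !(mulr0, legendre0).
have xy_neq0 : x * y != 0 by rewrite mulf_neq0.
apply: pm1_Fp_inj; first exact: legendre_pm1.
  by case: (legendre_pm1 x_neq0) (legendre_pm1 y_neq0) => -> [] ->; [left|right|right|left].
by rewrite rmorphM /= !legendreE exprMn.
Qed.

Lemma legendre1 : legendre 1 = 1.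
Proof. by rewrite /legendre oner_eq0 expr1n eqxx. Qed.

Lemma legendre_eq1 (x : 'F_p) : legendre x = 1 -> exists y, x = y ^+ 2.
Proof.
rewrite /legendre; have [->|x_neq0] := eqVneq x 0; first by [].
case: ifP => // /eqP x_half _; apply: euler_criterion => //; rewrite card_Fp //.
Qed.

Lemma legendre_nonresidue : exists x, legendre x = -1.
Proof.
have [z z_prim] : exists z : 'F_p, p.-1.-primitive_root z.
  apply: finField_prim_root; rewrite ?card_Fp //.
  by have := prime_gt1 p_pr; case: p.
have half_gt0 : (0 < p.-1./2)%N by case: p p_pr p_odd => [|[|[|n]]].
exists z; rewrite /legendre.
have z_neq0 : z != 0.
  apply/eqP => z0; have /eqP := prim_expr_order z_prim.
  by rewrite z0 expr0n even_half_predp muln_eq0 orbF -[_ == 0%N]negbK -lt0n half_gt0 eq_sym oner_eq0.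
rewrite (negbTE z_neq0) -(prim_order_dvd z_prim) gtnNdvd //.
by rewrite [ltnRHS]even_half_predp ltn_Pmulr.
Qed.

Lemma sum_legendre : \sum_(x : 'F_p) legendre x = 0.
Proof.
have [z leg_z] := legendre_nonresidue.
have z_neq0 : z != 0 by apply: contra_eqN leg_z => /eqP->; rewrite /legendre eqxx.
suff : \sum_(x : 'F_p) legendre x = - \sum_(x : 'F_p) legendre x by lia.
rewrite [LHS](reindex_inj (mulfI z_neq0)) -mulN1r -leg_z mulr_sumr.
by apply: eq_bigr => x _; rewrite legendreM.
Qed.

End Legendre.

Lemma intr_pchar_eq0 (R : nzRingType) q (z : int) : q \in [pchar R] ->
  (z%:~R == 0 :> R) = (q %| `|z|)%N.
Proof.
move=> q_char; case: z => n; first by rewrite (dvdn_pcharf q_char).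
by rewrite NegzE mulrNz oppr_eq0 abszN (dvdn_pcharf q_char).
Qed.

Section GaussSum.
Variables (p q : nat).
Hypotheses (p_pr : prime p) (p_odd : odd p) (q_pr : prime q) (q_odd : odd q) (neq_pq : p != q).

Lemma pred_card_dvd : (p %| (q ^ p.-1).-1)%N.
Proof.
rewrite (dvdn_pcharf (pchar_Fp p_pr)) -subn1 natrB ?expn_gt0 ?prime_gt0 // natrX.
have := @expf_cardB1 'F_p q%:R; rewrite card_Fp // => ->; rewrite ?subrr //.
by rewrite -(dvdn_pcharf (pchar_Fp p_pr)) dvdn_prime2.
Qed.

(** By Fermat, [p] divides [q ^ (p - 1) - 1], the order of the multiplicative group of the field
    with [q ^ (p - 1)] elements. *)
Lemma exists_root_field : exists (K : finFieldType) (z : K),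
  q \in [pchar K] /\ p.-primitive_root z.
Proof.
have p1_gt0 : (0 < p.-1)%N by case: p p_pr => [|[]].
have [K K_char K_card] := pPrimePowerField q_pr p1_gt0.
have [z z_prim] : exists z : K, p.-primitive_root z.
  by apply: finField_prim_root; rewrite ?prime_gt0 // K_card pred_card_dvd.
by exists K, z.
Qed.

Section Field.
Variables (K : finFieldType) (z : K).
Hypotheses (K_char : q \in [pchar K]) (z_prim : p.-primitive_root z).
Definition root_pow (a : 'F_p) : K := z ^+ a.
Local Notation e := root_pow.
Local Notation eta a := ((legendre (a : 'F_p))%:~R : K).

Lemma root_powD (a b : 'F_p) : e (a + b) = e a * e b.
Proof. rewrite /e -exprD -[RHS](prim_expr_mod z_prim) /=; congr (_ ^+ (_ %% _)%N); exact: Fp_cast. Qed.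

Lemma root_powMn (a : 'F_p) n : e (a *+ n) = e a ^+ n.
Proof. by elim: n => [|n IHn]; [rewrite /e expr0 | rewrite mulrS root_powD IHn exprS]. Qed.

Lemma sum_root_pow : \sum_(a : 'F_p) e a = 0.
Proof.
have z_neq1 : z != 1.
  by rewrite -[z]expr1 -(prim_order_dvd z_prim) dvdn1; case: p p_pr => [|[]].
have e1 : e 1 = z.
  by rewrite /e /= modn_small ?expr1 // Fp_cast ?prime_gt1.
have : \sum_(a : 'F_p) e a = z * \sum_(a : 'F_p) e a.
  rewrite [LHS](reindex_inj (addrI 1)) mulr_sumr; apply: eq_bigr => a _.
  by rewrite root_powD e1.
move/eqP; rewrite -subr_eq0 -{1}[\sum_(_ | _) _]mul1r -mulrBl mulf_eq0 subr_eq0 eq_sym.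
by rewrite (negbTE z_neq1) => /eqP.
Qed.

Lemma sum_root_powM (c : 'F_p) : \sum_(a : 'F_p) e (a * c) = if c == 0 then p%:R else 0.
Proof.
case: eqP => [->|/eqP c_neq0].
  by under eq_bigr do rewrite mulr0 /e expr0; rewrite sumr_const card_Fp.
by rewrite -[RHS]sum_root_pow [RHS](reindex_inj (mulIf c_neq0)).
Qed.

Definition gauss_sum : K := \sum_(a : 'F_p) eta a * e a.

Lemma sum_legendre_in_field : \sum_(a : 'F_p) eta a = 0.
Proof. by rewrite -rmorph_sum /= sum_legendre. Qed.

(** Substituting [b = a c] in the double sum cancels the symbol of [a]; the remaining sum of
    [e (a * (c + 1))] over nonzero [a] is [p - 1] for [c = -1] and -1 otherwise, and the constant -1
    is killed by the vanishing sum of symbols. *)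
Lemma gauss_sum_sqr : gauss_sum ^+ 2 = (legendre (-1 : 'F_p))%:~R * p%:R.
Proof.
transitivity (\sum_(a : 'F_p | a != 0) \sum_(c : 'F_p) eta c * e (a * (c + 1))).
  rewrite expr2 {1}/gauss_sum mulr_suml (bigD1 0) //= legendre0 !mul0r add0r.
  apply: eq_bigr => a a_neq0; rewrite /gauss_sum mulr_sumr.
  rewrite (reindex_inj (mulfI a_neq0)); apply: eq_bigr => c _ /=.
  rewrite mulrDr mulr1 root_powD legendreM // rmorphM /=.
  have eta2 : eta a * eta a = 1.
    by rewrite -intrM; case: (legendre_pm1 a_neq0) => ->.
  transitivity (eta a * eta a * (eta c * (e (a * c) * e a))); first by ring.
  by rewrite eta2 mul1r.
rewrite exchange_big /=.
transitivity (\sum_(c : 'F_p) eta c * ((if c + 1 == 0 then p%:R else 0) - 1)).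
  apply: eq_bigr => c _; rewrite -mulr_sumr; congr (_ * _).
  by rewrite -sum_root_powM [X in X - _](bigD1 0) //= mul0r [e 0]expr0 addrC addrK.
under eq_bigr do rewrite mulrBr mulr1.
rewrite sumrB sum_legendre_in_field subr0 (bigD1 (-1)) //= addNr eqxx big1 ?addr0 // => c c_neq.
by rewrite addr_eq0 (negbTE c_neq) mulr0.
Qed.

(** Frobenius fixes the symbols, which are integers, and sends [e a] to [e (a q)]; reindexing by [q]
    extracts the symbol of [q]. *)
Lemma gauss_sum_frobenius : gauss_sum ^+ q = (legendre (q%:R : 'F_p))%:~R * gauss_sum.
Proof.
have q_neq0 : q%:R != 0 :> 'F_p.
  by rewrite -(dvdn_pcharf (pchar_Fp p_pr)) dvdn_prime2.
rewrite -(pFrobenius_autE K_char) rmorph_sum /= [in RHS]/gauss_sum.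
rewrite [in RHS](reindex_inj (mulIf q_neq0)) mulr_sumr; apply: eq_bigr => a _.
rewrite rmorphM /= rmorph_int pFrobenius_autE legendreM // rmorphM /= mulr_natr root_powMn.
have eta2 : eta q%:R * eta q%:R = 1 by rewrite -intrM; case: (legendre_pm1 q_neq0) => ->.
transitivity (eta q%:R * eta q%:R * (eta a * e a ^+ q)); first by rewrite eta2 mul1r.
by ring.
Qed.

Lemma gauss_sum_half : (legendre (-1 : 'F_p) * p%:R)%:~R ^+ q.-1./2
  = (legendre (q%:R : 'F_p))%:~R :> K.
Proof.
have tau_neq0 : gauss_sum != 0.
  rewrite -sqrf_eq0 gauss_sum_sqr mulf_eq0 negb_or -(dvdn_pcharf K_char) dvdn_prime2 //.
  rewrite [q == p]eq_sym neq_pq andbT.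
  have neg1 : -1 != 0 :> 'F_p by rewrite oppr_eq0 oner_eq0.
  by case: (legendre_pm1 neg1) => ->; rewrite ?mulrNz ?oppr_eq0 oner_eq0.
apply: (mulIf tau_neq0); rewrite -gauss_sum_frobenius.
rewrite rmorphM /= rmorph_nat -gauss_sum_sqr -exprM mulnC -even_half_predp //.
by rewrite -exprSr prednK // prime_gt0.
Qed.

End Field.

(** Since [q.-1./2] is even, the sign in the square of the Gauss sum disappears. The resulting
    identity between integers in [K] descends to ['F_q], which has the same characteristic. *)
Lemma quadratic_reciprocity1 : (4 %| q.-1)%N -> legendre (p%:R : 'F_q) = legendre (q%:R : 'F_p).
Proof.
move=> /dvdnP[j def_q1]; have [K [z [K_char z_prim]]] := exists_root_field.
have := gauss_sum_half K_char z_prim.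
have -> : q.-1./2 = (2 * j)%N by rewrite def_q1 -[4%N]/(2 * 2)%N mulnA muln2 doubleK mulnC.
have p_neq0 : p%:R != 0 :> 'F_q by rewrite -(dvdn_pcharf (pchar_Fp q_pr)) dvdn_prime2 // eq_sym.
have q_neq0 : q%:R != 0 :> 'F_p by rewrite -(dvdn_pcharf (pchar_Fp p_pr)) dvdn_prime2.
have neg1 : -1 != 0 :> 'F_p by rewrite oppr_eq0 oner_eq0.
rewrite rmorphM /= exprMn [X in X * _]exprM -rmorphXn /=.
have -> : legendre (-1 : 'F_p) ^+ 2 = 1 by case: (legendre_pm1 neg1) => ->.
rewrite rmorph1 expr1n mul1r => /eqP; rewrite -subr_eq0 -rmorphXn -rmorphB /=.
rewrite (intr_pchar_eq0 _ K_char) -(intr_pchar_eq0 _ (pchar_Fp q_pr)) rmorphB /= rmorphXn /= subr_eq0.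
move=> /eqP leg_eq; apply: (pm1_Fp_inj q_pr q_odd); rewrite ?legendre_pm1 //; try exact: legendre_pm1.
rewrite legendreE // -leg_eq rmorph_nat; congr (_ ^+ _).
by rewrite def_q1 -[4%N]/(2 * 2)%N mulnA muln2 doubleK mulnC.
Qed.

End GaussSum.

Definition chi4 (n : nat) : int :=
  if (n %% 4 == 1)%N then 1 else if (n %% 4 == 3)%N then -1 else 0.

Definition chi8 (n : nat) : int :=
  if (n %% 8 \in [:: 1; 7])%N then 1 else if (n %% 8 \in [:: 3; 5])%N then -1 else 0.

Lemma chi4M : {morph chi4 : m n / (m * n)%N >-> m * n}.
Proof.
move=> m n; rewrite /chi4 -modnMm.
have := ltn_pmod m (isT : 0 < 4)%N; have := ltn_pmod n (isT : 0 < 4)%N.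
by case: (m %% 4)%N => [|[|[|[|]]]] //; case: (n %% 4)%N => [|[|[|[|]]]].
Qed.

Lemma chi8M : {morph chi8 : m n / (m * n)%N >-> m * n}.
Proof.
move=> m n; rewrite /chi8 -modnMm.
have := ltn_pmod m (isT : 0 < 8)%N; have := ltn_pmod n (isT : 0 < 8)%N.
by case: (m %% 8)%N => [|[|[|[|[|[|[|[|]]]]]]]] //;
   case: (n %% 8)%N => [|[|[|[|[|[|[|[|]]]]]]]].
Qed.

Lemma odd_mod8 n : odd n -> [\/ n %% 8 = 1, n %% 8 = 3, n %% 8 = 5 | n %% 8 = 7]%N.
Proof.
move=> n_odd; have : odd (n %% 8) by rewrite odd_mod.
have := ltn_pmod n (isT : 0 < 8)%N.
by case: (n %% 8)%N => [|[|[|[|[|[|[|[|]]]]]]]] // _ _; constructor.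
Qed.

Lemma mod4_mod8 n : (n %% 4 = n %% 8 %% 4)%N.
Proof. by rewrite modn_dvdm. Qed.

Section Supplements.
Variable p : nat.
Hypotheses (p_pr : prime p) (p_odd : odd p).

Lemma Fp_neg1_neq0 : (-1 : 'F_p) != 0.
Proof. by rewrite oppr_eq0 oner_eq0. Qed.

Lemma Fp_2_neq0 : (2%:R : 'F_p) != 0.
Proof.
rewrite -(dvdn_pcharf (pchar_Fp p_pr)) dvdn_prime2 //.
by apply: contraTneq p_odd => ->.
Qed.

Lemma chi4_pm1 : chi4 p = 1 \/ chi4 p = -1.
Proof.
by rewrite /chi4 mod4_mod8; case: (odd_mod8 p_odd) => ->; [left|right|left|right].
Qed.

Lemma chi8_pm1 : chi8 p = 1 \/ chi8 p = -1.
Proof. by rewrite /chi8; case: (odd_mod8 p_odd) => ->; [left|right|right|left]. Qed.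

Lemma legendreN1 : legendre (-1 : 'F_p) = chi4 p.
Proof.
apply: (pm1_Fp_inj p_pr p_odd); [exact/legendre_pm1/Fp_neg1_neq0 | exact: chi4_pm1 |].
rewrite legendreE // -signr_odd /chi4.
have def_p := odd_double_half p; rewrite p_odd add1n in def_p.
have -> : p.-1./2 = p./2 by rewrite -def_p /= uphalf_half odd_double /= doubleK.
have : (p %% 4 = 1 + 2 * odd p./2)%N.
  have := odd_double_half p./2; move: def_p; rewrite -!muln2.
  by case: (odd _) => /=; lia.
by case: (odd _) => ->.
Qed.

Lemma sqr_odd_mod8 n : odd n -> (8 %| (n ^ 2).-1)%N.
Proof.
move=> n_odd; have n2_gt0 : (0 < n ^ 2)%N by rewrite expn_gt0; case: n n_odd.
rewrite -subn1 -eqn_mod_dvd // -modnXm.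
by case: (odd_mod8 n_odd) => ->.
Qed.

(** With [z] a primitive eighth root of unity in the field with [p ^ 2] elements, [z + z ^+ 7],
    which is [z] plus its inverse, is a square root of 2. Frobenius sends it to itself or its
    opposite according to [p] modulo 8. *)
Lemma legendre2 : legendre (2%:R : 'F_p) = chi8 p.
Proof.
have [K K_char K_card] := pPrimePowerField p_pr (isT : 0 < 2)%N.
have [z z_prim] : exists z : K, 8.-primitive_root z.
  by apply: finField_prim_root; rewrite // K_card sqr_odd_mod8.
have z8 : z ^+ 8 = 1 := prim_expr_order z_prim.
have z4 : z ^+ 4 = -1.
  have : (z ^+ 4) ^+ 2 == 1 by rewrite -exprM z8.
  rewrite sqrf_eq1 => /orP[|/eqP //]; by rewrite -(prim_order_dvd z_prim).
pose t := z + z ^+ 7.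
have t2 : t ^+ 2 = 2%:R.
  rewrite /t (_ : (z + z ^+ 7) ^+ 2 = z ^+ 2 + 2%:R * z ^+ 8 + z ^+ 8 * (z ^+ 2 * z ^+ 4)); last by ring.
  by rewrite z8 z4; ring.
have tp : t ^+ p = (chi8 p)%:~R * t.
  rewrite -(pFrobenius_autE K_char) rmorphD /= !pFrobenius_autE -exprM.
  rewrite -(prim_expr_mod z_prim p) -(prim_expr_mod z_prim (7 * p)) -modnMmr /chi8 /t.
  have z5 : z ^+ 5 = - z by rewrite exprS z4 mulrN1.
  have z3 : z ^+ 7 = - z ^+ 3 by rewrite (exprD z 3 4) z4 mulrN1.
  case: (odd_mod8 p_odd) => -> /=; rewrite ?expr1 ?mul1r // ?mulrNz ?mulr1z ?mulN1r.
  - by rewrite -[(7 * 3 %% 8)%N]/5%N z5 z3 opprD opprK addrC.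
  - by rewrite -[(7 * 5 %% 8)%N]/3%N z5 z3 opprD opprK.
  - by rewrite addrC.
have two_neq0 : 2%:R != 0 :> K.
  by rewrite -(dvdn_pcharf K_char) (dvdn_pcharf (pchar_Fp p_pr)) Fp_2_neq0.
have t_neq0 : t != 0 by rewrite -sqrf_eq0 t2.
apply: (pm1_Fp_inj p_pr p_odd); [exact/legendre_pm1/Fp_2_neq0 | exact: chi8_pm1 |].
rewrite legendreE //; apply/eqP; rewrite -subr_eq0.
have -> : 2%:R ^+ p.-1./2 - (chi8 p)%:~R = (2%:R ^+ p.-1./2 - chi8 p)%:~R :> 'F_p.
  by rewrite rmorphB /= rmorphXn /= rmorph_nat.
rewrite (intr_pchar_eq0 _ (pchar_Fp p_pr)) -(intr_pchar_eq0 _ K_char).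
rewrite rmorphB /= rmorphXn /= rmorph_nat subr_eq0 -t2 -exprM mulnC -even_half_predp //.
apply/eqP/(mulIf t_neq0); rewrite -tp -exprSr prednK //.
exact: prime_gt0.
Qed.

End Supplements.

(** * The three-square theorem *)

Definition lift_char (R : realType) (M : nat) (f : nat -> int) (n : nat) : R :=
  principal_char R M n * (f n)%:~R.

Lemma lift_char_real (R : realType) (M m : nat) (f : nat -> int) : (m %| M)%N ->
    f 1%N = 1 -> {morph f : a b / (a * b)%N >-> a * b} -> (forall n, f (n + m)%N = f n) ->
    (forall n, coprime n m -> f n = 1 \/ f n = -1) ->
  real_character M (lift_char R M f).
Proof.
move=> dvd_mM f1 fM fm fu; have [p1 pM pp pu p0] := principal_char_real R M.
rewrite /lift_char; split=> [|a b|n|n con|n ncon].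
- by rewrite f1 p1 mulr1.
- by rewrite fM pM intrM mulrACA.
- rewrite pp; case/dvdnP: dvd_mM => k ->; congr (_ * _%:~R).
  by elim: k => [|k IHk]; rewrite ?addn0 // mulSn addnCA addnC fm.
- rewrite /principal_char con mul1r.
  by case: (fu n (coprime_dvdr dvd_mM con)) => ->; [left | right].
- by rewrite p0 // mul0r.
Qed.

Lemma lift_char_inj (M : nat) (f : nat -> int) a b : coprime a M -> coprime b M ->
  lift_char Rdefinitions.R M f a = lift_char Rdefinitions.R M f b -> f a = f b.
Proof. by rewrite /lift_char /principal_char => -> ->; rewrite !mul1r => /intr_inj. Qed.

Definition legendre_nat (p n : nat) : int := legendre (n%:R : 'F_p).

Lemma natFp_eq0 p n : prime p -> (n%:R == 0 :> 'F_p) = (p %| n)%N.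
Proof. by move=> p_pr; rewrite (dvdn_pcharf (pchar_Fp p_pr)). Qed.

Lemma natFp_mod p m n : prime p -> m = n %[mod p] -> m%:R = n%:R :> 'F_p.
Proof. by move=> p_pr eq_mn; rewrite -(Fp_nat_mod p_pr m) eq_mn Fp_nat_mod. Qed.

(** The Chinese remainder theorem gives [a] with residue [c] modulo 8 and [x] modulo [n]. It
    suffices that [q] agree with [a] under [chi4], [chi8] and the symbols at the primes of [n],
    since [chi4] and [chi8] together determine an odd residue modulo 8. *)
Lemma auxiliary_prime (n c x : nat) : odd n -> c = 1%N \/ c = 5%N -> coprime x n ->
  exists q, [/\ q = 1%N \/ prime q, q %% 8 = c, coprime q n
    & forall p, prime p -> (p %| n)%N -> legendre_nat p q = legendre_nat p x]%N.
Proof.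
move=> n_odd c15 co_xn; pose M := (8 * n)%N; have n_gt0 := odd_gt0 n_odd.
have co8n : coprime 8 n by rewrite (@coprime_pexpl 3 2) // coprime2n.
pose a := chinese 8 n c x.
have a8 : (a %% 8 = c)%N by rewrite /a chinese_modl //; case: c15 => ->.
have an : a = x %[mod n] by rewrite /a chinese_modr.
have coaM : coprime a M.
  rewrite coprimeMr -[coprime a n]coprime_modl an coprime_modl co_xn andbT.
  by rewrite (@coprime_pexpr 3 _ 2) // coprimen2 -(@odd_mod a 8) // a8; case: c15 => ->.
have M_gt0 : (0 < M)%N by rewrite muln_gt0 n_gt0.
pose RR : realType := Rdefinitions.R.
pose fs := [:: chi4; chi8] ++ [seq legendre_nat p | p <- primes n].
have fs_char f : List.In f fs -> real_character M (lift_char RR M f).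
  case=> [<-|[<-|f_in]].
  - apply: (@lift_char_real _ _ 4) => //; first by rewrite (@dvdn_mulr 4 8 n).
    + exact: chi4M.
    + by move=> m; rewrite /chi4 modnDr.
    + by move=> m; rewrite (@coprime_pexpr 2 _ 2) // coprimen2 => /chi4_pm1.
  - apply: (@lift_char_real _ _ 8) => //; first by rewrite dvdn_mulr.
    + exact: chi8M.
    + by move=> m; rewrite /chi8 modnDr.
    + by move=> m; rewrite (@coprime_pexpr 3 _ 2) // coprimen2 => /chi8_pm1.
  have [p p_in ->] : exists2 p, p \in primes n & f = legendre_nat p.
    elim: (primes n) f_in => //= p s IHs [<-|/IHs[r r_in ->]]; first by exists p; rewrite ?mem_head.
    by exists r => //; rewrite inE r_in orbT.
  move: p_in; rewrite mem_primes => /and3P[p_pr _ dvd_pn].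
  have p_odd : odd p := dvdn_odd dvd_pn n_odd.
  apply: (@lift_char_real _ _ p); first by rewrite dvdn_mull.
  - exact: legendre1.
  - by move=> m m'; rewrite /legendre_nat natrM legendreM.
  - by move=> m; congr legendre; apply: natFp_mod; rewrite // modnDr.
  - move=> m com; apply: legendre_pm1.
    by rewrite natFp_eq0 // -prime_coprime // coprime_sym.
have [|q [q_pr coqM q_eq]] :=
  @exists_prime_or_one_with_pattern RR M M_gt0 a coaM [seq lift_char RR M f | f <- fs].
  elim: fs fs_char => //= f s IHs fs_char g [<-|g_in]; first by apply: fs_char; left.
  by apply: IHs g_in => h h_in; apply: fs_char; right.
have fq f : List.In f fs -> f q = f a.
  move=> f_in; apply: lift_char_inj coqM coaM _; apply: q_eq.
  by elim: (fs) f_in => //= h s IHs [->|/IHs]; [left | right].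
have q_odd : odd q.
  by move: coqM; rewrite coprimeMr (@coprime_pexpr 3 _ 2) // coprimen2 => /andP[].
have chi4q : chi4 q = chi4 a by apply: fq; left.
have chi8q : chi8 q = chi8 a by apply: fq; right; left.
exists q; split=> //.
- move: chi4q chi8q; rewrite /chi4 /chi8 !(mod4_mod8 q, mod4_mod8 a) a8.
  by case: (odd_mod8 q_odd) => ->; case: c15 => ->.
- by move: coqM; rewrite coprimeMr => /andP[].
move=> p p_pr dvd_pn; rewrite fq.
  by congr legendre; apply: natFp_mod => //; rewrite -(modn_dvdm a dvd_pn) an modn_dvdm.
right; right; have : p \in primes n by rewrite mem_primes p_pr n_gt0.
by elim: (primes n) => //= r s IHs; rewrite inE => /predU1P[->|/IHs]; [left | right].
Qed.

Definition squarefree (n : nat) := forall p, prime p -> ~~ (p ^ 2 %| n)%N.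

Lemma squarefree_dvd m n : (m %| n)%N -> squarefree n -> squarefree m.
Proof. by move=> dvd_mn sqf p p_pr; apply: contra (sqf p p_pr) => /dvdn_trans->. Qed.

Lemma squarefree_decomp n : (0 < n)%N ->
  exists m s, [/\ (0 < m)%N, (0 < s)%N, squarefree m & n = m * s ^ 2]%N.
Proof.
elim/ltn_ind: n => n IHn n_gt0.
have [/hasP[p p_in dvd_p]|/hasPn no_p] := boolP (has (fun p => p ^ 2 %| n)%N (primes n)).
  move: p_in; rewrite mem_primes => /and3P[p_pr _ _].
  case/dvdnP: dvd_p => k def_n.
  have k_gt0 : (0 < k)%N by move: n_gt0; rewrite def_n muln_gt0 => /andP[].
  have lt_kn : (k < n)%N by rewrite def_n ltn_Pmulr // (ltn_exp2l 0) ?prime_gt1.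
  have [m [s [m_gt0 s_gt0 sqf def_k]]] := IHn k lt_kn k_gt0.
  exists m, (s * p)%N; split=> //; first by rewrite muln_gt0 s_gt0 prime_gt0.
  by rewrite def_n def_k expnMn mulnA.
exists n, 1%N; split=> //; last by rewrite muln1.
move=> p p_pr; apply/negP => dvd_p; have /no_p/negP[] // : p \in primes n.
by rewrite mem_primes p_pr n_gt0 (dvdn_trans _ dvd_p) // dvdn_mulr.
Qed.

Lemma crt_neg_square n b : (0 < n)%N -> squarefree n ->
    (forall p, prime p -> (p %| n)%N -> exists r, (p %| r ^ 2 + b)%N) ->
  exists r, (n %| r ^ 2 + b)%N.
Proof.
elim/ltn_ind: n => n IHn n_gt0 sqf sq_p.
have [n_le1|n_gt1] := leqP n 1.
  by exists 0%N; have -> : n = 1%N by apply/eqP; rewrite eqn_leq n_le1.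
have p_pr := pdiv_prime n_gt1; set p := pdiv n in p_pr.
have dvd_pn : (p %| n)%N := pdiv_dvd n.
case/dvdnP: (dvd_pn) => m def_n.
have m_gt0 : (0 < m)%N by move: n_gt0; rewrite def_n muln_gt0 => /andP[].
have lt_mn : (m < n)%N by rewrite def_n ltn_Pmulr ?prime_gt1.
have dvd_mn : (m %| n)%N by rewrite def_n dvdn_mulr.
have co_mp : coprime m p.
  rewrite coprime_sym prime_coprime //; apply: contra (sqf p p_pr) => dvd_pm.
  by rewrite def_n -mulnn dvdn_mul.
have [r1 r1P] := IHn m lt_mn m_gt0 (squarefree_dvd dvd_mn sqf)
  (fun r r_pr dvd_rm => sq_p r r_pr (dvdn_trans dvd_rm dvd_mn)).
have [r2 r2P] := sq_p p p_pr dvd_pn.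
exists (chinese m p r1 r2); rewrite def_n Gauss_dvd //; apply/andP; split.
  by rewrite /dvdn -modnDml -modnXm chinese_modl // modnXm modnDml.
by rewrite /dvdn -modnDml -modnXm chinese_modr // modnXm modnDml.
Qed.

Lemma legendre_multiplicative q n (g : nat -> int) : prime q -> odd q -> (0 < n)%N ->
    g 1%N = 1 -> {morph g : a b / (a * b)%N >-> a * b} ->
    (forall p, prime p -> (p %| n)%N -> legendre_nat q p = g p) ->
  legendre_nat q n = g n.
Proof.
move=> q_pr q_odd + g1 gM; elim/ltn_ind: n => n IHn n_gt0 leg_p.
have [n_le1|n_gt1] := leqP n 1.
  have -> : n = 1%N by apply/eqP; rewrite eqn_leq n_le1.
  by rewrite g1; apply: legendre1.
have p_pr := pdiv_prime n_gt1; set p := pdiv n in p_pr.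
case/dvdnP: (pdiv_dvd n) => m def_n.
have m_gt0 : (0 < m)%N by move: n_gt0; rewrite def_n muln_gt0 => /andP[].
have lt_mn : (m < n)%N by rewrite def_n ltn_Pmulr ?prime_gt1.
rewrite def_n gM -(leg_p p) ?pdiv_dvd // -IHn //.
  by rewrite /legendre_nat natrM legendreM.
by move=> r r_pr dvd_rm; apply: leg_p => //; rewrite def_n dvdn_mulr.
Qed.

Lemma legendre_nat_square p n : prime p -> odd p -> legendre_nat p n = 1 ->
  exists s, (s ^ 2 = n %[mod p])%N.
Proof.
move=> p_pr p_odd /(legendre_eq1 p_pr p_odd)[y def_n]; exists (y : nat).
have: (y ^ 2)%N%:R = n%:R :> 'F_p by rewrite natrX natr_Zp.
by move/(congr1 val) => /=; rewrite !val_Fp_nat.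
Qed.

Lemma legendre_neg_square p b : prime p -> odd p -> legendre (- b%:R : 'F_p) = 1 ->
  exists r, (p %| r ^ 2 + b)%N.
Proof.
move=> p_pr p_odd /(legendre_eq1 p_pr p_odd)[y def_b]; exists (y : nat).
by rewrite -natFp_eq0 // natrD natrX natr_Zp -def_b addNr.
Qed.

(** * Legendre's equation by the pigeonhole principle *)

Lemma nat_sqrt_bounds n : exists k, (k ^ 2 <= n < k.+1 ^ 2)%N.
Proof.
elim: n => [|n [k /andP[le_k lt_k]]]; first by exists 0%N.
have [le_n|lt_n] := leqP (k.+1 ^ 2) n.+1; last by exists k; rewrite leqW.
by exists k.+1; rewrite le_n (leq_ltn_trans lt_k) // ltn_exp2r.
Qed.

Lemma eqn_mod_dvdz (a m n : nat) : m = n %[mod a] -> (a%:Z %| m%:Z - n%:Z)%Z.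
Proof. by move=> eq_mn; rewrite -eqz_mod_dvd !modz_nat eq_mn. Qed.

Lemma sqr_diff_ord_le (k : nat) (i j : 'I_k.+1) : ((i : nat)%:Z - (j : nat)%:Z) ^+ 2 <= (k ^ 2)%N%:Z.
Proof.
have := ltn_ord i; have := ltn_ord j; rewrite !ltnS -mulnn PoszM.
move: (nat_of_ord i) (nat_of_ord j) => {}i {}j le_jk le_ik.
have -> : k%:Z * k%:Z = (i%:Z - j%:Z) ^+ 2 + (k%:Z - (i%:Z - j%:Z)) * (k%:Z + (i%:Z - j%:Z)) by ring.
by rewrite lerDl mulr_ge0 //; lia.
Qed.

(** The congruences make [V] a multiple of [a * b], and the size bounds place it strictly between
    [- a b] and [2 a b]. So [V] is 0, which is a solution, or [a b]. *)
Lemma small_ternary_solution (a b r s : nat) (z t w : int) : (0 < a)%N -> (0 < b)%N ->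
    coprime a b -> (a %| r ^ 2 + b)%N -> (s ^ 2 = a %[mod b])%N ->
    (a%:Z %| z + r%:Z * t)%Z -> (b%:Z %| z + s%:Z * w)%Z ->
    z ^+ 2 <= a%:Z * b%:Z -> t ^+ 2 < a%:Z -> w ^+ 2 < b%:Z -> z <> 0 \/ t <> 0 \/ w <> 0 ->
  exists z' t' w' : int, w' != 0 /\ z' ^+ 2 + b%:Z * t' ^+ 2 = a%:Z * w' ^+ 2.
Proof.
move=> a_gt0 b_gt0 co_ab dvd_a mod_b a_dvd b_dvd z2 t2 w2 neq0.
pose V := z ^+ 2 + b%:Z * t ^+ 2 - a%:Z * w ^+ 2.
have aV : (a%:Z %| V)%Z.
  have -> : V = (z + r%:Z * t) * (z - r%:Z * t) + (r ^ 2 + b)%N%:Z * t ^+ 2 + a%:Z * - w ^+ 2.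
    by rewrite PoszD -mulnn PoszM /V; ring.
  by rewrite !rpredD // ?dvdz_mulr.
have bV : (b%:Z %| V)%Z.
  have -> : V = (z + s%:Z * w) * (z - s%:Z * w) + ((s ^ 2)%N%:Z - a%:Z) * w ^+ 2 + b%:Z * t ^+ 2.
    by rewrite -mulnn PoszM /V; ring.
  by rewrite !rpredD // ?dvdz_mulr // eqn_mod_dvdz.
have /dvdzP[k def_V] : ((a%:Z * b%:Z) %| V)%Z by rewrite Gauss_dvdz ?coprimezE // aV bV.
have a0 : 0 < a%:Z by rewrite ltz_nat.
have b0 : 0 < b%:Z by rewrite ltz_nat.
have z20 : 0 <= z ^+ 2 by apply: sqr_ge0.
have t20 : 0 <= t ^+ 2 by apply: sqr_ge0.
have w20 : 0 <= w ^+ 2 by apply: sqr_ge0.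
clear dvd_a mod_b a_dvd b_dvd aV bV.
have ab0 : 0 < a%:Z * b%:Z by apply: mulr_gt0.
have aw : a%:Z * w ^+ 2 < a%:Z * b%:Z by rewrite ltr_pM2l.
have bt : b%:Z * t ^+ 2 < a%:Z * b%:Z by rewrite mulrC ltr_pM2r.
have bt0 : 0 <= b%:Z * t ^+ 2 by rewrite mulr_ge0.
have aw0 : 0 <= a%:Z * w ^+ 2 by rewrite mulr_ge0.
have k_lo : -1 < k by rewrite -(ltr_pM2r ab0) -def_V mulN1r /V; lra.
have k_hi : k < 2 by rewrite -(ltr_pM2r ab0) -def_V /V; lra.
have [k0|k1] : k = 0 \/ k = 1 by lia.
  exists z, t, w; split; last by apply/eqP; rewrite -subr_eq0 -/V def_V k0 mul0r.
  apply/eqP => w0; rewrite /V k0 mul0r w0 in def_V.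
  have t0 : t ^+ 2 = 0 by nia.
  have z0 : z ^+ 2 = 0 by rewrite t0 in def_V; lra.
  by move/eqP: z0; move/eqP: t0; rewrite !sqrf_eq0 => /eqP ? /eqP ?; case: neq0 => [|[]].
(* [z ^+ 2 + b * t ^+ 2 = a * (w ^+ 2 + b)]: multiply by [w ^+ 2 + b], a value of the same form. *)
exists (z * w + b%:Z * t), (z - t * w), (w ^+ 2 + b%:Z); split.
  by apply/eqP; lia.
have {def_V} : z ^+ 2 + b%:Z * t ^+ 2 = a%:Z * (w ^+ 2 + b%:Z).
  by apply/eqP; rewrite -subr_eq0; apply/eqP; move: def_V; rewrite k1 /V; lia.
move=> e; transitivity ((z ^+ 2 + b%:Z * t ^+ 2) * (w ^+ 2 + b%:Z)); first by ring.
by rewrite e; ring.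
Qed.

(** The box for [(z, t, w)] has sides just above the square roots of [a b], [a] and [b], hence more
    than [a b] points, so two of them share the residues of [z + r t] modulo [a] and [z + s w]
    modulo [b]; their difference is a small solution of both congruences. *)
Lemma legendre_ternary (a b r s : nat) : (1 < a)%N -> (forall k, k ^ 2 <> a)%N -> (0 < b)%N ->
    coprime a b -> (a %| r ^ 2 + b)%N -> (s ^ 2 = a %[mod b])%N ->
  exists z t w : int, w != 0 /\ z ^+ 2 + b%:Z * t ^+ 2 = a%:Z * w ^+ 2.
Proof.
move=> a_gt1 a_nsq b_gt0 co_ab dvd_a mod_b.
have a_gt0 := ltnW a_gt1.
have [Z /andP[Z_le Z_gt]] := nat_sqrt_bounds (a * b).
have [T /andP[T_le T_gt]] := nat_sqrt_bounds a.
(* Taking the root of [b.-1] keeps [W ^ 2 < b] strict even when [b] is a square, for instance 1; for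
   [a] strictness comes from [a_nsq]. *)
have [W /andP[W_le W_gt]] := nat_sqrt_bounds b.-1.
have T_lt : (T ^ 2 < a)%N by rewrite ltn_neqAle T_le andbT; apply/eqP/a_nsq.
have W_lt : (W ^ 2 < b)%N by apply: leq_ltn_trans W_le _; rewrite prednK.
have {}W_gt : (b <= W.+1 ^ 2)%N by rewrite -(prednK b_gt0).
pose box := ('I_Z.+1 * 'I_T.+1 * 'I_W.+1)%type.
pose h (x : box) : 'I_a * 'I_b :=
  (Ordinal (ltn_pmod (x.1.1 + r * x.1.2) a_gt0), Ordinal (ltn_pmod (x.1.1 + s * x.2) b_gt0)).
have h_ninj : ~~ injectiveb h.
  apply/injectiveP => /leq_card; rewrite !card_prod !card_ord leqNgt => /negP; apply.
  rewrite -(@ltn_exp2r _ _ 2) // (_ : (a * b) ^ 2 = (a * b) * a * b)%N; last by ring.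
  rewrite !expnMn; apply: (@leq_trans (Z.+1 ^ 2 * T.+1 ^ 2 * b)); last by rewrite leq_mul2l W_gt orbT.
  by rewrite ltn_mul2r b_gt0 /= ltn_mul.
have [x [y neq_xy eq_h]] := injectivePn _ h_ninj.
pose dz : int := (x.1.1 : nat)%:Z - (y.1.1 : nat)%:Z.
pose dt : int := (x.1.2 : nat)%:Z - (y.1.2 : nat)%:Z.
pose dw : int := (x.2 : nat)%:Z - (y.2 : nat)%:Z.
have a_dvd : (a%:Z %| dz + r%:Z * dt)%Z.
  have := congr1 (fun u => val u.1) eq_h => /= /eqn_mod_dvdz.
  by rewrite !PoszD !PoszM /dz /dt (_ : _ - _ = dz + r%:Z * dt) // /dz /dt; ring.
have b_dvd : (b%:Z %| dz + s%:Z * dw)%Z.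
  have := congr1 (fun u => val u.2) eq_h => /= /eqn_mod_dvdz.
  by rewrite !PoszD !PoszM /dz /dw (_ : _ - _ = dz + s%:Z * dw) // /dz /dw; ring.
have dz2 : dz ^+ 2 <= a%:Z * b%:Z by apply: le_trans (sqr_diff_ord_le _ _) _; rewrite -PoszM lez_nat.
have dt2 : dt ^+ 2 < a%:Z by apply: le_lt_trans (sqr_diff_ord_le _ _) _; rewrite ltz_nat.
have dw2 : dw ^+ 2 < b%:Z by apply: le_lt_trans (sqr_diff_ord_le _ _) _; rewrite ltz_nat.
have neq0 : dz <> 0 \/ dt <> 0 \/ dw <> 0.
  case: (eqVneq dz 0) => [dz0|/eqP]; last by left.
  case: (eqVneq dt 0) => [dt0|/eqP]; last by right; left.
  right; right => dw0; move/eqP: neq_xy; apply.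
  case: x y @dz @dt @dw dz0 dt0 dw0 {eq_h a_dvd b_dvd dz2 dt2 dw2} => [[i j] k] [[i' j'] k'] /=.
  move=> /eqP; rewrite subr_eq0 => /eqP[/val_inj->] /eqP; rewrite subr_eq0 => /eqP[/val_inj->].
  by move=> /eqP; rewrite subr_eq0 => /eqP[/val_inj->].
exact: (small_ternary_solution a_gt0 b_gt0 co_ab dvd_a mod_b a_dvd b_dvd dz2 dt2 dw2 neq0).
Qed.

(** * From rational to integral representations *)

Definition sum_of_three_squares (n : int) := exists x y z : int, n = x ^+ 2 + y ^+ 2 + z ^+ 2.

Lemma near_multiple (x w : int) : 0 < w -> exists y, 4 * (x - w * y) ^+ 2 <= w ^+ 2.
Proof.
move=> w_gt0; exists ((2 * x + w) %/ (2 * w))%Z.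
have w2 : 2 * w != 0 by lia.
have := divz_eq (2 * x + w) (2 * w); have := modz_ge0 (2 * x + w) w2.
have : ((2 * x + w) %% (2 * w) < 2 * w)%Z by apply: ltz_pmod; lia.
move: (_ %/ _)%Z (_ %% _)%Z => y m h1 h2 h3.
have : 2 * (x - w * y) = m - w by lia.
move=> e; have -> : 4 * (x - w * y) ^+ 2 = (m - w) ^+ 2 by rewrite -e; ring.
by nia.
Qed.

(* Davenport and Cassels: a rational point of the sphere is replaced by the second intersection
   of the sphere with its secant through a nearest integral point, whose denominator is smaller. *)
Lemma davenport_cassels (n x y z w : int) : 0 < w -> n * w ^+ 2 = x ^+ 2 + y ^+ 2 + z ^+ 2 ->
  sum_of_three_squares n.
Proof.
have [k] := ubnP `|w|%N; elim: k x y z w => // k IHk x y z w; rewrite ltnS => le_wk w_gt0 def_n.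
have [a a_near] := near_multiple x w_gt0; have [b b_near] := near_multiple y w_gt0.
have [c c_near] := near_multiple z w_gt0.
pose A := a ^+ 2 + b ^+ 2 + c ^+ 2 - n.
pose B := 2 * (n * w - (x * a + y * b + z * c)).
(* [w * w'] is the squared distance from [(x, y, z)] to [w] times the integral point, at most
   [3/4 w ^ 2]. So [w'] is smaller than [w], and if it is not positive then the rational point is
   already integral. *)
pose w' := A * w + B.
have ww' : w * w' = (x - w * a) ^+ 2 + (y - w * b) ^+ 2 + (z - w * c) ^+ 2.
  transitivity (n * w ^+ 2 + (w ^+ 2 * (a ^+ 2 + b ^+ 2 + c ^+ 2) - 2 * w * (x * a + y * b + z * c))).
    by rewrite /w' /A /B; ring.
  by rewrite def_n; ring.
have [w'_le0|w'_gt0] := lerP w' 0.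
  have e0 : (x - w * a) ^+ 2 + (y - w * b) ^+ 2 + (z - w * c) ^+ 2 <= 0 by rewrite -ww' mulr_ge0_le0 // ltW.
  have := sqr_ge0 (x - w * a); have := sqr_ge0 (y - w * b); have := sqr_ge0 (z - w * c).
  move=> hz hy hx.
  have /eqP : (x - w * a) ^+ 2 = 0 by lra.
  have /eqP : (y - w * b) ^+ 2 = 0 by lra.
  have /eqP : (z - w * c) ^+ 2 = 0 by lra.
  rewrite !sqrf_eq0 !subr_eq0 => /eqP ez /eqP ey /eqP ex.
  exists a, b, c; have w2 : w ^+ 2 != 0 by rewrite sqrf_eq0 gt_eqF.
  by apply: (mulIf w2); rewrite def_n ex ey ez; ring.
have lt_w : w' < w.
  have w2_gt0 : 0 < w ^+ 2 by rewrite exprn_gt0.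
  have le_ww : 4 * (w * w') <= 3 * w ^+ 2 by rewrite ww'; lra.
  rewrite ltNge; apply/negP => le_w.
  have : w ^+ 2 <= w * w' by rewrite expr2 ler_pM2l.
  by move=> le_ww2; lra.
apply: (IHk (A * x + B * a) (A * y + B * b) (A * z + B * c) w' _ w'_gt0).
  by apply: leq_trans le_wk; rewrite -ltz_nat !gtz0_abs.
transitivity (A ^+ 2 * (n * w ^+ 2) + 2 * A * B * (n * w) + n * B ^+ 2); first by rewrite /w'; ring.
transitivity (A ^+ 2 * (n * w ^+ 2) + A * B * 2 * (x * a + y * b + z * c) + B ^+ 2 * (A + n)).
  have -> : 2 * A * B * (n * w) = A * B * B + A * B * 2 * (x * a + y * b + z * c).
    have e : 2 * (n * w) = B + 2 * (x * a + y * b + z * c) by rewrite /B; ring.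
    by transitivity (A * B * (2 * (n * w))); [ring | rewrite e; ring].
  by ring.
by rewrite def_n /A; ring.
Qed.

Definition rationally_two_squares (b : nat) :=
  exists u v w : int, w != 0 /\ b%:Z * w ^+ 2 = u ^+ 2 + v ^+ 2.

Lemma squarefree_nonsquare n k : squarefree n -> (1 < n)%N -> (k ^ 2 <> n)%N.
Proof.
move=> sqf n_gt1 def_n; have k_gt1 : (1 < k)%N.
  by move: n_gt1; rewrite -def_n; case: k {def_n} => [|[]].
have := sqf _ (pdiv_prime k_gt1); rewrite -def_n => /negP; apply.
by rewrite dvdn_exp2r // pdiv_dvd.
Qed.

Lemma prime_squarefree p : prime p -> squarefree p.
Proof.
move=> p_pr r r_pr; apply/negP => dvd_r.
have /eqP def_r : r == p by rewrite -dvdn_prime2 // (dvdn_trans _ dvd_r) // dvdn_mulr.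
move: dvd_r; rewrite def_r => /(dvdn_leq (prime_gt0 p_pr)).
by rewrite leqNgt ltn_Pmulr ?prime_gt1 ?prime_gt0.
Qed.

(** As -1 is a square modulo [q], the ternary equation with [b = 1] applies. *)
Lemma two_squares_one_or_prime q : q = 1%N \/ prime q -> (q %% 4 = 1)%N -> rationally_two_squares q.
Proof.
case=> [-> _|q_pr q4]; first by exists 1, 0, 1.
have q_odd : odd q by rewrite -(@odd_mod q 4) // q4.
have leg1 : legendre (- 1%:R : 'F_q) = 1 by rewrite legendreN1 // /chi4 q4.
have [r dvd_q] := legendre_neg_square q_pr q_odd leg1.
have [||z [t [w [w0 def_q]]]] := @legendre_ternary q 1 r 0 (prime_gt1 q_pr) _ isT (coprimen1 _) dvd_q.
- by move=> k; apply: squarefree_nonsquare (prime_squarefree q_pr) (prime_gt1 q_pr).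
- by rewrite !modn1.
by exists z, t, w; rewrite w0 -def_q mul1r.
Qed.

Lemma two_squares_double q : rationally_two_squares q -> rationally_two_squares (2 * q).
Proof.
case=> [u [v [w [w0 e]]]]; exists (u + v), (u - v), w; split=> //.
rewrite PoszM -mulrA e; ring.
Qed.

Lemma three_squares_of_ternary (n b r s : nat) : (0 < n)%N -> squarefree n -> (0 < b)%N ->
    coprime n b -> (n %| r ^ 2 + b)%N -> (s ^ 2 = n %[mod b])%N -> rationally_two_squares b ->
  sum_of_three_squares n%:Z.
Proof.
move=> n_gt0 sqf b_gt0 co_nb n_dvd b_mod [u [v [w1 [w1_neq0 def_b]]]].
have [n_le1|n_gt1] := leqP n 1.
  have -> : n = 1%N by apply/eqP; rewrite eqn_leq n_le1.
  by exists 1, 0, 0.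
have [k|z [t [w [w_neq0 def_n]]]] := legendre_ternary n_gt1 _ b_gt0 co_nb n_dvd b_mod.
  exact: squarefree_nonsquare.
apply: (@davenport_cassels n%:Z (z * w1) (u * t) (v * t) `|w * w1|).
  by rewrite normr_gt0 mulf_neq0.
rewrite real_normK ?num_real // exprMn mulrA -def_n.
transitivity (z ^+ 2 * w1 ^+ 2 + (b%:Z * w1 ^+ 2) * t ^+ 2); first by ring.
by rewrite def_b; ring.
Qed.

Lemma neg_square_double n r b : odd n -> odd b -> (n %| r ^ 2 + b)%N ->
  exists r', (2 * n %| r' ^ 2 + b)%N.
Proof.
move=> n_odd b_odd dvd_n; have co2n : coprime 2 n by rewrite coprime2n.
exists (if odd r then r else r + n)%N; rewrite Gauss_dvd // dvdn2 oddD oddX b_odd addbT negbK.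
case: ifP => r_odd; first by rewrite r_odd.
rewrite oddD r_odd n_odd /= (_ : (r + n) ^ 2 + b = (r ^ 2 + b) + n * (2 * r + n))%N; last by ring.
by rewrite dvdn_add // dvdn_mulr.
Qed.

Lemma square_mod_double n q s : odd n -> odd q -> (s ^ 2 = n %[mod q])%N ->
  exists s', (s' ^ 2 = n %[mod 2 * q])%N.
Proof.
move=> n_odd q_odd mod_q; have co2q : coprime 2 q by rewrite coprime2n.
exists (if odd s then s else s + q)%N; apply/eqP; rewrite chinese_remainder //.
apply/andP; split; last by case: ifP => _; rewrite ?mod_q // -modnXm modnDr modnXm mod_q.
by rewrite !modn2 oddX n_odd; case: ifP => s_odd; rewrite ?oddD s_odd ?q_odd.
Qed.

Lemma legendre_nat_pred p n : prime p -> odd p -> (0 < n)%N -> (p %| n)%N ->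
  legendre_nat p n.-1 = chi4 p.
Proof.
move=> p_pr p_odd n_gt0 dvd_pn; rewrite -legendreN1 //; congr legendre.
by apply/eqP; rewrite -subr_eq0 opprK natr1 prednK // natFp_eq0.
Qed.

Lemma chi4_sqr p : odd p -> chi4 p * chi4 p = 1.
Proof. by case/chi4_pm1 => ->. Qed.

Lemma legendre_nat_reciprocity p q : prime p -> odd p -> prime q -> (q %% 4 = 1)%N -> p != q ->
  legendre_nat q p = legendre_nat p q.
Proof.
move=> p_pr p_odd q_pr q4 neq_pq; have q_odd : odd q by rewrite -(@odd_mod q 4) // q4.
apply: quadratic_reciprocity1 => //.
by rewrite -subn1 -eqn_mod_dvd ?prime_gt0 // q4.
Qed.

(** Here [b = q], with the symbol of [q] at each [p] dividing [n] equal to that of -1, represented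
    by [n.-1]; so [- q] is a square modulo [n]. Reciprocity gives [n] the symbol [chi4 n = 1] modulo
    [q]. The residue 5 modulo 8 excludes [q = 1]. *)
Lemma three_squares_1mod4 n : (0 < n)%N -> squarefree n -> (n %% 4 = 1)%N ->
  sum_of_three_squares n%:Z.
Proof.
move=> n_gt0 sqf n4; have n_odd : odd n by rewrite -(@odd_mod n 4) // n4.
have co_n : coprime n.-1 n by rewrite coprimePn.
have [q [q1_pr q8 co_qn leg_q]] := auxiliary_prime n_odd (or_intror (erefl 5)) co_n.
have q_pr : prime q by case: q1_pr q8 => // ->.
have q4 : (q %% 4 = 1)%N by rewrite mod4_mod8 q8.
have q_odd : odd q by rewrite -(@odd_mod q 4) // q4.
have leg_chi p : prime p -> (p %| n)%N -> legendre_nat p q = chi4 p.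
  by move=> p_pr dvd_pn; rewrite leg_q // legendre_nat_pred // (dvdn_odd dvd_pn).
have [r r_dvd] : exists r, (n %| r ^ 2 + q)%N.
  apply: crt_neg_square => // p p_pr dvd_pn; have p_odd := dvdn_odd dvd_pn n_odd.
  apply: legendre_neg_square => //; rewrite -mulN1r legendreM // legendreN1 //.
  by rewrite -[legendre _]/(legendre_nat p q) leg_chi // chi4_sqr.
have leg_qn : legendre_nat q n = chi4 n.
  apply: legendre_multiplicative => //; first exact: chi4M.
  move=> p p_pr dvd_pn; rewrite -leg_chi // legendre_nat_reciprocity // ?(dvdn_odd dvd_pn) //.
  by apply: contraTneq co_qn => <-; rewrite prime_coprime // dvd_pn.
have [s s_mod] : exists s, (s ^ 2 = n %[mod q])%N.
  by apply: legendre_nat_square => //; rewrite leg_qn /chi4 n4.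
apply: (@three_squares_of_ternary n q r s) => //.
- exact: prime_gt0.
- by rewrite coprime_sym.
- exact: two_squares_one_or_prime.
Qed.

(** With [b = q] the symbol of [n] would be [chi4 n = -1]. Taking [b = 2 q] and prescribing the
    symbols of -2 instead, it becomes [chi8 n * chi4 n], where both factors are -1. *)
Lemma three_squares_3mod8 n : (0 < n)%N -> squarefree n -> (n %% 8 = 3)%N ->
  sum_of_three_squares n%:Z.
Proof.
move=> n_gt0 sqf n8; have n_odd : odd n by rewrite -(@odd_mod n 8) // n8.
have co_n : coprime (2 * n.-1) n by rewrite coprimeMl coprime2n n_odd coprimePn.
have [q [q1_pr q8 co_qn leg_q]] := auxiliary_prime n_odd (or_intror (erefl 5)) co_n.
have q_pr : prime q by case: q1_pr q8 => // ->.
have q4 : (q %% 4 = 1)%N by rewrite mod4_mod8 q8.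
have q_odd : odd q by rewrite -(@odd_mod q 4) // q4.
have leg_chi p : prime p -> (p %| n)%N -> legendre_nat p q = chi8 p * chi4 p.
  move=> p_pr dvd_pn; have p_odd := dvdn_odd dvd_pn n_odd.
  rewrite leg_q // /legendre_nat natrM legendreM // legendre2 //.
  by congr (_ * _); apply: legendre_nat_pred.
have [r r_dvd] : exists r, (n %| r ^ 2 + 2 * q)%N.
  apply: crt_neg_square => // p p_pr dvd_pn; have p_odd := dvdn_odd dvd_pn n_odd.
  apply: legendre_neg_square => //; rewrite natrM -mulN1r !legendreM // legendreN1 // legendre2 //.
  rewrite -[legendre q%:R]/(legendre_nat p q) leg_chi //.
  by case: (chi4_pm1 p_odd) (chi8_pm1 p_odd) => -> [] ->.
have leg_qn : legendre_nat q n = chi8 n * chi4 n.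
  apply: (@legendre_multiplicative q n (fun m => chi8 m * chi4 m)) => //.
    by move=> a b; rewrite chi8M chi4M mulrACA.
  move=> p p_pr dvd_pn; rewrite -leg_chi // legendre_nat_reciprocity // ?(dvdn_odd dvd_pn) //.
  by apply: contraTneq co_qn => <-; rewrite prime_coprime // dvd_pn.
have [s0 s0_mod] : exists s, (s ^ 2 = n %[mod q])%N.
  by apply: legendre_nat_square => //; rewrite leg_qn /chi4 /chi8 mod4_mod8 n8.
have [s s_mod] := square_mod_double n_odd q_odd s0_mod.
apply: (@three_squares_of_ternary n (2 * q) r s) => //.
- by rewrite muln_gt0 (prime_gt0 q_pr).
- by rewrite coprimeMr coprimen2 n_odd coprime_sym.
- exact/two_squares_double/two_squares_one_or_prime.
Qed.

(** The symbol of [2 n] modulo [q] is [chi8 q * chi4 n]; the residue [c] of [q] modulo 8 is chosen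
    to make it 1. The value [q = 1] can occur here and satisfies the congruence trivially. *)
Lemma three_squares_2mod4 n : (0 < n)%N -> squarefree (2 * n) -> odd n ->
  sum_of_three_squares (2 * n)%N%:Z.
Proof.
move=> n_gt0 sqf n_odd; have sqf_n : squarefree n by apply: squarefree_dvd sqf; rewrite dvdn_mull.
have co_n : coprime n.-1 n by rewrite coprimePn.
pose c := if (n %% 4 == 1)%N then 1%N else 5.
have c15 : c = 1%N \/ c = 5%N by rewrite /c; case: ifP; [left | right].
have [q [q1_pr q8 co_qn leg_q]] := auxiliary_prime n_odd c15 co_n.
have q4 : (q %% 4 = 1)%N by rewrite mod4_mod8 q8; case: c15 => ->.
have q_odd : odd q by rewrite -(@odd_mod q 4) // q4.
have leg_chi p : prime p -> (p %| n)%N -> legendre_nat p q = chi4 p.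
  by move=> p_pr dvd_pn; rewrite leg_q // legendre_nat_pred // (dvdn_odd dvd_pn).
have [r0 r0_dvd] : exists r, (n %| r ^ 2 + q)%N.
  apply: crt_neg_square => // p p_pr dvd_pn; have p_odd := dvdn_odd dvd_pn n_odd.
  apply: legendre_neg_square => //; rewrite -mulN1r legendreM // legendreN1 //.
  by rewrite -[legendre _]/(legendre_nat p q) leg_chi // chi4_sqr.
have [r r_dvd] := neg_square_double n_odd q_odd r0_dvd.
have [s s_mod] : exists s, (s ^ 2 = 2 * n %[mod q])%N.
  case: q1_pr => [->|q_pr]; first by exists 0%N; rewrite !modn1.
  apply: legendre_nat_square => //.
  have leg_qn : legendre_nat q n = chi4 n.
    apply: legendre_multiplicative => //; first exact: chi4M.
    move=> p p_pr dvd_pn; rewrite -leg_chi // legendre_nat_reciprocity // ?(dvdn_odd dvd_pn) //.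
    by apply: contraTneq co_qn => <-; rewrite prime_coprime // dvd_pn.
  rewrite /legendre_nat natrM legendreM // legendre2 // -[legendre n%:R]/(legendre_nat q n) leg_qn.
  rewrite /chi8 q8 /c /chi4 mod4_mod8.
  by case: (odd_mod8 n_odd) => ->.
apply: (@three_squares_of_ternary (2 * n) q r s) => //.
- by rewrite muln_gt0.
- exact: odd_gt0.
- by rewrite coprimeMl coprime2n q_odd coprime_sym.
- exact: two_squares_one_or_prime.
Qed.

Theorem three_squares n : (n %% 4 = 1 \/ n %% 4 = 2 \/ n %% 8 = 3)%N -> sum_of_three_squares n%:Z.
Proof.
move=> n_mod; have n_gt0 : (0 < n)%N by case: n n_mod => // [[|[]]].
have [m [s [m_gt0 s_gt0 sqf def_n]]] := squarefree_decomp n_gt0.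
suff [x [y [z def_m]]] : sum_of_three_squares m%:Z.
  exists (s%:Z * x), (s%:Z * y), (s%:Z * z).
  by rewrite def_n PoszM def_m -mulnn PoszM; ring.
have s_odd : odd s.
  case: (boolP (odd s)) => // s_even; exfalso; have /dvdnP[t def_s] : (2 %| s)%N by rewrite dvdn2.
  move: n_mod; rewrite def_n def_s expnMn mulnA -[(2 ^ 2)%N]/4%N modnMl.
  case=> [//|[//|n8]]; have := mod4_mod8 (m * t ^ 2 * 4); by rewrite n8 modnMl.
have s8 : (s ^ 2 = 1 %[mod 8])%N by rewrite -modnXm; case: (odd_mod8 s_odd) => ->.
have n8 : (n %% 8 = m %% 8)%N by rewrite def_n -modnMmr s8 modnMmr muln1.
rewrite !(mod4_mod8 n) n8 -(mod4_mod8 m) in n_mod.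
case: n_mod => [m4|[m4|m8]].
- exact: three_squares_1mod4.
- have /dvdnP[k def_m] : (2 %| m)%N by rewrite /dvdn -(@modn_dvdm 4) // m4.
  rewrite mulnC in def_m; rewrite def_m; rewrite def_m in sqf m_gt0 m4.
  apply: three_squares_2mod4 => //; first by rewrite muln_gt0 in m_gt0.
  case: (boolP (odd k)) => // k_even; exfalso; move: m4; have /dvdnP[j ->] : (2 %| k)%N by rewrite dvdn2.
  by rewrite mulnCA modnMl.
- exact: three_squares_3mod8.
Qed.

(** * Sums of generalized pentagonal numbers *)

Lemma three_squares_int (N : int) : 0 <= N ->
    [\/ (N %% 4)%Z = 1, (N %% 4)%Z = 2 | (N %% 8)%Z = 3] -> sum_of_three_squares N.
Proof.
case: N => // n _; rewrite !modz_nat => H; apply: three_squares.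
by case: H => [[]|[]|[]] ->; [left | right; left | right; right].
Qed.

Lemma sqr_mod16 (x : int) :
  [\/ (x %% 4)%Z = 0 /\ (x ^+ 2 %% 16)%Z = 0, (x %% 4)%Z = 2 /\ (x ^+ 2 %% 16)%Z = 4,
      ((x %% 8)%Z = 1 \/ (x %% 8)%Z = 7) /\ (x ^+ 2 %% 16)%Z = 1
    | ((x %% 8)%Z = 3 \/ (x %% 8)%Z = 5) /\ (x ^+ 2 %% 16)%Z = 9].
Proof.
have [k [r [def_x r8]]] : exists k r : int, x = 8 * k + r /\ 0 <= r < 8.
  by exists (x %/ 8)%Z, (x %% 8)%Z; lia.
have def_x2 : x ^+ 2 = 16 * (4 * k ^+ 2 + k * r) + r ^+ 2 by rewrite def_x; ring.
move: def_x2; move: (x ^+ 2) (4 * k ^+ 2 + k * r) => y m def_y.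
case: r r8 def_x def_y => [[|[|[|[|[|[|[|[|r]]]]]]]]|r] // _ def_x;
  [rewrite -[_ ^+ 2]/(0 : int) | rewrite -[_ ^+ 2]/(1 : int) | rewrite -[_ ^+ 2]/(4 : int)
  | rewrite -[_ ^+ 2]/(9 : int) | rewrite -[_ ^+ 2]/(16 : int) | rewrite -[_ ^+ 2]/(25 : int)
  | rewrite -[_ ^+ 2]/(36 : int) | rewrite -[_ ^+ 2]/(49 : int)] => def_y.
- by constructor 1; lia.
- by constructor 3; lia.
- by constructor 2; lia.
- by constructor 4; lia.
- by constructor 1; lia.
- by constructor 4; lia.
- by constructor 2; lia.
- by constructor 3; lia.
Qed.

Lemma sqr_mod3 (x : int) :
  ((x %% 3)%Z = 0 /\ (x ^+ 2 %% 9)%Z = 0) \/ ((x %% 3)%Z != 0 /\ (x ^+ 2 %% 3)%Z = 1).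
Proof.
have [k [r [def_x r3]]] : exists k r : int, x = 3 * k + r /\ 0 <= r < 3.
  by exists (x %/ 3)%Z, (x %% 3)%Z; lia.
case: r r3 def_x => [[|[|[|r]]]|r] // _ def_x.
- have : x ^+ 2 = 9 * k ^+ 2 by rewrite def_x; ring.
  by move: (x ^+ 2) (k ^+ 2) => y m def_y; left; lia.
- have : x ^+ 2 = 3 * (3 * k ^+ 2 + 2 * k) + 1 by rewrite def_x; ring.
  by move: (x ^+ 2) (3 * k ^+ 2 + 2 * k) => y m def_y; right; lia.
- have : x ^+ 2 = 3 * (3 * k ^+ 2 + 4 * k + 1) + 1 by rewrite def_x; ring.
  by move: (x ^+ 2) (3 * k ^+ 2 + 4 * k + 1) => y m def_y; right; lia.
Qed.

Lemma sqr_mod5 (x : int) :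
  [\/ (x %% 5)%Z = 0 /\ (x ^+ 2 %% 5)%Z = 0,
      ((x %% 5)%Z = 1 \/ (x %% 5)%Z = 4) /\ (x ^+ 2 %% 5)%Z = 1
    | ((x %% 5)%Z = 2 \/ (x %% 5)%Z = 3) /\ (x ^+ 2 %% 5)%Z = 4].
Proof.
have [k [r [def_x r5]]] : exists k r : int, x = 5 * k + r /\ 0 <= r < 5.
  by exists (x %/ 5)%Z, (x %% 5)%Z; lia.
have def_x2 : x ^+ 2 = 5 * (5 * k ^+ 2 + 2 * k * r) + r ^+ 2 by rewrite def_x; ring.
move: def_x2; move: (x ^+ 2) (5 * k ^+ 2 + 2 * k * r) => y m def_y.
case: r r5 def_x def_y => [[|[|[|[|[|r]]]]]|r] // _ def_x;
  [rewrite -[_ ^+ 2]/(0 : int) | rewrite -[_ ^+ 2]/(1 : int) | rewrite -[_ ^+ 2]/(4 : int)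
  | rewrite -[_ ^+ 2]/(9 : int) | rewrite -[_ ^+ 2]/(16 : int)] => def_y.
- by constructor 1; lia.
- by constructor 2; lia.
- by constructor 3; lia.
- by constructor 3; lia.
- by constructor 2; lia.
Qed.

Lemma sqr_mod4 (x : int) :
  ((x %% 2)%Z = 0 /\ (x ^+ 2 %% 4)%Z = 0) \/ ((x %% 2)%Z = 1 /\ (x ^+ 2 %% 8)%Z = 1).
Proof.
case: (sqr_mod16 x) => -[]; move: (x ^+ 2) => y h1 h2; [left|left|right|right]; lia.
Qed.

(** [P] carries a condition modulo 3 through the reordering by parity. *)
Lemma two_odd_squares (P : int -> Prop) (x y z N : int) : P x -> P y -> P z ->
    x ^+ 2 + y ^+ 2 + z ^+ 2 = N -> (N %% 4)%Z = 2 ->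
  exists u v w : int, [/\ P u /\ P v /\ P w, (u %% 2)%Z = 1, (v %% 2)%Z = 1, (w %% 2)%Z = 0
    & u ^+ 2 + v ^+ 2 + w ^+ 2 = N].
Proof.
move=> Px Py Pz def_N N4.
case: (sqr_mod4 x) => -[x2 sx]; case: (sqr_mod4 y) => -[y2 sy]; case: (sqr_mod4 z) => -[z2 sz];
  try (exfalso; move: (x ^+ 2) (y ^+ 2) (z ^+ 2) sx sy sz def_N => X Y Z; lia).
- by exists y, z, x; split=> //; rewrite -def_N; ring.
- by exists x, z, y; split=> //; rewrite -def_N; ring.
- by exists x, y, z.
Qed.

Lemma one_odd_square (x y z N : int) : x ^+ 2 + y ^+ 2 + z ^+ 2 = N -> (N %% 4)%Z = 1 ->
  exists u v w : int, [/\ (u %% 2)%Z = 1, (v %% 2)%Z = 0, (w %% 2)%Z = 0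
    & u ^+ 2 + v ^+ 2 + w ^+ 2 = N].
Proof.
move=> def_N N4.
case: (sqr_mod4 x) => -[x2 sx]; case: (sqr_mod4 y) => -[y2 sy]; case: (sqr_mod4 z) => -[z2 sz];
  try (exfalso; move: (x ^+ 2) (y ^+ 2) (z ^+ 2) sx sy sz def_N => X Y Z; lia).
- by exists z, x, y; split=> //; rewrite -def_N; ring.
- by exists y, x, z; split=> //; rewrite -def_N; ring.
- by exists x, y, z.
Qed.

(** * Restoring primality to 3 *)

Definition unit6 (x : int) := (x %% 2)%Z = 1 /\ (x %% 3)%Z != 0.

(** The step that replaces [3 y] and [3 z] by coordinates prime to 6 at the same value of the form.
    It amounts to an element of norm 9 in the ring generated by a square root of [- c], other than 3
    up to sign. *)
Definition trisection (c : int) := forall y z : int, (y %% 2)%Z = 1 -> (z %% 2)%Z = 1 ->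
  (y %% 3)%Z != 0 \/ (z %% 3)%Z != 0 ->
  exists u v : int, [/\ unit6 u, unit6 v & u ^+ 2 + c * v ^+ 2 = 9 * (y ^+ 2 + c * z ^+ 2)].

(* Multiplication by [1 + 2 * sqrt (- 2)], of norm 9, or by its conjugate. *)
Lemma trisection2 : trisection 2.
Proof.
move=> y z y2 z2 yz3; have [nyz|nyz] : ((y - z) %% 3)%Z != 0 \/ ((y + z) %% 3)%Z != 0 by lia.
  by exists (y - 4 * z), (2 * y + z); split; [split; lia | split; lia | ring].
by exists (y + 4 * z), (2 * y - z); split; [split; lia | split; lia | ring].
Qed.

(* Multiplication by [2 + sqrt (- 5)], of norm 9, or by its conjugate. *)
Lemma trisection5 : trisection 5.
Proof.
move=> y z y2 z2 yz3; have [nyz|nyz] : ((y - z) %% 3)%Z != 0 \/ ((y + z) %% 3)%Z != 0 by lia.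
  by exists (2 * y - 5 * z), (y + 2 * z); split; [split; lia | split; lia | ring].
by exists (2 * y + 5 * z), (y - 2 * z); split; [split; lia | split; lia | ring].
Qed.

(** The factor 3 is divided out until one coordinate is prime to 3, then restored by one
    [trisection] per division. Oddness of [y] keeps it nonzero, so the division ends. *)
Lemma unit6_descent (c y z : int) : trisection c -> (y %% 2)%Z = 1 -> (z %% 2)%Z = 1 ->
    (y %% 3)%Z = 0 -> (z %% 3)%Z = 0 ->
  exists u v : int, [/\ unit6 u, unit6 v & u ^+ 2 + c * v ^+ 2 = y ^+ 2 + c * z ^+ 2].
Proof.
move=> tri_c; have [k] := ubnP `|y|%N; elim: k y z => // k IHk y z le_yk y2 z2 y3 z3.
have [[a def_y] [b def_z]] : (exists a, y = 3 * a) /\ (exists b, z = 3 * b).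
  by split; [exists (y %/ 3)%Z | exists (z %/ 3)%Z]; lia.
have def_N : y ^+ 2 + c * z ^+ 2 = 9 * (a ^+ 2 + c * b ^+ 2) by rewrite def_y def_z; ring.
have a2 : (a %% 2)%Z = 1 by lia.
have b2 : (b %% 2)%Z = 1 by lia.
have [ab3|/andP[/eqP a3 /eqP b3]] : ((a %% 3)%Z != 0 \/ (b %% 3)%Z != 0) \/
    ((a %% 3)%Z == 0) && ((b %% 3)%Z == 0) by lia.
  by rewrite def_N; apply: tri_c.
have [|u [v [[u2 u3] [v2 v3] def_uv]]] := IHk a b _ a2 b2 a3 b3; first by lia.
by rewrite def_N -def_uv; apply: tri_c => //; left.
Qed.

(* Three times the reflection orthogonal to [(1, 1, 1)], after a change of signs. *)
Lemma trisection3 (a b c : int) :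
    [\/ (a %% 3)%Z != 0, (b %% 3)%Z != 0 | (c %% 3)%Z != 0] ->
  exists u v w : int, [/\ (u %% 3)%Z != 0, (v %% 3)%Z != 0, (w %% 3)%Z != 0
    & u ^+ 2 + v ^+ 2 + w ^+ 2 = 9 * (a ^+ 2 + b ^+ 2 + c ^+ 2)].
Proof.
move=> abc3.
have step a' b' c' : ((a' + b' + c') %% 3)%Z != 0 -> exists u v w : int,
    [/\ (u %% 3)%Z != 0, (v %% 3)%Z != 0, (w %% 3)%Z != 0
      & u ^+ 2 + v ^+ 2 + w ^+ 2 = 9 * (a' ^+ 2 + b' ^+ 2 + c' ^+ 2)].
  move=> s3; pose s := a' + b' + c'.
  exists (3 * a' - 2 * s), (3 * b' - 2 * s), (3 * c' - 2 * s).
  by split; [rewrite /s; clear -s3; lia .. | rewrite /s; ring].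
have : [\/ ((a + b + c) %% 3)%Z != 0, ((- a + b + c) %% 3)%Z != 0,
    ((a - b + c) %% 3)%Z != 0 | ((a + b - c) %% 3)%Z != 0].
  case: (eqVneq ((a + b + c) %% 3)%Z 0) => s1; last by constructor 1.
  case: (eqVneq ((- a + b + c) %% 3)%Z 0) => s2; last by constructor 2.
  case: (eqVneq ((a - b + c) %% 3)%Z 0) => s3; last by constructor 3.
  by constructor 4; clear -abc3 s1 s2 s3; case: abc3 => h; lia.
by case=> /step[u [v [w [? ? ? e]]]]; exists u, v, w; rewrite ?sqrrN in e.
Qed.

(** Modulo 3 the coordinates are all divisible or all prime to 3. In the first case the 9 is divided
    out, which decreases [N > 0], and put back by [trisection3]. *)
Lemma units3_of_three_squares (x y z N : int) : x ^+ 2 + y ^+ 2 + z ^+ 2 = N -> 0 < N ->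
    (N %% 3)%Z = 0 ->
  exists u v w : int, [/\ (u %% 3)%Z != 0, (v %% 3)%Z != 0, (w %% 3)%Z != 0
    & u ^+ 2 + v ^+ 2 + w ^+ 2 = N].
Proof.
have [k] := ubnP `|N|%N; elim: k N x y z => // k IHk N x y z le_k def_N N_gt0 N3.
have [[x3 y3 z3]|[x3 y3 z3]] : [/\ (x %% 3)%Z = 0, (y %% 3)%Z = 0 & (z %% 3)%Z = 0] \/
    [/\ (x %% 3)%Z != 0, (y %% 3)%Z != 0 & (z %% 3)%Z != 0].
- case: (sqr_mod3 x) => -[x3 sx]; case: (sqr_mod3 y) => -[y3 sy]; case: (sqr_mod3 z) => -[z3 sz];
    try (exfalso; move: (x ^+ 2) (y ^+ 2) (z ^+ 2) sx sy sz def_N => X Y Z;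
         clear -N3; lia).
  + by left.
  + by right.
- have [[a def_x] [[b def_y] [c def_z]]] :
      (exists a, x = 3 * a) /\ (exists b, y = 3 * b) /\ (exists c, z = 3 * c).
    by clear -x3 y3 z3; split; [exists (x %/ 3)%Z | split; [exists (y %/ 3)%Z | exists (z %/ 3)%Z]]; lia.
  have {}def_N : N = 9 * (a ^+ 2 + b ^+ 2 + c ^+ 2).
    by rewrite -def_N def_x def_y def_z; ring.
  pose M := a ^+ 2 + b ^+ 2 + c ^+ 2; rewrite -/M in def_N.
  have abc3 : [\/ (a %% 3)%Z != 0, (b %% 3)%Z != 0 | (c %% 3)%Z != 0] \/ (M %% 3)%Z = 0.
    case: (sqr_mod3 a) => -[a3 sa]; last by left; constructor 1.
    case: (sqr_mod3 b) => -[b3 sb]; last by left; constructor 2.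
    case: (sqr_mod3 c) => -[c3 sc]; last by left; constructor 3.
    right; rewrite /M; move: (a ^+ 2) (b ^+ 2) (c ^+ 2) sa sb sc => A B C; clear; lia.
  case: abc3 => [/trisection3 | M3]; first by rewrite def_N.
  have M_gt0 : 0 < M by clear -N_gt0 def_N; lia.
  have lt_M : (`|M| < k)%N by clear -le_k def_N M_gt0; lia.
  have [u [v [w [u3 v3 w3 def_M]]]] := IHk M a b c lt_M (erefl _) M_gt0 M3.
  by rewrite def_N -def_M; apply: trisection3; constructor 1.
- by exists x, y, z.
Qed.

(** * From pentagonal numbers to squares of units modulo 6 *)

Lemma pentagonalE (x : int) : 2 * polygonal 5 x = 3 * x ^+ 2 - x.
Proof. by rewrite polygonalE -[5%:Z - 2]/(3 : int) -[5%:Z - 4]/(1 : int) mul1r. Qed.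

Lemma pentagonal_of_unit6 (X : int) : unit6 X -> exists x, X ^+ 2 = 24 * polygonal 5 x + 1.
Proof.
move=> X6; have [x [def_X|def_X]] : exists x, X = 6 * x - 1 \/ X = 1 - 6 * x.
  case: X6 => X2 X3; have [X6|X6] : ((X %% 6)%Z = 1 \/ (X %% 6)%Z = 5) by lia.
    by exists ((1 - X) %/ 6)%Z; right; lia.
  by exists ((X + 1) %/ 6)%Z; left; lia.
all: exists x; transitivity (12 * (2 * polygonal 5 x) + 1); last by ring.
all: by rewrite pentagonalE def_X; ring.
Qed.

Lemma pentagonal_ge0 (x : int) : 0 <= polygonal 5 x.
Proof.
rewrite -(pmulr_rge0 _ (isT : 0 < (2 : int))) pentagonalE subr_ge0.
by have [x_le0|x_gt0] := lerP x 0; nia.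
Qed.

Lemma universal_of_units (a b c : nat) :
    (forall n : int, 0 <= n -> exists X Y Z : int, [/\ unit6 X, unit6 Y, unit6 Z
       & a%:Z * X ^+ 2 + b%:Z * Y ^+ 2 + c%:Z * Z ^+ 2 = 24 * n + (a + b + c)%N%:Z]) ->
  universal a b c 5 5 5.
Proof.
move=> repr n; split=> [[x [y [z ->]]]|/repr[X [Y [Z [X6 Y6 Z6 e]]]]].
  by rewrite !addr_ge0 // mulr_ge0 // pentagonal_ge0.
have [x eX] := pentagonal_of_unit6 X6; have [y eY] := pentagonal_of_unit6 Y6.
have [z eZ] := pentagonal_of_unit6 Z6.
exists x, y, z; rewrite eX eY eZ !PoszD in e.
have h24 : (24 : int) != 0 by [].
apply: (mulfI h24); apply: (addIr (a%:Z + b%:Z + c%:Z)); rewrite -e; ring.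
Qed.

(** Modulo 3, either all coordinates are units, or [Z] and exactly one of [X], [Y] are multiples of
    3; that pair is repaired by [unit6_descent]. *)
Lemma units_11c (c X Y Z N : int) : trisection c -> (c %% 3)%Z = 2 ->
    (X %% 2)%Z = 1 -> (Y %% 2)%Z = 1 -> (Z %% 2)%Z = 1 ->
    X ^+ 2 + Y ^+ 2 + c * Z ^+ 2 = N -> (N %% 3)%Z = 1 ->
  exists U V W : int, [/\ unit6 U, unit6 V, unit6 W & U ^+ 2 + V ^+ 2 + c * W ^+ 2 = N].
Proof.
move=> tri_c c3 X2 Y2 Z2 def_N N3.
have [k def_c] : exists k, c = 3 * k + 2 by exists (c %/ 3)%Z; lia.
have e3 : X ^+ 2 + Y ^+ 2 + 2 * Z ^+ 2 + 3 * (k * Z ^+ 2) = N by rewrite -def_N def_c; ring.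
case: (sqr_mod3 X) => -[X3 sX]; case: (sqr_mod3 Y) => -[Y3 sY]; case: (sqr_mod3 Z) => -[Z3 sZ];
  try (exfalso; move: (k * Z ^+ 2) (X ^+ 2) (Y ^+ 2) (Z ^+ 2) sX sY sZ e3; clear -N3; lia).
- have [V [W [V6 W6 e]]] := unit6_descent tri_c X2 Z2 X3 Z3.
  by exists V, Y, W; split=> //; rewrite -def_N addrAC e; ring.
- have [V [W [V6 W6 e]]] := unit6_descent tri_c Y2 Z2 Y3 Z3.
  by exists X, V, W; split=> //; rewrite -def_N -addrA e; ring.
- by exists X, Y, Z.
Qed.

Lemma units_122 (X Y Z N : int) :
    (X %% 2)%Z = 1 -> (Y %% 2)%Z = 1 -> (Z %% 2)%Z = 1 ->
    X ^+ 2 + 2 * Y ^+ 2 + 2 * Z ^+ 2 = N -> (N %% 3)%Z = 2 ->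
  exists U V W : int, [/\ unit6 U, unit6 V, unit6 W & U ^+ 2 + 2 * V ^+ 2 + 2 * W ^+ 2 = N].
Proof.
move=> X2 Y2 Z2 def_N N3.
case: (sqr_mod3 X) => -[X3 sX]; case: (sqr_mod3 Y) => -[Y3 sY]; case: (sqr_mod3 Z) => -[Z3 sZ];
  try (exfalso; move: (X ^+ 2) (Y ^+ 2) (Z ^+ 2) sX sY sZ def_N; clear -N3; lia).
- have [V [W [V6 W6 e]]] := unit6_descent trisection2 X2 Y2 X3 Y3.
  by exists V, W, Z; split=> //; rewrite -def_N e.
- have [V [W [V6 W6 e]]] := unit6_descent trisection2 X2 Z2 X3 Z3.
  by exists V, Y, W; split=> //; rewrite -def_N addrAC e; ring.
- by exists X, Y, Z.
Qed.

(** If not all are units, [Y] is divisible by 3 together with [X] or [Z]. The latter pair also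
    belongs to the form with [c = 2], because [2 Y^2 + 4 Z^2] is twice [Y^2 + 2 Z^2]. *)
Lemma units_124 (X Y Z N : int) :
    (X %% 2)%Z = 1 -> (Y %% 2)%Z = 1 -> (Z %% 2)%Z = 1 ->
    X ^+ 2 + 2 * Y ^+ 2 + 4 * Z ^+ 2 = N -> (N %% 3)%Z = 1 ->
  exists U V W : int, [/\ unit6 U, unit6 V, unit6 W & U ^+ 2 + 2 * V ^+ 2 + 4 * W ^+ 2 = N].
Proof.
move=> X2 Y2 Z2 def_N N3.
case: (sqr_mod3 X) => -[X3 sX]; case: (sqr_mod3 Y) => -[Y3 sY]; case: (sqr_mod3 Z) => -[Z3 sZ];
  try (exfalso; move: (X ^+ 2) (Y ^+ 2) (Z ^+ 2) sX sY sZ def_N; clear -N3; lia).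
- have [V [W [V6 W6 e]]] := unit6_descent trisection2 X2 Y2 X3 Y3.
  by exists V, W, Z; split=> //; rewrite -def_N e.
- have [V [W [V6 W6 e]]] := unit6_descent trisection2 Y2 Z2 Y3 Z3.
  exists X, V, W; split=> //; rewrite -def_N.
  by transitivity (X ^+ 2 + 2 * (V ^+ 2 + 2 * W ^+ 2)); [ring | rewrite e; ring].
- by exists X, Y, Z.
Qed.

(** With [u], [v] odd and [w] even, [(u + w)^2 + (u - w)^2 + 2 v^2] doubles a sum of three squares
    and has odd coordinates. *)
Lemma universal_1_1_2 : universal 1 1 2 5 5 5.
Proof.
apply: universal_of_units => n n_ge0.
have [||x [y [z def_N]]] := @three_squares_int (12 * n + 2); [lia | constructor 2; lia |].
have [|u [v [w [_ u2 v2 w2 def_uvw]]]] := @two_odd_squares xpredT x y z _ isT isT isT (esym def_N); first by lia.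
have [|||||X [Y [Z [X6 Y6 Z6 e]]]] := @units_11c 2 (u + w) (u - w) v (24 * n + 4) trisection2 (erefl _);
  try (clear -u2 v2 w2; lia).
  transitivity (2 * (u ^+ 2 + v ^+ 2 + w ^+ 2)); first by ring.
  by rewrite def_uvw; ring.
by exists X, Y, Z; split=> //; rewrite !mul1r e.
Qed.

(** The target [24 n + 6] is divisible by 3, so units modulo 3 are secured first; then the even
    coordinate is 2 modulo 4 because the target is 6 modulo 8, and half of it is odd. *)
Lemma universal_1_1_4 : universal 1 1 4 5 5 5.
Proof.
apply: universal_of_units => n n_ge0.
have [||x [y [z def_N]]] := @three_squares_int (24 * n + 6); [lia | constructor 2; lia |].
have [||u [v [w [u3 v3 w3 def_uvw]]]] := units3_of_three_squares (esym def_N); [lia | lia |].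
have [|X [Y [Z' [[X3 [Y3 Z3]] X2 Y2 Z2 e]]]] :=
  two_odd_squares (P := fun t => (t %% 3)%Z != 0) u3 v3 w3 def_uvw; first by clear; lia.
have Z4 : (Z' %% 4)%Z = 2.
  case: (sqr_mod4 X) => -[X2' sX]; first by clear -X2 X2'; lia.
  case: (sqr_mod4 Y) => -[Y2' sY]; first by clear -Y2 Y2'; lia.
  case: (sqr_mod16 Z') => -[Z4 sZ] //; exfalso; move: (X ^+ 2) (Y ^+ 2) (Z' ^+ 2) sX sY sZ e;
    clear; lia.
have [Z def_Z] : exists t, Z' = 2 * t by exists (Z' %/ 2)%Z; clear -Z4; lia.
exists X, Y, Z; split=> //; last by rewrite -[RHS]e def_Z; ring.
by clear -def_Z Z3 Z4; split; lia.
Qed.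

(** The even coordinates satisfy [v^2 + w^2 = 4] modulo 8, so exactly one is 2 modulo 4 and the half
    sum [a] and half difference [v - a] are odd; twice the sum of their squares is [v^2 + w^2]. *)
Lemma universal_1_2_2 : universal 1 2 2 5 5 5.
Proof.
apply: universal_of_units => n n_ge0.
have [||x [y [z def_N]]] := @three_squares_int (24 * n + 5); [lia | constructor 1; lia |].
have [|u [v [w [u2 v2 w2 e]]]] := one_odd_square (esym def_N); first by clear; lia.
have vw4 : ((v + w) %% 4)%Z = 2.
  case: (sqr_mod4 u) => -[u2' su]; first by clear -u2 u2'; lia.
  case: (sqr_mod16 v) => -[v4 sv]; try (exfalso; clear -v4 v2; lia);
  case: (sqr_mod16 w) => -[w4 sw]; try (exfalso; clear -w4 w2; lia);
  move: (u ^+ 2) (v ^+ 2) (w ^+ 2) su sv sw e; clear -v4 w4; lia.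
have [a def_a] : exists a, v + w = 2 * a by exists ((v + w) %/ 2)%Z; clear -vw4; lia.
have def_w : w = 2 * a - v by rewrite -def_a addrC addKr.
have [|||||X [Y [Z [X6 Y6 Z6 eXYZ]]]] := @units_122 u a (v - a) (24 * n + 5);
  try (clear -u2 v2 w2 vw4 def_w; lia).
  by rewrite -e def_w; ring.
by exists X, Y, Z; split=> //; rewrite mul1r eXYZ.
Qed.

(** Twice the target is [u^2 + v^2 + w^2]. Modulo 16 the odd squares are 1 and 9, so after a sign
    change [u - v] is 4 modulo 8; then [(u + v) / 2], [w / 2] and [(u - v) / 4] are odd. *)
Lemma universal_1_2_4 : universal 1 2 4 5 5 5.
Proof.
apply: universal_of_units => n n_ge0.
have [||x [y [z def_N]]] := @three_squares_int (48 * n + 14); [lia | constructor 2; lia |].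
have [|u [v [w [_ u2 v2 w2 e]]]] := @two_odd_squares xpredT x y z _ isT isT isT (esym def_N).
  by clear; lia.
have [w4 uv8] : (w %% 4)%Z = 2 /\ (((u - v) %% 8)%Z = 4 \/ ((u + v) %% 8)%Z = 4).
  case: (sqr_mod16 u) => -[u4 su]; try (exfalso; clear -u4 u2; lia);
  case: (sqr_mod16 v) => -[v4 sv]; try (exfalso; clear -v4 v2; lia);
  case: (sqr_mod16 w) => -[w4 sw]; try (exfalso; clear -w4 w2; lia);
  try (exfalso; move: (u ^+ 2) (v ^+ 2) (w ^+ 2) su sv sw e; clear; lia);
  by split=> //; clear -u4 v4; lia.
wlog uv8' : v v2 e uv8 / ((u - v) %% 8)%Z = 4.
  move=> wlog_v; case: (uv8) => h; first exact: (wlog_v v).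
  by apply: (wlog_v (- v)); rewrite ?sqrrN ?opprK //; [clear -v2; lia | left].
have [d def_v] : exists d, v = u - 4 * d by exists ((u - v) %/ 4)%Z; clear -uv8'; lia.
have [b def_w] : exists b, w = 2 * b by exists (w %/ 2)%Z; clear -w4; lia.
have [|||||X [Y [Z [X6 Y6 Z6 eXYZ]]]] := @units_124 (u - 2 * d) b d (24 * n + 7);
  try (clear -u2 v2 w4 uv8' def_v def_w; lia).
  have two_neq0 : (2 : int) != 0 by [].
  apply: (mulfI two_neq0).
  transitivity (u ^+ 2 + v ^+ 2 + w ^+ 2); first by rewrite def_v def_w; ring.
  by rewrite e; ring.
by exists X, Y, Z; split=> //; rewrite mul1r eXYZ.
Qed.

(** In a representation of five times the target, some coordinate is divisible by 5 and the other
    two satisfy [a = 2 b] or [a = - 2 b] modulo 5. Dividing [a^2 + b^2] by 5 is division by a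
    Gaussian integer of norm 5, which gives [X^2 + (2 X - b)^2]. *)
Lemma universal_1_1_5 : universal 1 1 5 5 5 5.
Proof.
apply: universal_of_units => n n_ge0.
have [||x [y [z def_N]]] := @three_squares_int (120 * n + 35); [lia | constructor 3; lia |].
have [x2 y2 z2] : [/\ (x %% 2)%Z = 1, (y %% 2)%Z = 1 & (z %% 2)%Z = 1].
  case: (sqr_mod4 x) => -[x2 sx]; case: (sqr_mod4 y) => -[y2 sy]; case: (sqr_mod4 z) => -[z2 sz];
    try (exfalso; move: (x ^+ 2) (y ^+ 2) (z ^+ 2) sx sy sz def_N; clear; lia).
  by [].
have sol a b c : (a %% 2)%Z = 1 -> (b %% 2)%Z = 1 -> (c %% 2)%Z = 1 -> (c %% 5)%Z = 0 ->
    ((a + 2 * b) %% 5)%Z = 0 -> a ^+ 2 + b ^+ 2 + c ^+ 2 = 120 * n + 35 ->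
    exists X Y Z : int, [/\ unit6 X, unit6 Y, unit6 Z
       & 1 * X ^+ 2 + 1 * Y ^+ 2 + 5 * Z ^+ 2 = 24 * n + 7].
  move=> a2 b2 c2 c5 ab5 e.
  have [X def_a] : exists X, a = 5 * X - 2 * b by exists ((a + 2 * b) %/ 5)%Z; clear -ab5; lia.
  have [Z def_c] : exists Z, c = 5 * Z by exists (c %/ 5)%Z; clear -c5; lia.
  have [|||||U [V [W [U6 V6 W6 eUVW]]]] := @units_11c 5 X (2 * X - b) Z (24 * n + 7) trisection5 (erefl _);
    try (clear -a2 b2 c2 def_a def_c; lia).
    have five_neq0 : (5 : int) != 0 by [].
    apply: (mulfI five_neq0).
    transitivity (a ^+ 2 + b ^+ 2 + c ^+ 2); first by rewrite def_a def_c; ring.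
    by rewrite e; ring.
  by exists U, V, W; split=> //; rewrite !mul1r.
have sol' a b c : (a %% 2)%Z = 1 -> (b %% 2)%Z = 1 -> (c %% 2)%Z = 1 -> (c %% 5)%Z = 0 ->
    ((a + 2 * b) %% 5)%Z = 0 \/ ((a - 2 * b) %% 5)%Z = 0 ->
    a ^+ 2 + b ^+ 2 + c ^+ 2 = 120 * n + 35 ->
    exists X Y Z : int, [/\ unit6 X, unit6 Y, unit6 Z
       & 1 * X ^+ 2 + 1 * Y ^+ 2 + 5 * Z ^+ 2 = 24 * n + 7].
  move=> a2 b2 c2 c5 [] ab5 e; first exact: (sol a b c).
  by apply: (sol a (- b) c); rewrite ?sqrrN ?mulrN //; clear -b2; lia.
case: (sqr_mod5 x) => -[x5 sx]; case: (sqr_mod5 y) => -[y5 sy]; case: (sqr_mod5 z) => -[z5 sz];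
  try (exfalso; move: (x ^+ 2) (y ^+ 2) (z ^+ 2) sx sy sz def_N; clear; lia).
- by apply: (sol' x y z) => //; clear -x5 y5; lia.
- by apply: (sol' y z x) => //; [clear -y5 z5; lia | rewrite [RHS]def_N; ring].
- by apply: (sol' y z x) => //; [clear -y5 z5; lia | rewrite [RHS]def_N; ring].
- by apply: (sol' x z y) => //; [clear -x5 z5; lia | rewrite [RHS]def_N; ring].
- by apply: (sol' x y z) => //; clear -x5 y5; lia.
- by apply: (sol' x z y) => //; [clear -x5 z5; lia | rewrite [RHS]def_N; ring].
- by apply: (sol' x y z) => //; clear -x5 y5; lia.
Qed.

(** * The triple (1, 3, 6) *)

Definition bad_at (x y z : int) :=
  ((x %% 9)%Z == 0) && (((y - z) %% 9)%Z == 0) || ((x %% 9)%Z == 0) && (((y + z) %% 9)%Z == 0).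

(** The residues modulo 9 that obstruct every choice of order and signs in [splits_some]. *)
Definition bad (x y z : int) := [|| bad_at x y z, bad_at y x z | bad_at z x y].

Lemma bad_atC (x y z : int) : bad_at x y z = bad_at x z y.
Proof.
rewrite /bad_at [z + y]addrC; congr (_ && _ || _).
by apply/eqP/eqP => /dvdz_mod0P d9; apply/dvdz_mod0P; rewrite -opprB rpredN.
Qed.

Lemma bad_swap (x y z : int) : bad x y z = bad y x z.
Proof. by rewrite /bad [bad_at z y x]bad_atC orbCA. Qed.

Lemma bad_rot (x y z : int) : bad z x y = bad x y z.
Proof. by rewrite /bad [bad_at x z y]bad_atC [bad_at y z x]bad_atC orbC orbA. Qed.

(* Under these conditions [X ^+ 2 + A ^+ 2 + 2 * B ^+ 2 = X ^+ 2 + 3 * (Y ^+ 2 + 2 * Z ^+ 2)]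
   with [Y = (A + 2 * B) / 3] and [Z = (B - A) / 3], both prime to 3. *)
Definition splits (A B : int) :=
  [&& ((A - B) %% 3)%Z == 0, ((A - B) %% 9)%Z != 0 & ((A + 2 * B) %% 9)%Z != 0].

Definition splits_some (o e f : int) :=
  [|| splits (o + e) f, splits (o - e) f, splits (- o + e) f, splits (- o - e) f,
      splits (o + f) e, splits (o - f) e, splits (- o + f) e | splits (- o - f) e].

Lemma splits_some_residues :
  all (fun o => all (fun e => all (fun f =>
     ((o ^+ 2 + e ^+ 2 + f ^+ 2) %% 3 == 2)%Z ==> ~~ bad o e f ==> splits_some o e f)
   (map Posz (iota 0 9))) (map Posz (iota 0 9))) (map Posz (iota 0 9)).
Proof. by vm_compute. Qed.

Lemma splits_some_of_not_bad (o e f : int) :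
  ((o ^+ 2 + e ^+ 2 + f ^+ 2) %% 3)%Z = 2 -> ~~ bad o e f -> splits_some o e f.
Proof.
have residue (x : int) : exists2 r : int, r \in map Posz (iota 0 9) & exists k, x = r + 9 * k.
  exists (x %% 9)%Z; last by exists (x %/ 9)%Z; lia.
  have : (0 <= x %% 9)%Z by lia.
  have : (x %% 9 < 9)%Z by lia.
  by case: (x %% 9)%Z => // r; rewrite ltz_nat => r9 _; rewrite mem_map ?mem_iota // => i j [].
have [o' o'_in [i def_o]] := residue o; have [e' e'_in [j def_e]] := residue e.
have [f' f'_in [k def_f]] := residue f.
move/allP/(_ _ o'_in)/allP/(_ _ e'_in)/allP/(_ _ f'_in): splits_some_residues.
have mod9 (x y t : int) : x = y + 9 * t -> (x %% 9 = y %% 9)%Z by clear; lia.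
have mod3 (x y t : int) : x = y + 9 * t -> (x %% 3 = y %% 3)%Z by clear; lia.
have splits_eq a a' b b' s t : a = a' + 9 * s -> b = b' + 9 * t -> splits a b = splits a' b'.
  move=> -> ->; have d1 : a' + 9 * s - (b' + 9 * t) = a' - b' + 9 * (s - t) by ring.
  have d2 : a' + 9 * s + 2 * (b' + 9 * t) = a' + 2 * b' + 9 * (s + 2 * t) by ring.
  by rewrite /splits (mod3 _ _ _ d1) (mod9 _ _ _ d1) (mod9 _ _ _ d2).
have bad_at_eq a a' b b' c c' s t u : a = a' + 9 * s -> b = b' + 9 * t -> c = c' + 9 * u ->
    bad_at a b c = bad_at a' b' c'.
  move=> -> -> ->; have d1 : b' + 9 * t - (c' + 9 * u) = b' - c' + 9 * (t - u) by ring.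
  have d2 : b' + 9 * t + (c' + 9 * u) = b' + c' + 9 * (t + u) by ring.
  by rewrite /bad_at (mod9 _ a' s) // (mod9 _ _ _ d1) (mod9 _ _ _ d2).
rewrite /bad (bad_at_eq _ _ _ _ _ _ _ _ _ def_o def_e def_f).
rewrite (bad_at_eq _ _ _ _ _ _ _ _ _ def_e def_o def_f) (bad_at_eq _ _ _ _ _ _ _ _ _ def_f def_o def_e).
have <- : ((o ^+ 2 + e ^+ 2 + f ^+ 2) %% 3 = (o' ^+ 2 + e' ^+ 2 + f' ^+ 2) %% 3)%Z.
  rewrite (mod3 _ (o' ^+ 2 + e' ^+ 2 + f' ^+ 2)
    (2 * o' * i + 9 * i ^+ 2 + 2 * e' * j + 9 * j ^+ 2 + 2 * f' * k + 9 * k ^+ 2)) //.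
  by rewrite def_o def_e def_f; ring.
move=> check3 o3 nbad; move: check3; rewrite o3 eqxx nbad !implyTb /splits_some.
rewrite (splits_eq (o + e) (o' + e') f f' (i + j) k) //; last by rewrite def_o def_e; ring.
rewrite (splits_eq (o - e) (o' - e') f f' (i - j) k) //; last by rewrite def_o def_e; ring.
rewrite (splits_eq (- o + e) (- o' + e') f f' (- i + j) k) //; last by rewrite def_o def_e; ring.
rewrite (splits_eq (- o - e) (- o' - e') f f' (- i - j) k) //; last by rewrite def_o def_e; ring.
rewrite (splits_eq (o + f) (o' + f') e e' (i + k) j) //; last by rewrite def_o def_f; ring.
rewrite (splits_eq (o - f) (o' - f') e e' (i - k) j) //; last by rewrite def_o def_f; ring.
rewrite (splits_eq (- o + f) (- o' + f') e e' (- i + k) j) //; last by rewrite def_o def_f; ring.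
by rewrite (splits_eq (- o - f) (- o' - f') e e' (- i - k) j) //; rewrite def_o def_f; ring.
Qed.

(* Reflecting a bad triple in the plane orthogonal to (1, 1, 1), after a possible sign change of
   [x], lowers the power of 3 dividing [x + y + z] until the triple is no longer bad. *)
Lemma reflect_bad (k : nat) (x y z : int) : (x %% 9)%Z = 0 -> ((y + z) %% 9)%Z = 0 ->
    (y %% 3)%Z != 0 -> ~~ (27 * 3 ^+ k %| x + y + z)%Z ->
  exists u v w : int, ~~ bad u v w /\ u ^+ 2 + v ^+ 2 + w ^+ 2 = x ^+ 2 + y ^+ 2 + z ^+ 2.
Proof.
elim: k x y z => [|k IHk] x y z x9 yz9 y3.
  rewrite mulr1 => ndvd; have [t def_s] : exists t, x + y + z = 3 * t.
    by exists ((x + y + z) %/ 3)%Z; clear -x9 yz9; lia.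
  have t9 : (t %% 3 = 0)%Z /\ (t %% 9)%Z != 0.
    by clear -ndvd def_s x9 yz9; split; [lia | rewrite def_s in ndvd; lia].
  (* Here 3 divides [t] and 9 does not, so [x - 2 t] is nonzero modulo 9, while the other two
     coordinates stay prime to 3: none of the three can be the one that makes the triple bad. *)
  exists (x - 2 * t), (y - 2 * t), (z - 2 * t); split.
    by clear -t9 x9 yz9 y3; rewrite /bad /bad_at; lia.
  transitivity (x ^+ 2 + y ^+ 2 + z ^+ 2 + 4 * t * (3 * t - (x + y + z))); first by ring.
  by rewrite def_s subrr mulr0 addr0.
set m : int := 27 * 3 ^+ k in IHk; have -> : 27 * 3 ^+ k.+1 = 3 * m by rewrite exprS /m; ring.
move=> ndvd; have [dvd_s|] := boolP (m %| x + y + z)%Z; last exact: IHk.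
have [dvd_s'|ndvd_s'] := boolP (m %| - x + y + z)%Z; last first.
  have [|u [v [w [nbad e]]]] := IHk (- x) y z _ yz9 y3 ndvd_s'; first by clear -x9; lia.
  by exists u, v, w; rewrite e sqrrN.
have [t def_s] : exists t, x + y + z = 3 * t.
  by exists ((x + y + z) %/ 3)%Z; clear -x9 yz9; lia.
have m27 : (27 %| m)%Z by rewrite /m dvdz_mulr.
have t9 : (t %% 9)%Z = 0.
  by have := dvdz_trans m27 dvd_s; rewrite def_s; clear; lia.
have ndvd_t : ~~ (m %| t)%Z by apply: contra ndvd => dvd_t; rewrite def_s dvdz_mul.
(* After the reflection and the change of the first sign, the sum of the coordinates is
   [(- x + y + z) - 2 t]. Modulo [m] this is [t], because [m] divides both [- x + y + z] and
   [3 t]. *)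
have [||||u [v [w [nbad e]]]] := IHk (- (x - 2 * t)) (y - 2 * t) (z - 2 * t).
- by clear -x9 t9; lia.
- by clear -yz9 t9; lia.
- by clear -y3 t9; lia.
- apply: contra ndvd_t => dvd_r.
  have -> : t = (- (x - 2 * t) + (y - 2 * t) + (z - 2 * t)) - (- x + y + z) + (x + y + z).
    by rewrite def_s; ring.
  by apply: rpredD => //; apply: rpredB.
exists u, v, w; split=> //; rewrite e.
transitivity (x ^+ 2 + y ^+ 2 + z ^+ 2 + 4 * t * (3 * t - (x + y + z))); first by ring.
by rewrite def_s subrr mulr0 addr0.
Qed.

Lemma not_dvd_large_power (s : int) : s != 0 -> ~~ (27 * 3 ^+ `|s|%N %| s)%Z.
Proof.
move=> s_neq0; apply/negP; rewrite dvdzE abszM abszX => /dvdn_leq.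
rewrite lt0n absz_eq0 s_neq0 => /(_ isT); rewrite leqNgt => /negP; apply.
apply: (@leq_trans (3 ^ `|s|)); first exact: ltn_expl.
by rewrite leq_pmull.
Qed.

(** The descent needs [x + y + z] or [- x + y + z] to be nonzero. Both vanish only for
    [(0, b, - b)], whose value [2 b^2] is even; hence the parity hypothesis. The residue 2 modulo 3
    makes [b] prime to 3. *)
Lemma not_bad_three_squares (x y z N : int) : x ^+ 2 + y ^+ 2 + z ^+ 2 = N ->
    (N %% 3)%Z = 2 -> (N %% 2)%Z = 1 ->
  exists u v w : int, ~~ bad u v w /\ u ^+ 2 + v ^+ 2 + w ^+ 2 = N.
Proof.
move=> def_N N3 N2.
have sol a b c : a ^+ 2 + b ^+ 2 + c ^+ 2 = N -> (a %% 9)%Z = 0 -> ((b + c) %% 9)%Z = 0 ->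
    exists u v w : int, ~~ bad u v w /\ u ^+ 2 + v ^+ 2 + w ^+ 2 = N.
  move=> e a9 bc9; have b3 : (b %% 3)%Z != 0.
    apply/eqP => b3; case: (sqr_mod3 a) => -[a3 sa]; last by clear -a3 a9; lia.
    case: (sqr_mod3 b) => -[b3' sb]; last by clear -b3 b3'; lia.
    case: (sqr_mod3 c) => -[c3 sc]; last by clear -b3 c3 bc9; lia.
    by move: (a ^+ 2) (b ^+ 2) (c ^+ 2) sa sb sc e; clear -N3; lia.
  have [s0|s_neq0] := eqVneq (a + b + c) 0; last first.
    have [u [v [w [nbad e']]]] := reflect_bad a9 bc9 b3 (not_dvd_large_power s_neq0).
    by exists u, v, w; rewrite e'.
  have [s0'|s_neq0'] := eqVneq (- a + b + c) 0; last first.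
    have Na9 : ((- a) %% 9)%Z = 0 by clear -a9; lia.
    have [u [v [w [nbad e']]]] := reflect_bad Na9 bc9 b3 (not_dvd_large_power s_neq0').
    by exists u, v, w; rewrite e' sqrrN.
  have a0 : a = 0 by clear -s0 s0'; lia.
  have c0 : c = - b by clear -s0 s0'; lia.
  exfalso; move: N2; rewrite -e a0 c0 sqrrN expr0n /= add0r; move: (b ^+ 2) => B; clear; lia.
have sol' a b c : a ^+ 2 + b ^+ 2 + c ^+ 2 = N -> bad_at a b c ->
    exists u v w : int, ~~ bad u v w /\ u ^+ 2 + v ^+ 2 + w ^+ 2 = N.
  move=> e /orP[] /andP[/eqP a9 /eqP bc9]; last exact: (sol a b c).
  by apply: (sol a b (- c)); rewrite ?sqrrN.
have [|nbad] := boolP (bad x y z); last by exists x, y, z.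
case/or3P; apply: sol'; rewrite -def_N; ring.
Qed.

(** Doubling [o^2 + e^2 + f^2 = 12 n + 5] gives [X^2 + A^2 + 2 B^2], with [X] and [A] the sum and
    difference of two coordinates up to sign and [B] the third. The condition [splits A B] then
    turns [A^2 + 2 B^2] into [3 Y^2 + 6 Z^2] with units. *)
Lemma universal_1_3_6 : universal 1 3 6 5 5 5.
Proof.
apply: universal_of_units => n n_ge0.
have [||x [y [z def_N]]] := @three_squares_int (12 * n + 5); [lia | constructor 1; lia |].
have [||x' [y' [z' [nbad' def_N']]]] := not_bad_three_squares (esym def_N).
- by clear; lia.
- by clear; lia.
have [o [e [f [nbad o2 e2 f2 eN]]]] : exists o e f : int, [/\ ~~ bad o e f, (o %% 2)%Z = 1,
    (e %% 2)%Z = 0, (f %% 2)%Z = 0 & o ^+ 2 + e ^+ 2 + f ^+ 2 = 12 * n + 5].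
  case: (sqr_mod4 x') => -[x2 sx]; case: (sqr_mod4 y') => -[y2 sy]; case: (sqr_mod4 z') => -[z2 sz];
    try (exfalso; move: (x' ^+ 2) (y' ^+ 2) (z' ^+ 2) sx sy sz def_N'; clear; lia).
  - by exists z', x', y'; split=> //; [rewrite bad_rot | rewrite -def_N'; ring].
  - by exists y', x', z'; split=> //; [rewrite bad_swap | rewrite -def_N'; ring].
  - by exists x', y', z'.
have sol X A B : (X %% 2)%Z = 1 -> (A %% 2)%Z = 1 -> (B %% 2)%Z = 0 -> splits A B ->
    X ^+ 2 + A ^+ 2 + 2 * B ^+ 2 = 24 * n + 10 -> exists X Y Z : int, [/\ unit6 X, unit6 Y, unit6 Z
       & 1 * X ^+ 2 + 3 * Y ^+ 2 + 6 * Z ^+ 2 = 24 * n + 10].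
  move=> X2 A2 B2 /and3P[/eqP AB3 AB9 AB9' eX].
  have [Z def_A] : exists Z, A = B - 3 * Z by exists ((B - A) %/ 3)%Z; clear -AB3; lia.
  have eX' : X ^+ 2 + 3 * ((B - Z) ^+ 2 + 2 * Z ^+ 2) = 24 * n + 10 by rewrite -eX def_A; ring.
  exists X, (B - Z), Z; split.
  - split=> //; apply/eqP => X3; case: (sqr_mod3 X) => -[X3' sX]; last by clear -X3 X3'; lia.
    by move: (X ^+ 2) ((B - Z) ^+ 2 + 2 * Z ^+ 2) sX eX'; clear; lia.
  - by clear -A2 B2 AB9 AB9' def_A; split; lia.
  - by clear -A2 B2 AB9 AB9' def_A; split; lia.
  - by rewrite -eX'; ring.
have e3 : ((o ^+ 2 + e ^+ 2 + f ^+ 2) %% 3)%Z = 2 by rewrite eN; clear; lia.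
have eN2 : 2 * (o ^+ 2 + e ^+ 2 + f ^+ 2) = 24 * n + 10 by rewrite eN; ring.
have := splits_some_of_not_bad e3 nbad; rewrite /splits_some.
case/orP=> [|/orP[|/orP[|/orP[|/orP[|/orP[|/orP[|]]]]]]].
- by move=> h; apply: (sol (o - e) _ _ _ _ _ h); [clear -o2 e2 f2; lia .. | rewrite -eN2; ring].
- by move=> h; apply: (sol (o + e) _ _ _ _ _ h); [clear -o2 e2 f2; lia .. | rewrite -eN2; ring].
- by move=> h; apply: (sol (o + e) _ _ _ _ _ h); [clear -o2 e2 f2; lia .. | rewrite -eN2; ring].
- by move=> h; apply: (sol (o - e) _ _ _ _ _ h); [clear -o2 e2 f2; lia .. | rewrite -eN2; ring].
- by move=> h; apply: (sol (o - f) _ _ _ _ _ h); [clear -o2 e2 f2; lia .. | rewrite -eN2; ring].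
- by move=> h; apply: (sol (o + f) _ _ _ _ _ h); [clear -o2 e2 f2; lia .. | rewrite -eN2; ring].
- by move=> h; apply: (sol (o + f) _ _ _ _ _ h); [clear -o2 e2 f2; lia .. | rewrite -eN2; ring].
- by move=> h; apply: (sol (o - f) _ _ _ _ _ h); [clear -o2 e2 f2; lia .. | rewrite -eN2; ring].
Qed.

(** * Triples excluded by small values *)

Lemma polygonal_ge_sqr (k : nat) (x : int) : (4 <= k)%N -> x ^+ 2 <= polygonal k x.
Proof.
move=> k4; rewrite -(ler_pM2l (isT : 0 < (2 : int))) polygonalE.
have -> : (k%:Z - 2) * x ^+ 2 - (k%:Z - 4) * x = 2 * x ^+ 2 + (k%:Z - 4) * (x ^+ 2 - x) by ring.
rewrite lerDl mulr_ge0 //; first by lia.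
by rewrite subr_ge0; have [x_le0|x_gt0] := lerP x 0; nia.
Qed.

Lemma polygonal_ge0 (k : nat) (x : int) : (4 <= k)%N -> 0 <= polygonal k x.
Proof. by move=> k4; apply: le_trans (polygonal_ge_sqr x k4); apply: sqr_ge0. Qed.

(** After 0 and 1 the next value is the one at -1, namely [k - 3]; for [k >= 12] it is at least
    9. *)
Lemma polygonal_gap (k : nat) (x : int) : (4 <= k)%N ->
  [\/ polygonal k x = 0, polygonal k x = 1 | k%:Z - 3 <= polygonal k x].
Proof.
move=> k4; have e := polygonalE k x.
have [x0|[x1|x_far]] : x = 0 \/ x = 1 \/ (x <= -1 \/ 2 <= x) by lia.
- by constructor 1; rewrite x0 in e *; move: e; rewrite expr0n /= !mulr0; lia.
- by constructor 2; rewrite x1 in e *; move: e; rewrite expr1n !mulr1; lia.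
constructor 3; rewrite -(ler_pM2l (isT : 0 < (2 : int))) e.
have -> : (k%:Z - 2) * x ^+ 2 - (k%:Z - 4) * x = 2 * x ^+ 2 + (k%:Z - 4) * (x ^+ 2 - x) by ring.
have x2 : 2 <= x ^+ 2 - x by case: x_far; nia.
have x1 : 1 <= x ^+ 2 by case: x_far; nia.
have : (k%:Z - 4) * 2 <= (k%:Z - 4) * (x ^+ 2 - x) by rewrite ler_wpM2l //; lia.
by lia.
Qed.

(** For [k >= 4] the value at [x] is at least [x^2], so all values below [144 = 12^2] come from
    absolute values of [x] up to 11. *)
Definition small_values (k : nat) : seq nat :=
  [seq v <- [seq `|polygonal k x|%N | x <- map Posz (iota 0 12) ++ map (fun i => - i%:Z) (iota 1 11)]
   | v < 144]%N.

Lemma small_valuesP (k : nat) (x : int) : (4 <= k)%N -> polygonal k x < 144 ->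
  `|polygonal k x|%N \in small_values k.
Proof.
move=> k4 P_lt; rewrite mem_filter -ltz_nat gez0_abs ?polygonal_ge0 // P_lt andTb.
apply: (map_f (fun x => `|polygonal k x|%N)).
have x2 : x ^+ 2 < 12 ^+ 2 by apply: le_lt_trans (polygonal_ge_sqr x k4) P_lt.
have x_lt : `|x| < 12 by rewrite -(ltr_pXn2r (isT : (0 < 2)%N)) ?nnegrE // real_normK ?num_real.
rewrite mem_cat; case: x x_lt {x2 P_lt} => i lt_i.
  by apply/orP; left; apply/mapP; exists i => //; rewrite mem_iota; move: lt_i; lia.
apply/orP; right; apply/mapP; exists i.+1; last by rewrite NegzE.
by rewrite mem_iota; move: lt_i; lia.
Qed.

(* Unlike [has], this stops at the first witness under call-by-value evaluation. *)
Definition some_in (T : Type) (p : pred T) (s : seq T) : bool := (find p s < size s)%N.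

Lemma some_inE (T : Type) (p : pred T) (s : seq T) : some_in p s = has p s.
Proof. by rewrite has_find. Qed.

Definition representable (s : seq nat) (a b c n : nat) : bool :=
  some_in (fun u => some_in (fun v => some_in (fun w => a * u + b * v + c * w == n)%N s) s) s.

Lemma representableP (s : seq nat) (a b c n : nat) :
  reflect (exists u v w, [/\ u \in s, v \in s, w \in s & a * u + b * v + c * w = n]%N)
    (representable s a b c n).
Proof.
rewrite /representable some_inE; apply: (iffP hasP) => [[u u_in]|[u [v [w [u_in v_in w_in e]]]]].
  rewrite some_inE => /hasP[v v_in]; rewrite some_inE => /hasP[w w_in /eqP e].
  by exists u, v, w.
exists u => //; rewrite some_inE; apply/hasP; exists v => //.
by rewrite some_inE; apply/hasP; exists w; rewrite // e.
Qed.

Lemma universal_representable (k a b c n : nat) : (4 <= k)%N -> (0 < a)%N -> (0 < b)%N -> (0 < c)%N ->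
  universal a b c k k k -> (n < 144)%N -> representable (small_values k) a b c n.
Proof.
move=> k4 a0 b0 c0 univ n_lt; have [_ /(_ isT) [x [y [z e]]]] := univ n%:Z.
have [Px Py Pz] : [/\ 0 <= polygonal k x, 0 <= polygonal k y & 0 <= polygonal k z].
  by split; apply: polygonal_ge0.
have le_mul (d : nat) (t : int) : (0 < d)%N -> 0 <= t -> t <= d%:Z * t.
  by move=> d_gt0 t_ge0; rewrite ler_peMl //; lia.
have := le_mul a _ a0 Px; have := le_mul b _ b0 Py; have := le_mul c _ c0 Pz => lez ley lex.
have mem_x : `|polygonal k x|%N \in small_values k by apply: small_valuesP => //; lia.
have mem_y : `|polygonal k y|%N \in small_values k by apply: small_valuesP => //; lia.
have mem_z : `|polygonal k z|%N \in small_values k by apply: small_valuesP => //; lia.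
apply/representableP; exists `|polygonal k x|%N, `|polygonal k y|%N, `|polygonal k z|%N; split=> //.
by apply/eqP; rewrite -eqz_nat !PoszD !PoszM !gez0_abs // -e.
Qed.

Definition representable2 (s : seq nat) (a b n : nat) : bool :=
  some_in (fun u => some_in (fun v => a * u + b * v == n)%N s) s.

Lemma representable2P (s : seq nat) (a b n : nat) :
  reflect (exists u v, [/\ u \in s, v \in s & a * u + b * v = n]%N) (representable2 s a b n).
Proof.
rewrite /representable2 some_inE; apply: (iffP hasP) => [[u u_in]|[u [v [u_in v_in e]]]].
  by rewrite some_inE => /hasP[v v_in /eqP e]; exists u, v.
by exists u => //; rewrite some_inE; apply/hasP; exists v; rewrite // e.
Qed.

Lemma representable_last (s : seq nat) (a b c n : nat) :
  (n < c)%N -> representable s a b c n -> representable2 s a b n.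
Proof.
move=> lt_nc /representableP[u [v [w [u_in v_in _ e]]]]; apply/representable2P.
by exists u, v; split=> //; case: w e => [|w] e; [rewrite muln0 addn0 in e | nia].
Qed.

Lemma representable2_last (s : seq nat) (a b n : nat) :
  (n < b)%N -> representable2 s a b n -> n \in [seq (a * u)%N | u <- s].
Proof.
move=> lt_nb /representable2P[u [v [u_in _ e]]]; apply/mapP; exists u => //.
by case: v e => [|v] e; [rewrite muln0 addn0 in e | nia].
Qed.

(** Here [n1] is missed by [p_k], so [b <= n1], and [n2] by [p_k + b p_k], so [c <= n2].
    Conditionals replace conjunctions so that call-by-value evaluation skips the costly branch. *)
Definition escalation (k : nat) : bool :=
  let s := small_values k in
  some_in (fun n1 => if n1 \in s then false else all (fun b =>
    some_in (fun n2 => if representable2 s 1 b n2 then false else all (fun c =>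
      if (k == 5) && ((1, b, c)%N \in candidates) then true
      else some_in (fun n => ~~ representable s 1 b c n) (iota 0 144))
      (iota b (n2.+1 - b))) (iota 0 144))
    (iota 1 n1)) (iota 0 144).

Lemma escalation_holds : all escalation [:: 4; 5; 7; 8; 9; 10; 11]%N.
Proof. by vm_compute. Qed.

Lemma universal_first_coefficient (k a b c : nat) : (4 <= k)%N -> (0 < a)%N -> (a <= b)%N -> (b <= c)%N ->
  universal a b c k k k -> a = 1%N.
Proof.
move=> k4 a0 le_ab le_bc univ; have b0 := leq_trans a0 le_ab; have c0 := leq_trans b0 le_bc.
have /representableP[u [v [w [_ _ _ e]]]] :=
  universal_representable k4 a0 b0 c0 univ (isT : (1 < 144)%N).
have [a_le1|a_gt1] := leqP a 1; first by apply/eqP; rewrite eqn_leq a_le1.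
exfalso; case: u e => [|u] e; last by nia.
case: v e => [|v] e; last by nia.
by case: w e => [|w] e; nia.
Qed.

Lemma universal_escalation (k a b c : nat) : (4 <= k)%N -> escalation k ->
    (0 < a)%N -> (a <= b)%N -> (b <= c)%N -> universal a b c k k k ->
  k = 5%N /\ (a, b, c) \in candidates.
Proof.
move=> k4 esc a0 le_ab le_bc univ; have b0 := leq_trans a0 le_ab; have c0 := leq_trans b0 le_bc.
have repr n := @universal_representable k a b c n k4 a0 b0 c0 univ.
have a1 := universal_first_coefficient k4 a0 le_ab le_bc univ.
rewrite {}a1 in repr *.
move: esc; rewrite /escalation some_inE => /hasP[n1]; rewrite mem_iota => n1_lt.
case: ifP => // /negbT n1_miss /allP esc_b.
have le_bn1 : (b <= n1)%N.
  rewrite leqNgt; apply: contra n1_miss => lt_n1b.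
  have /repr/(representable_last (leq_trans lt_n1b le_bc))/(representable2_last lt_n1b) := n1_lt.
  by rewrite (eq_map (g := id)) ?map_id // => u; rewrite mul1n.
have /esc_b : b \in iota 1 n1 by rewrite mem_iota b0 add1n ltnS.
rewrite some_inE => /hasP[n2]; rewrite mem_iota => n2_lt; case: ifP => // /negbT n2_miss /allP esc_c.
have le_cn2 : (c <= n2)%N.
  rewrite leqNgt; apply: contra n2_miss => lt_n2c.
  exact: representable_last lt_n2c (repr n2 n2_lt).
have /esc_c : c \in iota b (n2.+1 - b).
  by rewrite mem_iota le_bc subnKC ?ltnS // (leq_trans le_bc) // leqW.
case: ifP => [/andP[/eqP-> ?] //|_]; rewrite some_inE => /hasP[n].
by rewrite mem_iota => n_lt /negP[]; apply: repr.
Qed.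

Lemma not_universal_large (k a b c : nat) : (12 <= k)%N ->
  (0 < a)%N -> (a <= b)%N -> (b <= c)%N -> ~ universal a b c k k k.
Proof.
move=> k12 a0 le_ab le_bc univ; have k4 : (4 <= k)%N by apply: leq_trans k12.
have a1 := universal_first_coefficient k4 a0 le_ab le_bc univ; rewrite {}a1 in le_ab univ.
have digit (d : nat) (t : int) : (0 < d)%N -> d%:Z * polygonal k t < 9 ->
    exists f : bool, d%:Z * polygonal k t = (f * d)%N.
  move=> d_gt0 dt; case: (polygonal_gap t k4) => e; rewrite ?e ?mulr0 ?mulr1.
  - by exists false.
  - by exists true; rewrite mul1n.
  by exfalso; nia.
have digits (n : nat) : (n < 9)%N -> exists e f g : bool, n = (e + f * b + g * c)%N.
  move=> n_lt; have [_ /(_ isT) [x [y [z e]]]] := univ n%:Z.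
  have Px : 0 <= 1%:Z * polygonal k x by rewrite mulr_ge0 ?polygonal_ge0.
  have Py : 0 <= b%:Z * polygonal k y by rewrite mulr_ge0 ?polygonal_ge0.
  have Pz : 0 <= c%:Z * polygonal k z by rewrite mulr_ge0 ?polygonal_ge0.
  have [||e' def_x] := digit 1%N x; [by [] | by lia |].
  have [||f' def_y] := digit b y; [by lia | by lia |].
  have [||g' def_z] := digit c z; [by lia | by lia |].
  by exists e', f', g'; apply/eqP; rewrite -eqz_nat e def_x def_y def_z muln1.
(* Representing 2 forces [b <= 2], representing 3 and 4 forces [c <= 4], and then 8 exceeds the
   largest sum [1 + 2 + 4]. *)
have [e2 [f2 [g2 d2]]] := digits 2 isT; have [e3 [f3 [g3 d3]]] := digits 3 isT.
have [e4 [f4 [g4 d4]]] := digits 4 isT; have [e8 [f8 [g8 d8]]] := digits 8 isT.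
have b_le2 : (b <= 2)%N.
  by clear -d2 le_ab le_bc; case: e2 f2 g2 d2 => [] [] []; lia.
have c_le4 : (c <= 4)%N.
  by clear -d3 d4 b_le2 le_ab le_bc; case: e3 f3 g3 d3 => [] [] [] d3; case: e4 f4 g4 d4 => [] [] [] d4; lia.
by clear -d8 b_le2 c_le4; case: e8 f8 g8 d8 => [] [] []; lia.
Qed.

Lemma universal_candidates (k a b c : nat) : (4 <= k)%N -> k <> 6%N ->
    (0 < a)%N -> (a <= b)%N -> (b <= c)%N -> universal a b c k k k ->
  k = 5%N /\ (a, b, c) \in candidates.
Proof.
move=> k4 k6 a0 le_ab le_bc univ.
have [k12|k_lt] := leqP 12 k; first by case: (not_universal_large k12 a0 le_ab le_bc univ).
apply: universal_escalation => //.
apply: (allP escalation_holds).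
by do 12?[case: k k4 k6 k_lt {univ} => [|k] //]; rewrite !inE; lia.
Qed.

Theorem theorem1p1 :
  (forall k a b c : nat,
     (4 <= k)%N -> k <> 6%N ->
     (0 < a)%N -> (0 < b)%N -> (0 < c)%N -> (a <= b)%N -> (b <= c)%N ->
     universal a b c k k k ->
     k = 5%N /\ (a, b, c) \in candidates)
  /\
  (universal 1 1 2 5 5 5 /\ universal 1 1 4 5 5 5 /\ universal 1 2 2 5 5 5 /\
   universal 1 2 4 5 5 5 /\ universal 1 1 5 5 5 5 /\ universal 1 3 6 5 5 5).
Proof.
split=> [k a b c k4 k6 a0 _ _ le_ab le_bc|]; first exact: universal_candidates.
split; first exact: universal_1_1_2.
split; first exact: universal_1_1_4.
split; first exact: universal_1_2_2.
split; first exact: universal_1_2_4.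
split; [exact: universal_1_1_5 | exact: universal_1_3_6].
Qed.
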